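(* Let $D$ be a divisor on $Y$. Then there exists a unique integral effective $\pi$-antieffective divisor $\tilde D$ satisfying (i) $\tilde D\geqslant D$, and (ii) for any $\pi$-antieffective divisor $D'$ such that $D'\geqslant D$, we have $D'\geqslant \tilde D$. Moreover, this divisor $\tilde D$ is equivalent to $D$.
   Context: Let $k$ be an algebraically closed field of characteristic zero and let $R$ be a regular local ring over $k$ of dimension at least $2$ such that $X=\operatorname{Spec} R$ is the germ of a smooth algebraic variety over $k$. Let $\mathfrak a$ be an ideal sheaf on $X$ and fix a log resolution $\pi:Y\to X$ of $(X,\mathfrak a)$, i.e. a birational morphism such that $Y$ is smooth, $\mathfrak a\cdot\mathcal O_Y=\mathcal O_Y(-F)$ for some effective Cartier divisor $F$, and $F+\mathrm{Exc}(\pi)$ is a simple normal crossing divisor. For divisors $D, D'$ on $Y$, $D'\geqslant D$ means that all coefficients of $D'-D$ are non-negative; a divisor is effective if all its coefficients are non-negative, and integral if all its coefficients are integers. A divisor $D$ on $Y$ with integral coefficients is called $\pi$-antieffective if and only if $H^0(E,\mathcal O_Y(-D)|_E)\neq 0$ for every $\pi$-exceptional prime divisor $E$ on $Y$, i.e. if and only if $-D|_E$ is a divisor class on $E$ containing an effective divisor. Here $\mathcal O_Y(-D)|_E$ denotes the pullback of $\mathcal O_Y(-D)$ to $E$ along the embedding $E\to Y$. Two divisors $D_1$ and $D_2$ on $Y$ are called equivalent if and only if they define the same ideal in $R$, i.e. if and only if $\pi_*\mathcal O_Y(-D_1)=\pi_*\mathcal O_Y(-D_2)$.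
   Formalization: The English fails for D = -div(π*f), f a nonzero nonunit: D is itself antieffective, so D̃ = D is not effective. Effectivity of D̃ is asserted only when π_*O_Y(-D) ⊆ R (exactly when it holds); all else is for every D. π is taken proper, as usual for log resolutions. *)

(* Defs.v *)
From HB Require Import structures.
From mathcomp Require Import all_boot all_order all_algebra.
From mathcomp Require Import boolp classical_sets functions cardinality.

Set Implicit Arguments.
Unset Strict Implicit.
Unset Printing Implicit Defensive.

Import Order.TTheory GRing.Theory Num.Theory.
Local Open Scope classical_set_scope.
Local Open Scope ring_scope.

(* An integral separated scheme with function field K is represented as in
   Zariski and EGA I, section 8 ("schemas de Chevalley"): by the set of its
   local rings, viewed as subrings of K.  A point of the scheme IS its local
   ring, so a scheme is a [set (set K)]; a point C is a specialization of a
   point B (lies in the closure of B) iff [C `<=` B].  Sheaves of fractional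
   ideals are subsheaves of the constant sheaf K. *)

Definition is_subring (K : fieldType) (A : set K) : Prop :=
  GRing.subring_closed [in A].

Definition is_submodule (K : fieldType) (A M : set K) : Prop :=
  [/\ M 0, (forall x y, M x -> M y -> M (x + y))
    & (forall a x, A a -> M x -> M (a * x))].

Definition is_ideal (K : fieldType) (A I : set K) : Prop :=
  is_submodule A I /\ I `<=` A.

Definition prime_ideal (K : fieldType) (A p : set K) : Prop :=
  [/\ is_ideal A p, ~ p 1
    & (forall x y, A x -> A y -> p (x * y) -> p x \/ p y)].

Definition span (K : fieldType) (A S : set K) : set K :=
  smallest (is_submodule A) S.

(* the product I * M, consisting of the finite sums of products *)
Definition mulset (K : fieldType) (A I M : set K) : set K :=
  span A [set x * y | x in I & y in M].

Definition noetherian (K : fieldType) (A : set K) : Prop :=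
  forall I, is_ideal A I -> exists s : seq K, I = span A [set` s].

Definition finite_type (K : fieldType) (B A : set K) : Prop :=
  exists s : seq K, A = smallest (@is_subring K) (B `|` [set` s]).

Definition localization (K : fieldType) (A p : set K) : set K :=
  [set x / y | x in A & y in A `\` p].

(* the local rings of Spec A *)
Definition Spec (K : fieldType) (A : set K) : set (set K) :=
  [set localization A p | p in prime_ideal A].

Definition nonunits (K : fieldType) (A : set K) : set K :=
  [set x | A x /\ ~ (exists2 y, A y & x * y = 1)].

Definition is_local (K : fieldType) (A : set K) : Prop :=
  is_subring A /\ is_ideal A (nonunits A).

(* chain of d.+1 primes *)
Definition prime_chain (K : fieldType) (A : set K) (d : nat) : Prop :=
  exists p : nat -> set K,
    (forall i, (i <= d)%N -> prime_ideal A (p i)) /\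
    (forall i, (i < d)%N -> p i `<` p i.+1).

Definition krull_dim (K : fieldType) (A : set K) (d : nat) : Prop :=
  prime_chain A d /\ ~ prime_chain A d.+1.

Definition regular_parameters (K : fieldType) (A : set K) (x : seq K) : Prop :=
  krull_dim A (size x) /\ nonunits A = span A [set` x].

Definition regular_local (K : fieldType) (A : set K) : Prop :=
  [/\ is_local A, noetherian A & exists x, regular_parameters A x].

(* R is a local ring, with fraction field K, of a smooth affine variety Spec A
   over k; since k is a perfect field, smooth over k means regular. *)
Definition smooth_germ (k K : fieldType) (iota : {rmorphism k -> K})
    (R : set K) : Prop :=
  [/\ exists A, [/\ finite_type (range iota) A,
        (forall B, Spec A B -> regular_local B) & Spec A R]
    & [set x / y | x in R & y in R] = setT].

Definition valuation_ring (K : fieldType) (V : set K) : Prop :=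
  is_subring V /\ (forall x, V x \/ V x^-1).

Definition dominates (K : fieldType) (V B : set K) : Prop :=
  B `<=` V /\ nonunits B `<=` nonunits V.

(* Y is an integral scheme of finite type over Spec R, birational to Spec R;
   the last clause is the valuative criterion of properness (uniqueness is
   separatedness). *)
Definition proper_model (K : fieldType) (R : set K) (Y : set (set K)) : Prop :=
  (exists (n : nat) (A : 'I_n -> set K),
     (forall i, finite_type R (A i)) /\ Y = \bigcup_i Spec (A i)) /\
  (forall V, valuation_ring V -> R `<=` V ->
     exists! B, Y B /\ dominates V B).

(* These sets, for s a finite sequence of rational functions, form a basis of
   the Zariski topology of Y. *)
Definition basic_open (K : fieldType) (Y : set (set K)) (s : seq K) :
    set (set K) :=
  [set C | Y C /\ [set` s] `<=` C].

(* A prime divisor is given by its generic point, a point of Y of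
    codimension one. *)

Definition prime_divisor (K : fieldType) (Y : set (set K)) (E : set K) : Prop :=
  Y E /\ krull_dim E 1.

(* The exceptional locus consists of the points of Y at which Y -> Spec R is
   not a local isomorphism. *)
Definition exceptional_locus (K : fieldType) (R : set K) (Y : set (set K)) :
    set (set K) :=
  Y `\` Spec R.

Definition exceptional (K : fieldType) (R : set K) (Y : set (set K))
    (E : set K) : Prop :=
  prime_divisor Y E /\ exceptional_locus R Y E.

(* The coefficients lie in an arbitrary archimedean domain, such as int, rat or
   a real field. *)
Definition is_divisor (K : fieldType) (Q : archiRealDomainType)
    (Y : set (set K)) (D : set K -> Q) : Prop :=
  finite_set [set E | D E != 0] /\ (forall E, D E != 0 -> prime_divisor Y E).

Definition div_le (K : fieldType) (Q : archiRealDomainType)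
    (D D' : set K -> Q) : Prop :=
  forall E, D E <= D' E.

Definition effective (K : fieldType) (Q : archiRealDomainType)
    (D : set K -> Q) : Prop :=
  forall E, 0 <= D E.

Definition integral (K : fieldType) (Q : archiRealDomainType)
    (D : set K -> Q) : Prop :=
  forall E, D E \is a Num.int.

(* ord_E f >= c, for E a discrete valuation ring *)
Definition ord_ge (K : fieldType) (Q : archiRealDomainType)
    (E : set K) (c : Q) (f : K) : Prop :=
  exists (t : K) (n : int),
    [/\ t != 0, nonunits E = span E [set t], c <= n%:~R & E (f / t ^ n)].

(* the sections over the open set U of the sheaf O_Y(-D) *)
Definition OYopp (K : fieldType) (Q : archiRealDomainType)
    (Y : set (set K)) (D : set K -> Q) (U : set (set K)) : set K :=
  [set f | forall E, prime_divisor Y E -> U E -> ord_ge E (D E) f].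

(* the stalk of O_Y(-D) at C *)
Definition OYopp_stalk (K : fieldType) (Q : archiRealDomainType)
    (Y : set (set K)) (D : set K -> Q) (C : set K) : set K :=
  [set f | exists2 s : seq K, basic_open Y s C & OYopp Y D (basic_open Y s) f].

(* pi_* O_Y(-D), an R-submodule of K that need not lie in R *)
Definition pushforward (K : fieldType) (Q : archiRealDomainType)
    (Y : set (set K)) (D : set K -> Q) : set K :=
  OYopp Y D Y.

Definition defines_ideal (K : fieldType) (Q : archiRealDomainType)
    (R : set K) (Y : set (set K)) (D : set K -> Q) : Prop :=
  is_ideal R (pushforward Y D).

Definition equivalent (K : fieldType) (Q : archiRealDomainType)
    (Y : set (set K)) (D1 D2 : set K -> Q) : Prop :=
  pushforward Y D1 = pushforward Y D2.

(* the stalk at C of the ideal sheaf of the prime divisor E through C *)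
Definition ideal_stalk (K : fieldType) (E C : set K) : set K :=
  nonunits E `&` C.

(* The reduced divisor whose components form the set S has simple normal
   crossings: at each point, its components are cut out by members of a regular
   system of parameters. *)
Definition snc (K : fieldType) (Y S : set (set K)) : Prop :=
  forall C, Y C -> exists2 x : seq K, regular_parameters C x &
    forall E, S E -> C `<=` E ->
      exists2 t, t \in x & ideal_stalk E C = span C [set t].

Definition log_resolution (K : fieldType) (R a : set K) (Y : set (set K)) :
    Prop :=
  [/\ proper_model R Y,
      (forall C, Y C -> regular_local C)
    & exists F : set K -> int,
      [/\ is_divisor Y F, effective F,
          (forall C, Y C -> span C a = OYopp_stalk Y F C),
          (* Exc(pi) is a divisor *)
          (forall C, exceptional_locus R Y C ->
             exists2 E, exceptional R Y E & C `<=` E)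
        & snc Y [set E | prime_divisor Y E /\ (F E != 0 \/ exceptional R Y E)]]].

(* the stalk at C of I_E * O_Y(-D) *)
Definition IE_OYopp_stalk (K : fieldType) (Q : archiRealDomainType)
    (Y : set (set K)) (D : set K -> Q) (E C : set K) : set K :=
  mulset C (ideal_stalk E C) (OYopp_stalk Y D C).

(* Global sections over E of the restriction O_Y(-D)|_E, which is the sheaf
   O_Y(-D) / I_E O_Y(-D) on E: a section is a family of germs (s C), with C
   ranging over the points of E and s C taken modulo I_E O_Y(-D), that lifts
   locally to sections of O_Y(-D). *)
Definition restricted_section (K : fieldType) (Q : archiRealDomainType)
    (Y : set (set K)) (D : set K -> Q) (E : set K) (s : set K -> K) : Prop :=
  forall C0, Y C0 -> C0 `<=` E ->
    exists2 u : seq K, basic_open Y u C0 &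
    exists2 f, OYopp Y D (basic_open Y u) f &
    forall C, basic_open Y u C -> C `<=` E -> IE_OYopp_stalk Y D E C (s C - f).

Definition H0_restriction_neq0 (K : fieldType) (Q : archiRealDomainType)
    (Y : set (set K)) (D : set K -> Q) (E : set K) : Prop :=
  exists2 s, restricted_section Y D E s &
    exists C, [/\ Y C, C `<=` E & ~ IE_OYopp_stalk Y D E C (s C)].

Definition antieffective (K : fieldType) (Q : archiRealDomainType)
    (R : set K) (Y : set (set K)) (D : set K -> Q) : Prop :=
  [/\ is_divisor Y D, integral D
    & forall E, exceptional R Y E -> H0_restriction_neq0 Y D E].

(* Main.v *)
(* The divisor [Dt] is the pointwise minimum of all antieffective divisors above [D].
   A minimum of antieffective divisors is antieffective: if [D2 <= D1] agree at an
   exceptional [E], then [O_Y(-D1)|_E] embeds into [O_Y(-D2)|_E]. Every nonzero [f] in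
   [pi_* O_Y(-D)] bounds [Dt] from above: take [ord_E f] at the exceptional [E] and
   round [D] up elsewhere; the restriction of [f] itself is the nonzero section. Hence
   [Dt] exists and defines the same ideal as [D].

   If [pi_* O_Y(-D)] lies in [R], then [Dt] is effective off the exceptional locus, and
   a negativity lemma applies. Let [E0] be a component of the negative part [N] with
   minimal center [p], maximizing [n_E / ord_E f] for some [f] in [p]. A suitable product
   of powers of [f] and of a section of [O_Y(N)|_E0] is a regular function on [E0], which
   is proper over the residue field of [p], so this function is algebraic and vanishes
   nowhere: [div f] is proportional to [N] near [E0]. Choosing [f] well, this holds for
   every function in place of [f], so every function of order zero along [E0] is a unit
   near [E0] and has algebraic residue; this contradicts the transcendence of the residue
   field of [E0] over that of [p], a point of codimension at least two. The facts used on
   regular local rings are proved with derivations, which exist in abundance in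
   characteristic zero. *)

Require Import Defs.
From HB Require Import structures.
From mathcomp Require Import all_boot all_order all_algebra.
From mathcomp Require Import boolp classical_sets functions cardinality.
From mathcomp Require Import ring zify.
Set Implicit Arguments.
Unset Strict Implicit.
Unset Printing Implicit Defensive.
Import Order.TTheory GRing.Theory Num.Theory.
Local Open Scope classical_set_scope.
Local Open Scope ring_scope.

Local Notation span := Defs.span.

(** [Y] is merely proper over [Spec R]: no ample divisor and no intersection form is at hand, so
    negativity cannot be read off from intersection numbers. Properness enters as the valuative
    criterion: a function with a pole on the closure of [E0] yields a valuation ring, whose center
    on [Y] is a point where regularity is contradicted. Orders control only points of codimension
    one, whence the need for [hartogs] at the others. All comparisons are made at points lying over
    [p] itself. Minimality of [p] forces each negative component through such a point to have center
    [p] as well, so a finite list of ratios decides every inequality. Choosing [f] well means that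
    its set of extremal components is as small as possible. Multiplying a high power of [f] by any
    [h] can only shrink that set, hence leaves it unchanged, and proportionality passes from [f] to
    [h]. Derivations stand in for dimension theory: a chain of [d.+1] primes gives [d] independent
    derivations. Depth at least two and the transcendence of residue fields both follow. *)

Lemma Zorn_above (T : Type) (P : set (set T)) (A0 : set T) : P A0 ->
  (forall F : set (set T), F `<=` P -> F !=set0 -> total_on F subset ->
     P (\bigcup_(X in F) X)) ->
  exists A, [/\ P A, A0 `<=` A & forall B, P B -> A `<=` B -> B = A].
Proof.
move=> PA0 chainP.
(* [Zorn_bigcup] also asks about the empty chain, whose union is [set0]; admitting [set0] takes care
   of it. *)
pose P' := [set X | X = set0 \/ P X /\ A0 `<=` X].
have [|A [P'A maxA]] := @Zorn_bigcup T P'.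
  move=> F FP' Ftot.
  have [[X [FX X0]]|noX] := pselect (exists X, F X /\ X !=set0); last first.
    left; apply/seteqP; split=> // x [X FX Xx]; apply: noX.
    by exists X; split=> //; exists x.
  right; pose F' := [set X | F X /\ X !=set0].
  have -> : \bigcup_(X in F) X = \bigcup_(X in F') X.
    apply/seteqP; split=> x [Z]; last by case=> FZ _ Zx; exists Z.
    by move=> FZ Zx; exists Z => //; split=> //; exists x.
  have F'P Z : F' Z -> P Z /\ A0 `<=` Z.
    by case=> FZ [z Zz]; case: (FP' Z FZ) => // Z0; move: Zz; rewrite Z0.
  split.
    apply: chainP => [Z /F'P[]//||Z W [FZ _] [FW _]]; last exact: Ftot.
    by exists X.
  by move=> x A0x; exists X => //; have [_] := F'P X (conj FX X0); apply.
have P'A0 : P' A0 by right; split.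
have [PA A0A] : P A /\ A0 `<=` A.
  case: P'A => // A_0; have [A00|/set0P A0n0] := eqVneq A0 set0.
    by rewrite A_0 -A00; split.
  case: (maxA A0) => //; rewrite A_0; split=> //.
  by case: A0n0 => x A0x /(_ x A0x).
exists A; split=> // B PB AB; apply: contrapT => BA.
apply: (maxA B); last by right; split=> //; apply: subset_trans AB.
by split=> // BsubA; apply: BA; apply/seteqP.
Qed.

(** * Subrings and localization *)

Section Rings.
Variable K : fieldType.
Implicit Types A B C I M P p q S : set K.

Lemma subringP A : is_subring A <->
  [/\ A 1, (forall x y, A x -> A y -> A (x - y))
    & (forall x y, A x -> A y -> A (x * y))].
Proof.
split=> [[A1 AB AM]|[A1 AB AM]]; split.
- by move: A1; rewrite inE.
- by move=> x y Ax Ay; have := AB x y; rewrite !inE; apply.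
- by move=> x y Ax Ay; have := AM x y; rewrite !inE; apply.
- by rewrite inE.
- by move=> x y; rewrite !inE; apply: AB.
- by move=> x y; rewrite !inE; apply: AM.
Qed.

Section SubringTheory.
Variables (A : set K) (rA : is_subring A).

Lemma subring1 : A 1. Proof. by case/subringP: rA. Qed.
Lemma subringB x y : A x -> A y -> A (x - y).
Proof. by case/subringP: rA => _ h _; apply: h. Qed.
Lemma subringM x y : A x -> A y -> A (x * y).
Proof. by case/subringP: rA => _ _; apply. Qed.
Lemma subring0 : A 0.
Proof. by rewrite -(subrr 1); apply: subringB; apply: subring1. Qed.
Lemma subringN x : A x -> A (- x).
Proof. by move=> Ax; rewrite -sub0r; apply: subringB => //; apply: subring0. Qed.
Lemma subringD x y : A x -> A y -> A (x + y).
Proof. by move=> Ax Ay; rewrite -[y]opprK; apply/subringB/subringN. Qed.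
Lemma subringX x n : A x -> A (x ^+ n).
Proof.
move=> Ax; elim: n => [|n IH]; first by rewrite expr0; apply: subring1.
by rewrite exprS; apply: subringM.
Qed.
Lemma subring_nat n : A n%:R.
Proof.
elim: n => [|n IH]; first exact: subring0.
by rewrite -natr1; apply: subringD => //; apply: subring1.
Qed.
Lemma subring_sum (J : Type) (r : seq J) (Q : pred J) (F : J -> K) :
  (forall i, Q i -> A (F i)) -> A (\sum_(i <- r | Q i) F i).
Proof. move=> AF; apply: big_ind => //; [exact: subring0 | exact: subringD]. Qed.
Lemma subring_submodule : is_submodule A A.
Proof. split; [exact: subring0 | exact: subringD | exact: subringM]. Qed.

Lemma submoduleN M x : is_submodule A M -> M x -> M (- x).
Proof.
by move=> [_ _ h] Mx; rewrite -mulN1r; apply: h => //; apply/subringN/subring1.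
Qed.
Lemma submoduleB M x y : is_submodule A M -> M x -> M y -> M (x - y).
Proof. by move=> hM Mx My; case: (hM) => _ h _; apply: h => //; apply: submoduleN. Qed.

End SubringTheory.

Lemma submodule_sum A M (J : Type) (r : seq J) (Q : pred J) (F : J -> K) :
  is_submodule A M ->
  (forall i, Q i -> M (F i)) -> M (\sum_(i <- r | Q i) F i).
Proof. by move=> [M0 MD _] MF; apply: big_ind. Qed.

Lemma span_submodule A S : is_submodule A (span A S).
Proof.
split=> [M [[]]//|x y Sx Sy M hM|a x Aa Sx M hM].
  by case: (hM) => [[_ MD _] _]; apply: MD; [apply: Sx | apply: Sy].
by case: (hM) => [[_ _ MZ] _]; apply: MZ => //; apply: Sx.
Qed.

Lemma sub_span A S : S `<=` span A S.
Proof. by move=> x Sx M [_]; apply. Qed.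

Lemma span_min A S M : is_submodule A M -> S `<=` M -> span A S `<=` M.
Proof. by move=> hM SM x; apply. Qed.

Lemma spanS A S S' : S `<=` S' -> span A S `<=` span A S'.
Proof.
by move=> SS; apply: span_min (span_submodule _ _) _ => x /SS; apply: sub_span.
Qed.

Lemma span_nil A : span A [set` [::]] = [set 0].
Proof.
apply/seteqP; split; last by move=> x ->; case: (span_submodule A [set` [::]]).
apply: span_min => //; split=> // [x y -> ->|a x _ ->]; first by rewrite addr0.
by rewrite mulr0.
Qed.

Lemma span_cons A t (s : seq K) : is_subring A ->
  span A [set` t :: s] = [set x | exists a y, [/\ A a, span A [set` s] y & x = a * t + y]].
Proof.
move=> rA; apply/seteqP; split.
  have [s0 sD sM] := span_submodule A [set` s].
  apply: span_min; first split.
  - by exists 0, 0; rewrite mul0r addr0; split=> //; apply: subring0.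
  - move=> _ _ [a [y [Aa Sy ->]]] [b [z [Ab Sz ->]]].
    exists (a + b), (y + z); split; [exact: subringD|exact: sD|by rewrite mulrDl addrACA].
  - move=> c _ Ac [a [y [Aa Sy ->]]]; exists (c * a), (c * y).
    by split; [exact: subringM|exact: sM|rewrite mulrDr mulrA].
  - move=> x /=; rewrite inE => /orP[/eqP->|xs].
      by exists 1, 0; rewrite mul1r addr0; split=> //; apply: subring1.
    exists 0, x; rewrite mul0r add0r; split=> //; first exact: subring0.
    exact: sub_span.
move=> _ [a [y [Aa Sy ->]]].
have [s0 sD sM] := span_submodule A [set` t :: s].
apply: sD; first by apply: sM => //; apply: sub_span; rewrite /= mem_head.
by apply: spanS Sy => z /=; rewrite inE orbC => ->.
Qed.

Lemma span1 A t : is_subring A -> span A [set t] = [set a * t | a in A].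
Proof.
move=> rA; have -> : [set t] = [set` [:: t]].
  by apply/seteqP; split=> x /=; rewrite inE => /eqP.
rewrite span_cons // span_nil; apply/seteqP; split=> x /=.
  by move=> [a [_ [Aa -> ->]]]; exists a; rewrite ?addr0.
by move=> [a Aa <-]; exists a, 0; rewrite addr0.
Qed.

Lemma bigcap_subring (J : Type) (P : set J) (F : J -> set K) :
  (forall i, P i -> is_subring (F i)) -> is_subring (\bigcap_(i in P) F i).
Proof.
move=> rF; apply/subringP; split=> [i Pi|x y Fx Fy i Pi|x y Fx Fy i Pi].
- exact: (subring1 (rF i Pi)).
- by apply: (subringB (rF i Pi)); [apply: Fx|apply: Fy].
- by apply: (subringM (rF i Pi)); [apply: Fx|apply: Fy].
Qed.

Lemma smallest_subring S : is_subring (smallest (@is_subring K) S).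
Proof. by apply: (@bigcap_subring _ _ id) => i []. Qed.

Lemma bigcup_subring (F : set (set K)) :
  F !=set0 -> total_on F subset -> (forall A, F A -> is_subring A) ->
  is_subring (\bigcup_(A in F) A).
Proof.
move=> [A0 FA0] Ftot rF.
have two x y : (\bigcup_(A in F) A) x -> (\bigcup_(A in F) A) y ->
    exists A, [/\ F A, A x & A y].
  move=> [A FA Ax] [B FB By]; case: (Ftot A B FA FB) => AB.
    by exists B; split=> //; apply: AB.
  by exists A; split=> //; apply: AB.
apply/subringP; split=> [|x y Fx Fy|x y Fx Fy].
- by exists A0 => //; exact: (subring1 (rF A0 FA0)).
- by have [A [FA Ax Ay]] := two x y Fx Fy; exists A => //; apply: (subringB (rF A FA)).
- by have [A [FA Ax Ay]] := two x y Fx Fy; exists A => //; apply: (subringM (rF A FA)).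
Qed.

Lemma prime_subset A p : prime_ideal A p -> p `<=` A.
Proof. by case=> -[_]. Qed.
Lemma prime0 A p : prime_ideal A p -> p 0.
Proof. by case=> -[[]]. Qed.
Lemma primeD A p x y : prime_ideal A p -> p x -> p y -> p (x + y).
Proof. by case=> -[[_ h _]] *; apply: h. Qed.
Lemma primeMl A p a x : prime_ideal A p -> A a -> p x -> p (a * x).
Proof. by case=> -[[_ _ h]] *; apply: h. Qed.
Lemma primeMr A p a x : prime_ideal A p -> A a -> p x -> p (x * a).
Proof. by rewrite mulrC; apply: primeMl. Qed.
Lemma prime_neq0 A p x : prime_ideal A p -> ~ p x -> x != 0.
Proof. by move=> pp px; apply/eqP => x0; apply: px; rewrite x0; apply: (prime0 pp). Qed.
Lemma primeMn A p x y : prime_ideal A p -> A x -> A y -> ~ p x -> ~ p y -> ~ p (x * y).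
Proof. by move=> [_ _ h] Ax Ay nx ny /(h _ _ Ax Ay)[]. Qed.
Lemma prime_zero A : is_subring A -> prime_ideal A [set 0].
Proof.
move=> rA; split=> [|/eqP|x y _ _ /= /eqP].
- split; last by move=> x ->; apply: subring0.
  by split=> // [x y -> ->|a x _ ->]; rewrite ?addr0 ?mulr0.
- by rewrite oner_eq0.
- by rewrite mulf_eq0 => /orP[/eqP|/eqP]; [left|right].
Qed.

Section Localization.
Variables (A p : set K) (rA : is_subring A) (pp : prime_ideal A p).

Lemma loc_sub : A `<=` localization A p.
Proof.
move=> x Ax; exists x => //; exists 1; last by rewrite divr1.
by split; [exact: subring1|case: pp].
Qed.

Lemma loc_subring : is_subring (localization A p).
Proof.
apply/subringP; split=> [|_ _ [x Ax [y [Ay py] <-]] [z Az [w [Aw pw] <-]]|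
   _ _ [x Ax [y [Ay py] <-]] [z Az [w [Aw pw] <-]]].
- exact: (loc_sub (subring1 rA)).
- have y0 := prime_neq0 pp py; have w0 := prime_neq0 pp pw.
  exists (x * w - z * y); first by apply: subringB => //; apply: subringM.
  exists (y * w); last by field; rewrite ?y0 ?w0.
  by split; [exact: subringM|exact: (primeMn pp Ay Aw py pw)].
- exists (x * z); first exact: subringM.
  exists (y * w); last by rewrite mulf_div.
  by split; [exact: subringM|exact: (primeMn pp Ay Aw py pw)].
Qed.

Lemma loc_inv y : A y -> ~ p y -> localization A p y^-1.
Proof.
by move=> Ay py; exists 1; [exact: subring1|exists y => //; rewrite mul1r].
Qed.

(** The extension of the ideal [q] of [A] to the localization at [p]. *)
Definition locp q := [set x / y | x in q & y in A `\` p].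

Lemma locpI q : prime_ideal A q -> q `<=` p -> locp q `&` A = q.
Proof.
move=> pq qp; apply/seteqP; split=> [_ [[x qx [y [Ay py] <-]] Axy]|x qx].
  have y0 := prime_neq0 pp py.
  case: (pq) => _ _ /(_ (x / y) y Axy Ay); rewrite divfK //.
  by case=> // /qp.
split; last exact: (prime_subset pq qx).
exists x => //; exists 1; last by rewrite divr1.
by split; [exact: subring1|case: pp].
Qed.

Lemma locp_prime q : prime_ideal A q -> q `<=` p -> prime_ideal (localization A p) (locp q).
Proof.
move=> pq qp; split; first split; first split.
- by exists 0; [exact: (prime0 pq)|exists 1; rewrite ?mul0r//; split; [exact: subring1|case: pp]].
- move=> _ _ [x qx [y [Ay py] <-]] [z qz [w [Aw pw] <-]].
  have y0 := prime_neq0 pp py; have w0 := prime_neq0 pp pw.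
  exists (x * w + z * y).
    by apply: (primeD pq); apply: (primeMr pq).
  exists (y * w); last by field; rewrite ?y0 ?w0.
  by split; [exact: subringM|exact: (primeMn pp Ay Aw py pw)].
- move=> _ _ [x Ax [y [Ay py] <-]] [z qz [w [Aw pw] <-]].
  exists (x * z); first exact: (primeMl pq).
  exists (y * w); last by rewrite mulf_div.
  by split; [exact: subringM|exact: (primeMn pp Ay Aw py pw)].
- move=> _ [x qx [y [Ay py] <-]]; exists x; first exact: (prime_subset pq qx).
  by exists y.
- move=> q1; have : (locp q `&` A) 1 by split=> //; exact: subring1.
  by rewrite locpI //; case: pq.
- move=> _ _ [x Ax [y [Ay py] <-]] [z Az [w [Aw pw] <-]].
  have y0 := prime_neq0 pp py; have w0 := prime_neq0 pp pw.
  move=> [u qu [v [Av pv]]]; have v0 := prime_neq0 pp pv.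
  rewrite mulf_div => /(congr1 (fun e => e * (v * (y * w)))) e.
  have {}e : v * (x * z) = u * (y * w).
    move: e; rewrite (_ : u / v * _ = u * (y * w)); last by field; rewrite ?v0 ?w0 ?y0.
    by rewrite (_ : x * z / _ * _ = v * (x * z)); last by field; rewrite ?v0 ?w0 ?y0.
  have : q (v * (x * z)) by rewrite e; apply: (primeMr pq) => //; exact: subringM.
  case: (pq) => _ _ h /(h _ _ Av (subringM rA Ax Az))[/qp//|/(h _ _ Ax Az)[qx|qz]].
    by left; exists x => //; exists y.
  by right; exists z => //; exists w.
Qed.

Lemma loc_nonunits : nonunits (localization A p) = locp p.
Proof.
apply/seteqP; split=> [_ [[x Ax [y [Ay py] <-]] nu]|_ [x px [y [Ay py] <-]]].
  have y0 := prime_neq0 pp py.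
  exists x; last by exists y.
  apply: contrapT => px; apply: nu; exists (y / x); first by exists y => //; exists x.
  by rewrite mulf_div [y * x]mulrC divff // mulf_neq0 // (prime_neq0 pp px).
have y0 := prime_neq0 pp py.
split; first by exists x; [exact: (prime_subset pp px)|exists y].
move=> [_ [z Az [w [Aw pw] <-]]]; have w0 := prime_neq0 pp pw.
rewrite mulf_div => /(congr1 (fun e => e * (y * w))); rewrite mul1r divfK ?mulf_neq0 // => e.
by apply: (primeMn pp Ay Aw py pw); rewrite -e; exact: (primeMr pp).
Qed.

Lemma loc_local : is_local (localization A p).
Proof.
split; first exact: loc_subring.
by rewrite loc_nonunits; case: (locp_prime pp).
Qed.

Lemma loc_nonunitsI : nonunits (localization A p) `&` A = p.
Proof. by rewrite loc_nonunits locpI. Qed.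

End Localization.

Lemma prime_contract A B q : is_subring A -> A `<=` B -> prime_ideal B q ->
  prime_ideal A (q `&` A).
Proof.
move=> rA AB pq; split; first split; first split.
- by split; [exact: (prime0 pq)|exact: subring0].
- by move=> x y [qx Ax] [qy Ay]; split; [exact: (primeD pq)|exact: subringD].
- by move=> a x Aa [qx Ax]; split; [apply: (primeMl pq); first apply: AB|exact: subringM].
- by move=> x [].
- by case=> q1 _; case: pq.
- move=> x y Ax Ay [qxy _]; case: (pq) => _ _ /(_ _ _ (AB _ Ax) (AB _ Ay) qxy).
  by case; [left|right].
Qed.

(** This is what makes the set of points of a model stable under localization, and every
    localization of [R] a local ring of the affine variety. *)
Lemma loc_loc A p q : is_subring A -> prime_ideal A p ->
  prime_ideal (localization A p) q ->
  localization (localization A p) q = localization A (q `&` A).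
Proof.
move=> rA pp pq; have AL := loc_sub rA pp; have rL := loc_subring rA pp.
apply/seteqP; split=> [_ [_ [x Ax [y [Ay py] <-]] [_ [[z Az [w [Aw pw] <-]] qzw]] <-]|].
  have y0 := prime_neq0 pp py; have w0 := prime_neq0 pp pw.
  have z0 : z != 0.
    by apply/eqP => z0; apply: qzw; rewrite z0 mul0r; apply: (prime0 pq).
  exists (x * w); first exact: subringM.
  exists (y * z); last by field; rewrite ?w0 ?y0 ?z0.
  split; first exact: subringM.
  move=> [qyz _]; case: (pq) => _ _ /(_ _ _ (AL _ Ay) (AL _ Az) qyz)[qy|qz].
    case: (pq) => _ + _; apply; rewrite -(divff y0); apply: (primeMr pq _ qy).
    exact: loc_inv.
  by apply: qzw; apply: (primeMr pq _ qz); exact: loc_inv.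
move=> _ [x Ax [y [Ay qy] <-]]; exists x; first exact: AL.
by exists y => //; split; [exact: AL|move=> ?; apply: qy].
Qed.

Section Local.
Variables (C : set K) (lC : is_local C).
Let rC : is_subring C := lC.1.

Lemma nonunit_inv x : C x -> ~ nonunits C x -> C x^-1.
Proof.
move=> Cx nx; have [y Cy xy1] : exists2 y, C y & x * y = 1.
  by apply: contrapT => ny; apply: nx.
have x0 : x != 0 by apply: contra_eq_neq xy1 => ->; rewrite mul0r eq_sym oner_neq0.
by rewrite -[x^-1]mulr1 -xy1 mulKf.
Qed.

Lemma nonunitP x : nonunits C x <-> C x /\ (x = 0 \/ ~ C x^-1).
Proof.
split=> [nx|[Cx [->|nx]]].
- have [Cx nu] := nx; split=> //; have [->|x0] := eqVneq x 0; first by left.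
  by right=> Cx'; apply: nu; exists x^-1; rewrite ?divff.
- split; first exact: subring0.
  by move=> [y _]; rewrite mul0r => /eqP; rewrite eq_sym oner_eq0.
- by split=> // -[y Cy xy]; apply: nx; rewrite (mulr1_eq xy).
Qed.

Lemma nonunits_prime : prime_ideal C (nonunits C).
Proof.
split=> [||x y Cx Cy nxy]; first by case: lC.
  by case=> _; apply; exists 1; [exact: subring1|rewrite mulr1].
apply: contrapT => /not_orP[nx ny].
case: nxy => _; apply; exists (x^-1 * y^-1); first by apply: subringM => //; exact: nonunit_inv.
have x0 : x != 0 by apply/eqP => x0; apply: nx; apply/nonunitP; rewrite x0; split; [exact: subring0|left].
have y0 : y != 0 by apply/eqP => y0; apply: ny; apply/nonunitP; rewrite y0; split; [exact: subring0|left].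
by rewrite mulrACA !divff // mulr1.
Qed.

Lemma prime_sub_nonunits q : prime_ideal C q -> q `<=` nonunits C.
Proof.
move=> pq x qx; split; first exact: (prime_subset pq qx).
by move=> [y Cy xy1]; case: (pq) => _ + _; apply; rewrite -xy1; exact: (primeMr pq).
Qed.

Lemma nonunit_add1 x : nonunits C x -> C (1 + x)^-1 /\ 1 + x != 0.
Proof.
move=> nx; have pm := nonunits_prime.
have n1x : ~ nonunits C (1 + x).
  move=> n1; case: (pm) => _ + _; apply; rewrite -[1](addrK x).
  by apply: (submoduleB rC (M := nonunits C)) => //; case: lC => _ [].
split; first by apply: nonunit_inv => //; apply: subringD => //; [exact: subring1|case: nx].
exact: (prime_neq0 pm n1x).
Qed.

End Local.
End Rings.

Lemma seq_tail (T : eqType) (t : T) (s : seq T) : [set` s] `<=` [set` t :: s].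
Proof. by move=> x xs; rewrite /= inE orbC (_ : x \in s). Qed.

Lemma seq_head (T : eqType) (t : T) (s : seq T) : [set` t :: s] t.
Proof. by rewrite /= mem_head. Qed.

(** * Noetherian rings *)

Section Noetherian.
Variable K : fieldType.
Implicit Types A B C I J M P p q S : set K.

Lemma chain_seq (F : set (set K)) (s : seq K) : F !=set0 -> total_on F subset ->
  [set` s] `<=` \bigcup_(X in F) X -> exists2 X, F X & [set` s] `<=` X.
Proof.
move=> [X0 FX0] Ftot; elim: s => [|t s IH] sF; first by exists X0.
have [|X FX sX] := IH; first by move=> x xs; apply: sF; rewrite /= inE orbC (_ : x \in s).
have [Y FY tY] : (\bigcup_(X in F) X) t by apply: sF; rewrite /= mem_head.
case: (Ftot X Y FX FY) => XY; [exists Y => //|exists X => //] => x /=;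
  rewrite inE => /orP[/eqP->|/sX] //; exact: XY.
Qed.

Lemma noetherian_max A (P : set (set K)) I0 : noetherian A ->
  (forall I, P I -> is_ideal A I) -> P I0 ->
  exists I, [/\ P I, I0 `<=` I & forall J, P J -> I `<=` J -> J = I].
Proof.
move=> nA Pid PI0; apply: Zorn_above => // F FP F0 Ftot.
have [X0 FX0] := F0.
have [s sE] : exists s : seq K, \bigcup_(X in F) X = span A [set` s].
  apply: nA; split; last by move=> x [X /FP/Pid[_ XA] /XA].
  split.
  - by exists X0 => //; have [[]] := Pid _ (FP _ FX0).
  - move=> x y [X FX Xx] [Y FY Yy].
    case: (Ftot X Y FX FY) => XY; [exists Y => //|exists X => //].
      by have [[_ h _] _] := Pid _ (FP _ FY); apply: h => //; apply: XY.
    by have [[_ h _] _] := Pid _ (FP _ FX); apply: h => //; apply: XY.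
  - move=> a x Aa [X FX Xx]; exists X => //.
    by have [[_ _ h] _] := Pid _ (FP _ FX); apply: h.
have [|X FX sX] := @chain_seq F s F0 Ftot; first by rewrite sE; exact: sub_span.
rewrite (_ : \bigcup_(X in F) X = X); first exact: FP.
apply/seteqP; split=> [|x Xx]; last by exists X.
by rewrite sE; apply: span_min sX; case: (Pid _ (FP _ FX)).
Qed.

Lemma noetherian_stable A (I : nat -> set K) : noetherian A ->
  (forall n, is_ideal A (I n)) -> (forall n, I n `<=` I n.+1) ->
  exists N, forall n, (N <= n)%N -> I n = I N.
Proof.
move=> nA idI incI.
have [||_ [[N _ <-] _ maxN]] := @noetherian_max A (range I) (I 0%N) nA _ _.
- by move=> _ [n _ <-].
- by exists 0%N.
exists N => n Nn; apply: maxN; first by exists n.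
rewrite -(subnK Nn); elim: (n - N)%N => [|k IH] //; rewrite addSn.
by apply: subset_trans IH _; exact: incI.
Qed.

(** Two ascending chains replace Artin-Rees. The colon ideals [J n] of [I] by [x ^+ n] stabilize at
    some [m], so [a n] agrees with [x * a n.+1] modulo [J m] for [n] at least [m]. The ideals
    generated by [J m] and [a (m + n)] then ascend as well, and where they stop, the last [a] lies
    in [J m] up to the unit [1 - x * c]. *)
Lemma krull_intersection C I x b : is_local C -> noetherian C -> is_ideal C I ->
  nonunits C x -> (forall n, exists i a, [/\ I i, C a & b = i + x ^+ n * a]) ->
  I b.
Proof.
move=> lC nC idI nx /choice[i /choice[a hb]].
have rC := lC.1; have Cx : C x by case: nx.
have [[I0 ID IM] IC] := idI.
have IB u v : I u -> I v -> I (u - v) by apply: (submoduleB rC).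
pose J n := [set c | C c /\ I (x ^+ n * c)].
have idJ n : is_ideal C (J n).
  split; last by move=> c [].
  split=> [|u v [Cu Iu] [Cv Iv]|u v Cu [Cv Iv]].
  - by split; rewrite ?mulr0//; exact: subring0.
  - by split; [exact: subringD|rewrite mulrDr; exact: ID].
  - by split; [exact: subringM|rewrite mulrCA; exact: IM].
have incJ n : J n `<=` J n.+1.
  by move=> c [Cc Ic]; split=> //; rewrite exprS -mulrA; exact: IM.
have [m Jm] := noetherian_stable nC idJ incJ.
have step n : (m <= n)%N -> J m (a n - x * a n.+1).
  move=> mn; rewrite -(Jm n mn); have [In Can bn] := hb n.
  have [In1 Can1 bn1] := hb n.+1.
  split; first by apply: subringB => //; exact: subringM.
  have -> : x ^+ n * (a n - x * a n.+1) = i n.+1 - i n.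
    have -> : x ^+ n * (a n - x * a n.+1) = i n + x ^+ n * a n - i n - x ^+ n.+1 * a n.+1.
      by rewrite exprS; ring.
    by rewrite -bn bn1; ring.
  exact: IB.
pose G n := [set y | exists c j, [/\ C c, J m j & y = j + a (m + n)%N * c]].
have [[J0 JD JM] JC] := idJ m.
have idG n : is_ideal C (G n).
  have [_ Can _] := hb (m + n)%N.
  split; last first.
    move=> _ [c [j [Cc Jj ->]]]; apply: subringD => //; first exact: JC.
    exact: subringM.
  split=> [|_ _ [c [j [Cc Jj ->]]] [c' [j' [Cc' Jj' ->]]]|u _ Cu [c [j [Cc Jj ->]]]].
  - by exists 0, 0; rewrite mulr0 addr0; split=> //; exact: subring0.
  - exists (c + c'), (j + j'); split; [exact: subringD|exact: JD|by rewrite mulrDr addrACA].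
  - by exists (u * c), (u * j); split; [exact: subringM|exact: JM|rewrite mulrDr mulrCA].
have [|N GN] := noetherian_stable nC idG.
  move=> n _ [c [j [Cc Jj ->]]].
  exists (x * c), (j + (a (m + n)%N - x * a (m + n).+1) * c); split.
  - exact: subringM.
  - by apply: (JD) => //; rewrite mulrC; apply: (JM) => //; apply: step; exact: leq_addr.
  - by rewrite addnS; ring.
have [c [j [Cc Jj e]]] : G N (a (m + N.+1)%N).
  rewrite -(GN N.+1 (leqnSn N)); exists 1, 0; rewrite mulr1 add0r.
  by split=> //; exact: subring1.
have nxc : nonunits C (- (x * c)).
  apply: (submoduleN rC); first by case: lC => _ [].
  by rewrite mulrC; case: lC => _ [[_ _ h] _]; apply: h.
have [inv1 ne1] := nonunit_add1 lC nxc.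
have Ja : J m (a (m + N.+1)%N).
  have -> : a (m + N.+1)%N =
      (1 + - (x * c))^-1 * (j + (a (m + N)%N - x * a (m + N).+1) * c).
    apply: (mulfI ne1); rewrite mulVKf //; move: e; rewrite addnS => e.
    by rewrite mulrBl mulrBl mul1r {1}e; ring.
  apply: (JM) => //; apply: (JD) => //; rewrite mulrC; apply: (JM) => //.
  by apply: step; exact: leq_addr.
have [Ii Ca ->] := hb (m + N.+1)%N.
apply: (ID) => //; rewrite exprD [_ * x ^+ _]mulrC -mulrA.
by apply: (IM); [exact: subringX|case: Ja].
Qed.

(* [M + nonunits C * span C w] *)
Fixpoint addm C M (w : seq K) : set K :=
  if w is t :: w' then
    [set z | exists a y, [/\ nonunits C a, addm C M w' y & z = a * t + y]]
  else M.

Section Nakayama.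
Variables (C M : set K) (lC : is_local C) (hM : is_submodule C M).
Let rC : is_subring C := lC.1.
Let mC : is_submodule C (nonunits C).
Proof. by case: lC => _ []. Qed.

Lemma addm_submodule (w : seq K) : is_submodule C (addm C M w).
Proof.
have [m0 mD mM] := mC.
elim: w => //= t w [i0 iD iM]; split.
- by exists 0, 0; rewrite mul0r addr0.
- move=> _ _ [a [y [Ca hy ->]]] [b [z [Cb hz ->]]]; exists (a + b), (y + z).
  by split; [exact: mD|exact: iD|rewrite mulrDl addrACA].
- move=> c _ Cc [a [y [Ca hy ->]]]; exists (c * a), (c * y).
  by split; [exact: mM|exact: iM|rewrite mulrDr mulrA].
Qed.

Lemma addm_base (w : seq K) : M `<=` addm C M w.
Proof.
elim: w => //= t w IH x /IH hx; exists 0, x; rewrite mul0r add0r; split=> //.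
by case: mC.
Qed.

Lemma addmM (w : seq K) a x : nonunits C a -> span C [set` w] x -> addm C M w (a * x).
Proof.
move=> na; elim: w x => [|t w IH] x.
  by rewrite span_nil => ->; rewrite mulr0; case: hM.
rewrite span_cons // => -[c [y [Cc /IH hy ->]]].
exists (c * a), (a * y); split=> //; last by ring.
by case: mC => _ _; apply.
Qed.

(** The head satisfies [t = a * t + y] with [a] a nonunit. Dividing by the unit [1 - a] expresses it
    by the remaining generators, which removes one generator at a time. *)
Lemma nakayama (w : seq K) : [set` w] `<=` addm C M w -> [set` w] `<=` M.
Proof.
elim: w => // t w IH hw.
have [_ _ aM] := addm_submodule w; have [_ aD _] := addm_submodule w.
have addt : addm C M w t.
  have [|a [y [na hy e]]] := hw t; first by rewrite /= mem_head.
  have [inv1 ne1] := nonunit_add1 lC (submoduleN rC mC na).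
  rewrite (_ : t = (1 + - a)^-1 * y); first exact: aM.
  by apply: (mulfI ne1); rewrite mulVKf // mulrBl mul1r {1}e addrAC subrr add0r.
have wM : [set` w] `<=` M.
  apply: IH => u uw; have [|a [y [na hy ->]]] := hw u.
    by rewrite /= inE orbC (_ : u \in w).
  by apply: (aD) => //; apply: (aM) => //; case: na.
have sub : addm C M w `<=` M.
  elim: (w) wM => [_ x //|v v' IHv wM _ /= [a [y [na hy ->]]]].
  case: hM => _ MD MM; apply: MD; last first.
    by apply: IHv hy => u uv; apply: wM; rewrite /= inE orbC (_ : u \in v').
  by apply: MM; [case: na|apply: wM; rewrite /= mem_head].
by move=> u /=; rewrite inE => /orP[/eqP->|/wM//]; exact: sub.
Qed.

End Nakayama.

(** For a subring [J] this is the ring [J[x]]; for an ideal [J] of a ring [V] it is the extension of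
    [J] to [V[x]]. *)
Definition adjoin J (x : K) : set K :=
  [set p.[x] | p in [set p : {poly K} | forall i, J p`_i]].

Lemma poly_coefM A M (p q : {poly K}) : is_submodule A M ->
  (forall i, A p`_i) -> (forall i, M q`_i) -> forall i, M (p * q)`_i.
Proof.
move=> hM Ap Mq i; rewrite coefM; apply: (submodule_sum _ hM) => j _.
by case: (hM) => _ _; apply.
Qed.

Lemma adjoin_submodule A M x : is_submodule A M -> is_submodule (adjoin A x) (adjoin M x).
Proof.
move=> hM; have [M0 MD MM] := hM; split.
- by exists 0; rewrite ?horner0 // => i; rewrite coef0.
- move=> _ _ [p Mp <-] [q Mq <-]; exists (p + q); rewrite ?hornerD// => i.
  by rewrite coefD; apply: MD.
- move=> _ _ [p Ap <-] [q Mq <-]; exists (p * q); rewrite ?hornerM//.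
  exact: (poly_coefM hM Ap Mq).
Qed.

Lemma adjoin_base A x : A 0 -> A `<=` adjoin A x.
Proof.
move=> A0 a Aa; exists a%:P; rewrite ?hornerC// => i.
by rewrite coefC; case: eqP.
Qed.

Lemma adjoin_mem A x : is_subring A -> adjoin A x x.
Proof.
move=> rA; exists 'X; rewrite ?hornerX// => i; rewrite coefX.
exact: subring_nat.
Qed.

Lemma adjoin_subring A x : is_subring A -> is_subring (adjoin A x).
Proof.
move=> rA; have [_ hD hM] := adjoin_submodule x (subring_submodule rA).
apply/subringP; split=> //.
  by apply: adjoin_base; [exact: subring0|exact: subring1].
move=> _ _ [p Ap <-] [q Aq <-]; exists (p - q); first by move=> i; rewrite coefB; exact: subringB.
by rewrite hornerD hornerN.
Qed.

Lemma adjoin_sub A B x : is_subring B -> A `<=` B -> B x -> adjoin A x `<=` B.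
Proof.
move=> rB AB Bx _ [p Ap <-]; rewrite horner_coef; apply: subring_sum => // i _.
by apply: subringM => //; [exact/AB|exact: subringX].
Qed.

End Noetherian.

(** * Extension of valuations *)

Section Chevalley.
Variable K : fieldType.
Implicit Types A B C I J M V P p q S : set K.

Lemma span_id A M : is_submodule A M -> span A M = M.
Proof.
move=> hM; apply/seteqP; split; last exact: sub_span.
exact: span_min.
Qed.

Section ValuationStep.
Variables (V J : set K) (hJ : is_ideal V J).
Hypothesis unit1 : forall b, J b -> 1 - b != 0 /\ V (1 - b)^-1.

Lemma adjoin_inv_proper (x : K) (n m : nat) (p q : {poly K}) : x != 0 -> ~ J 1 ->
  (forall i, J p`_i) -> (forall i, J q`_i) ->
  (size p <= n.+1)%N -> (size q <= m.+1)%N -> (m <= n)%N ->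
  p.[x] = 1 -> q.[x^-1] = 1 ->
  exists2 p' : {poly K}, (forall i, J p'`_i) & (size p' <= n)%N /\ p'.[x] = 1.
Proof.
move=> x0 J1 Jp Jq sp sq mn px qx; have [[J0 JD JM] JV] := hJ.
have [ne1 inv1] := unit1 (Jq 0%N).
pose b j := (1 - q`_0)^-1 * q`_j.
have Jb j : J (b j) by apply: (JM).
exists (\poly_(i < n) (p`_i + p`_n * b (n - i)%N)).
  move=> i; rewrite coef_poly; case: ifP => _ //.
  by apply: (JD) => //; apply: (JM) => //; exact: JV.
split; first exact: size_poly.
rewrite horner_poly.
have qE : \sum_(j < n) b j.+1 * x^-1 ^+ j.+1 = 1.
  have e : 1 - q`_0 = \sum_(j < n) q`_j.+1 * x^-1 ^+ j.+1.
    rewrite -[X in X - _]qx (horner_coef_wide _ (leq_trans sq (mn : (m < n.+1)%N))).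
    by rewrite big_ord_recl /= expr0 mulr1 addrC addKr.
  apply: (mulfI ne1); rewrite mulr1 mulr_sumr [RHS]e.
  by apply: eq_bigr => j _; rewrite /b mulrA mulVKf.
rewrite -px (horner_coef_wide _ sp) big_ord_recr /=.
under eq_bigr do rewrite mulrDl.
rewrite big_split /=; congr (_ + _).
rewrite -[X in _ = p`_n * X]mulr1 -qE (reindex_inj rev_ord_inj) /= !mulr_sumr.
apply: eq_bigr => j _; rewrite subKn // -!mulrA; congr (_ * _).
have -> : x ^+ (n - j.+1) = x ^+ n * x^-1 ^+ j.+1; last by rewrite /b; ring.
by apply: (mulIf (expf_neq0 j.+1 x0)); rewrite -exprD subnK // exprVn divfK ?expf_neq0.
Qed.

End ValuationStep.

Lemma adjoin_inv_absurd V J (x : K) : is_ideal V J ->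
  (forall b, J b -> 1 - b != 0 /\ V (1 - b)^-1) -> x != 0 -> ~ J 1 ->
  adjoin J x 1 -> adjoin J x^-1 1 -> False.
Proof.
move=> hJ unit1 x0 J1 [p Jp px] [q Jq qx].
have [k] := ubnP (size p + size q)%N.
elim: k x x0 p q Jp Jq px qx => // k IH x x0 p q Jp Jq px qx sk.
wlog mn : x x0 p q Jp Jq px qx sk / (size q <= size p)%N.
  move=> wh; case: (leqP (size q) (size p)) => [|/ltnW] h; first exact: (wh x x0 p q).
  by apply: (wh x^-1 _ q p) => //; rewrite ?invr_eq0 ?invrK // addnC.
have sp : size p = (size p).-1.+1.
  case: (size p) (size_poly_eq0 p) => // /esym/eqP p0.
  by move: px; rewrite p0 horner0 => /eqP; rewrite eq_sym oner_eq0.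
have sq : size q = (size q).-1.+1.
  case: (size q) (size_poly_eq0 q) => // /esym/eqP p0.
  by move: qx; rewrite p0 horner0 => /eqP; rewrite eq_sym oner_eq0.
have [||| p' Jp' [sp' p'x]] := @adjoin_inv_proper V J hJ unit1 x (size p).-1 (size q).-1 p q x0 J1 Jp Jq _ _ _ px qx.
- by rewrite -sp.
- by rewrite -sq.
- by rewrite -ltnS -sp -sq.
by apply: (IH x x0 p' q) => //; apply: (@leq_trans (size p + size q)) => //; rewrite ltn_add2r sp ltnS.
Qed.

(** Chevalley's argument: a subring [V] maximal among those in which [I] generates a proper ideal is
    a valuation ring. If neither [x] nor [x^-1] were in [V], then [I] would generate the unit ideal
    both in [V[x]] and in [V[x^-1]]. *)
Theorem valuation_extension A I : is_subring A -> is_ideal A I -> ~ I 1 ->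
  exists V, [/\ valuation_ring V, A `<=` V & I `<=` nonunits V].
Proof.
move=> rA [hI IA] I1.
have [||V [[rV V1] AV maxV]] := @Zorn_above K [set B | is_subring B /\ ~ span B I 1] A.
- by split=> //; rewrite span_id.
- move=> F FP F0 Ftot.
  have rU : is_subring (\bigcup_(X in F) X) by apply: bigcup_subring => // X /FP[].
  split=> // sp1.
  suff [X FX sX1] : (\bigcup_(X in F) span X I) 1 by have [_] := FP X FX.
  apply: span_min sp1; last by move=> x Ix; have [X FX] := F0; exists X => //; exact: (sub_span Ix).
  have mono X Y : X `<=` Y -> span X I `<=` span Y I.
    move=> XY; apply: span_min; last by move=> x; apply: sub_span.
    have [Y0 YD YM] := span_submodule Y I; split=> // c x /XY; exact: YM.
  split.
  - by have [X FX] := F0; exists X => //; have [] := span_submodule X I.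
  - move=> x y [X FX Xx] [Y FY Yy]; case: (Ftot X Y FX FY) => /mono XY.
      by exists Y => //; have [_ h _] := span_submodule Y I; apply: h => //; apply: XY.
    by exists X => //; have [_ h _] := span_submodule X I; apply: h => //; apply: XY.
  - move=> a x [X FX Xa] [Y FY Yx]; case: (Ftot X Y FX FY) => XY.
      by exists Y => //; have [_ _ h] := span_submodule Y I; apply: h => //; apply: XY.
    by exists X => //; have [_ _ h] := span_submodule X I; apply: h => //; apply: mono Yx.
pose J := span V I; have hJ : is_submodule V J by exact: span_submodule.
have [J0 JD JM] := hJ.
have JV : J `<=` V.
  apply: span_min; first exact: subring_submodule.
  exact: subset_trans IA AV.
(* By maximality it is enough that [J] stays proper after inverting [1 - b]. This holds because
   every power of [1 - b] is congruent to 1 modulo [J]. *)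
have unit1 b : J b -> 1 - b != 0 /\ V (1 - b)^-1.
  move=> Jb; have b1 : 1 - b != 0 by rewrite subr_eq0; apply/eqP => b1; rewrite -b1 in Jb.
  split=> //; pose c := (1 - b)^-1.
  have hc : span (adjoin V c) I `<=` adjoin J c.
    apply: span_min; first exact: adjoin_submodule.
    by move=> x Ix; apply: adjoin_base => //; apply: sub_span.
  rewrite -(maxV (adjoin V c)); first exact: adjoin_mem.
    split; first exact: adjoin_subring.
    move=> /hc[p Jp pc].
    (* multiply [p.[c] = 1] by a power of [1 - b] *)
    have V1b : V (1 - b) by apply: subringB => //; [exact: subring1|exact: JV].
    have pw i N : (i <= N)%N -> V ((1 - b) ^+ N * c ^+ i).
      move=> iN; rewrite -{1}(subnK iN) exprD /c exprVn mulfK ?expf_neq0 //.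
      exact: subringX.
    have : J ((1 - b) ^+ size p).
      have -> : (1 - b) ^+ size p = \sum_(i < size p) (1 - b) ^+ size p * c ^+ i * p`_i.
        transitivity ((1 - b) ^+ size p * p.[c]); first by rewrite pc mulr1.
        by rewrite horner_coef mulr_sumr; apply: eq_bigr => i _; ring.
      apply: (submodule_sum _ hJ) => i _; apply: (JM) => //; apply: pw.
      exact: ltnW.
    have pow n : J ((1 - b) ^+ n) -> False.
      elim: n => [|n IH]; first by rewrite expr0.
      rewrite exprS mulrBl mul1r => h; apply: IH.
      rewrite -[X in J X](subrK (b * (1 - b) ^+ n)); apply: (JD) => //.
      by rewrite mulrC; apply: (JM) => //; exact: subringX.
    exact: pow.
  by apply: adjoin_base; exact: subring0.
exists V; split=> //; last first.
  move=> x Ix; split; first by apply/AV/IA.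
  by move=> [y Vy xy1]; apply: V1; rewrite -xy1 mulrC; apply: (JM) => //; exact: sub_span.
split=> // x; have [->|x0] := eqVneq x 0; first by left; exact: subring0.
apply: contrapT => /not_orP[Vx Vx'].
have key z : ~ V z -> adjoin J z 1.
  move=> Vz; apply: contrapT => nJ; apply: Vz.
  rewrite -(maxV (adjoin V z)); first exact: adjoin_mem.
    split; first exact: adjoin_subring.
    move=> h; apply: nJ; apply: span_min h; first exact: adjoin_submodule.
    by move=> y Iy; apply: adjoin_base => //; apply: sub_span.
  by apply: adjoin_base; exact: subring0.
exact: (adjoin_inv_absurd (conj hJ JV) unit1 x0 V1 (key _ Vx) (key _ Vx')).
Qed.

Lemma dominating_valuation C : is_local C -> exists2 V, valuation_ring V & dominates V C.
Proof.
move=> lC; have [rC idm] := lC.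
have [|V [vV CV mV]] := @valuation_extension C (nonunits C) rC idm.
  by case: (nonunits_prime lC).
by exists V.
Qed.

Lemma valuation_local V : valuation_ring V -> is_local V.
Proof.
move=> [rV vV]; split=> //.
have nuP x : nonunits V x <-> V x /\ (x = 0 \/ ~ V x^-1).
  split=> [[Vx nu]|[Vx [->|nx]]].
  - split=> //; have [->|x0] := eqVneq x 0; first by left.
    by right=> Cx'; apply: nu; exists x^-1; rewrite ?divff.
  - split; first exact: subring0.
    by move=> [y _]; rewrite mul0r => /eqP; rewrite eq_sym oner_eq0.
  - by split=> // -[y Cy xy]; apply: nx; rewrite (mulr1_eq xy).
have mM a x : V a -> nonunits V x -> nonunits V (a * x).
  move=> Va [Vx nx]; split; first exact: subringM.
  by move=> [y Vy e]; apply: nx; exists (a * y); [exact: subringM|rewrite mulrCA mulrA].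
have add x y : V (x / y) -> nonunits V x -> nonunits V y -> y != 0 -> nonunits V (x + y).
  move=> Vxy nx ny y0; rewrite (_ : x + y = (x / y + 1) * y).
    by apply: mM => //; apply: subringD => //; exact: subring1.
  by rewrite mulrDl mul1r divfK.
split; last by move=> x [].
split=> //; first by apply/nuP; split; [exact: subring0|left].
move=> x y nx ny; have [->|x0] := eqVneq x 0; first by rewrite add0r.
have [->|y0] := eqVneq y 0; first by rewrite addr0.
case: (vV (x / y)) => h; first exact: add.
by rewrite addrC; apply: add => //; rewrite -invf_div.
Qed.

End Chevalley.

(** * The basis theorem *)

Section HilbertBasis.
Variable K : fieldType.
Implicit Types A B C I J M P p q S : set K.

Definition coefs_in A : set {poly K} := [set p | forall i, A p`_i].

(** The leading coefficients in degree [n], with 0 included. They are taken from polynomials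
    representing elements of [I], because [x] may be algebraic and an element of [adjoin A x] then
    has no degree. *)
Definition lead A x I n :=
  [set c | exists p : {poly K}, [/\ coefs_in A p, (size p <= n.+1)%N, I p.[x] & p`_n = c]].

Lemma hilbert_basis A x : is_subring A -> noetherian A -> noetherian (adjoin A x).
Proof.
move=> rA nA I [[I0 ID IM] IAx].
have AAx : A `<=` adjoin A x by apply: adjoin_base; exact: subring0.
have xAx := adjoin_mem x rA.
have idL n : is_ideal A (lead A x I n).
  split; last by move=> _ [p [Ap _ _ <-]].
  split.
  - exists 0; rewrite horner0 size_poly0 coef0; split=> // i; rewrite coef0; exact: subring0.
  - move=> _ _ [p [Ap sp Ip <-]] [q [Aq sq Iq <-]]; exists (p + q); rewrite coefD; split=> //.
    + by move=> i; rewrite coefD; exact: subringD.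
    + by rewrite (leq_trans (size_polyD _ _)) // geq_max sp.
    + by rewrite hornerD; exact: ID.
  - move=> a _ Aa [p [Ap sp Ip <-]]; exists (a *: p); rewrite coefZ; split=> //.
    + by move=> i; rewrite coefZ; exact: subringM.
    + exact: leq_trans (size_scale_leq _ _) sp.
    + by rewrite hornerZ; apply: (IM) => //; exact: AAx.
have incL n : lead A x I n `<=` lead A x I n.+1.
  move=> _ [p [Ap sp Ip <-]]; exists (p * 'X); rewrite coefMX /=; split=> //.
  - by move=> i; rewrite coefMX; case: eqP => _ //; exact: subring0.
  - by have [->|p0] := eqVneq p 0; rewrite ?mul0r ?size_poly0 // size_mulX.
  - by rewrite hornerMX mulrC; exact: IM.
have [N LN] := noetherian_stable nA idL incL.
have gens n : exists s : seq K, [set` s] `<=` I /\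
    (forall c, lead A x I n c -> exists p : {poly K},
      [/\ coefs_in A p, (size p <= n.+1)%N, span (adjoin A x) [set` s] p.[x] & p`_n = c]).
  have [s sE] := nA _ (idL n).
  have : [set` s] `<=` lead A x I n by rewrite sE; exact: sub_span.
  rewrite [X in _ -> exists s, _ /\ (forall c, X c -> _)]sE; elim: {sE} s => [_|t s IH sL].
    exists [::]; split=> // c; rewrite span_nil => ->; exists 0.
    rewrite size_poly0 coef0 horner0 span_nil; split=> // i; rewrite coef0; exact: subring0.
  have [|s' [s'I hs']] := IH.
    by move=> u us; apply: (sL u); exact: seq_tail.
  have [p [Ap sp Ip pt]] : lead A x I n t by apply: (sL t); exact: seq_head.
  have rAx := adjoin_subring x rA.
  exists (p.[x] :: s'); split; first by move=> u /=; rewrite inE => /orP[/eqP->|/s'I].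
  move=> c; rewrite span_cons // => -[a [y [Aa /hs'[q [Aq sq sqx <-]] ->]]].
  exists (a *: p + q); rewrite coefD coefZ pt; split=> //.
  - by move=> i; rewrite coefD coefZ; apply: subringD => //; exact: subringM.
  - rewrite (leq_trans (size_polyD _ _)) // geq_max sq andbT.
    exact: leq_trans (size_scale_leq _ _) sp.
  - rewrite span_cons //; exists a, q.[x]; rewrite hornerD hornerZ.
    by split=> //; exact: AAx.
have [s hs] := choice gens.
pose S := flatten [seq s n | n <- iota 0 N.+1].
have sS n : (n <= N)%N -> [set` s n] `<=` [set` S].
  move=> nN u un; apply/flattenP; exists (s n) => //.
  by apply: map_f; rewrite mem_iota add0n ltnS.
exists S; apply/seteqP; split; last first.
  apply: span_min => // u /flattenP[_ /mapP[n _ ->]]; exact: (hs n).1.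
have hsp := span_submodule (adjoin A x) [set` S].
have [sp0 spD spM] := hsp.
(* Induction on the size: subtract a polynomial [g] with the same coefficient in degree [n] and
   value in the span. Beyond the stabilization index [N], such a [g] is a shift of one of degree at
   most [N]. *)
suff main n (p : {poly K}) : (size p <= n)%N -> coefs_in A p -> I p.[x] ->
    span (adjoin A x) [set` S] p.[x].
  by move=> u Iu; have [p Ap px] := IAx u Iu; rewrite -px; apply: (main (size p)); rewrite ?px.
elim: n p => [|n IH] p.
  by rewrite leqn0 size_poly_eq0 => /eqP-> _ _; rewrite horner0.
move=> sp Ap Ip.
have [g [Ag sg spg gc]] : exists g, [/\ coefs_in A g, (size g <= n.+1)%N,
    span (adjoin A x) [set` S] g.[x] & g`_n = p`_n].
  have [nN|/ltnW Nn] := leqP n N.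
    have [|g [Ag sg spg gc]] := (hs n).2 p`_n; first by exists p.
    by exists g; split=> //; apply: spanS spg; exact: sS.
  have [|g [Ag sg spg gc]] := (hs N).2 p`_n; first by rewrite -(LN n) //; exists p.
  exists (g * 'X^(n - N)); split.
  - move=> i; rewrite coefMXn; case: ifP => _ //; exact: subring0.
  - have [->|g0] := eqVneq g 0; first by rewrite mul0r size_poly0.
    by rewrite size_mulXn //; lia.
  - rewrite hornerM hornerXn mulrC; apply: (spM); first by apply: subringX => //; exact: adjoin_subring.
    by apply: spanS spg; exact: sS.
  - by rewrite coefMXn ltnNge leq_subr /= subKn.
rewrite -[p](subrK g) hornerD; apply: (spD) => //; apply: IH.
- apply/leq_sizeP => j; rewrite leq_eqVlt => /orP[/eqP<-|nj].
    by rewrite coefB gc subrr.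
  by rewrite coefB !nth_default ?subrr //; apply: leq_trans nj.
- by move=> i; rewrite coefB; exact: subringB.
- rewrite hornerD hornerN; apply: (ID) => //; rewrite -mulN1r; apply: (IM).
    by apply: AAx; exact: (subringN rA (subring1 rA)).
  have SI : [set` S] `<=` I by move=> u /flattenP[_ /mapP[m _ ->]]; exact: (hs m).1.
  have hI : is_submodule (adjoin A x) I by split.
  exact: (span_min hI SI spg).
Qed.

Lemma finite_type_noetherian A B : is_subring A -> noetherian A -> finite_type A B ->
  noetherian B.
Proof.
move=> rA nA [s ->]; elim: s A rA nA => [|x s IH] A rA nA.
  suff -> : smallest (@is_subring K) (A `|` [set` [::]]) = A by [].
  rewrite (_ : A `|` [set` [::]] = A); first exact: smallest_id.
  by apply/seteqP; split=> [y []|y] //; left.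
suff -> : smallest (@is_subring K) (A `|` [set` x :: s]) =
    smallest (@is_subring K) (adjoin A x `|` [set` s]).
  by apply: IH; [exact: adjoin_subring|exact: hilbert_basis].
have AAx : A `<=` adjoin A x by apply: adjoin_base; exact: subring0.
have rs X := @smallest_subring K X.
apply/seteqP; split; apply: smallest_sub => //.
  move=> y [/AAx Ay|]; first by apply: sub_gen_smallest; left.
  rewrite /= inE => /orP[/eqP->|ys]; apply: sub_gen_smallest; [left|by right].
  exact: adjoin_mem.
move=> y [|ys]; last by apply: sub_gen_smallest; right; exact: seq_tail.
apply: adjoin_sub => // [z Az|]; apply: sub_gen_smallest; first by left.
by right; exact: seq_head.
Qed.

End HilbertBasis.

(** * Discrete valuation rings *)

Section DVR.
Variable K : fieldType.
Implicit Types E : set K.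

Definition frac_field E : Prop := forall x, exists a b, [/\ E a, E b, b != 0 & x = a / b].

Definition uniformizer E (t : K) : Prop := t != 0 /\ nonunits E = span E [set t].

Definition dvr E : Prop :=
  [/\ is_local E, noetherian E, frac_field E & exists t, uniformizer E t].

(** Any uniformizer may serve, so the order depends on no choice. At [h = 0] the value is
    meaningless: as division by zero gives zero, every [n] qualifies there. Hence the hypotheses
    [h != 0] below. *)
Definition ord E (h : K) : int :=
  xget 0 [set n : int | exists t, [/\ uniformizer E t, E (h / t ^ n) & E (t ^ n / h)]].

Section Ord.
Variables (E : set K) (dE : dvr E).
Let lE : is_local E. Proof. by case: dE. Qed.
Let rE : is_subring E. Proof. by case: lE. Qed.

Lemma uniformizer_nonunit t : uniformizer E t -> nonunits E t.
Proof. by move=> [_ ->]; exact: sub_span. Qed.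

Lemma uniformizer_mem t : uniformizer E t -> E t.
Proof. by case/uniformizer_nonunit. Qed.

Lemma uniformizer_inv t : uniformizer E t -> ~ E t^-1.
Proof.
move=> ut; have /(nonunitP lE)[_ [t0|//]] := uniformizer_nonunit ut.
by case: ut; rewrite t0 eqxx.
Qed.

Lemma uniformizerXz t (n : int) : uniformizer E t -> E (t ^ n) <-> 0 <= n.
Proof.
move=> ut; case: n => n.
  by split=> // _; rewrite -exprnP; apply: subringX => //; exact: uniformizer_mem.
split=> // Et; exfalso; apply: (uniformizer_inv ut).
have t0 := ut.1.
have -> : t^-1 = t ^+ n * (t ^ Negz n); last first.
  by apply: subringM => //; apply: subringX => //; exact: uniformizer_mem.
by rewrite NegzE -exprnN exprSr invfM mulVKf // expf_neq0.
Qed.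

Lemma uniformizer_div t x : uniformizer E t -> E x -> x = 0 \/ E x^-1 \/ E (x / t).
Proof.
move=> ut Ex; have [->|x0] := eqVneq x 0; [by left|right].
have [nx|nx] := pselect (nonunits E x); last by left; exact: nonunit_inv.
right; have t0 := ut.1; move: nx; rewrite ut.2 span1 // => -[a Ea <-].
by rewrite mulfK.
Qed.

(** Otherwise division by [t] could go on forever and [x] would lie in all powers of the maximal
    ideal, hence vanish by Krull's intersection theorem. *)
Lemma dvr_unit_part_nat t x : uniformizer E t -> E x -> x != 0 ->
  exists n : nat, E (x / t ^+ n) /\ E (t ^+ n / x).
Proof.
move=> ut Ex x0; have t0 := ut.1.
apply: contrapT => nex; apply/negP: x0; rewrite negbK; apply/eqP.
have nE : noetherian E by case: dE.
have [id0 _ _] := prime_zero rE.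
apply: (krull_intersection lE nE id0 (uniformizer_nonunit ut)) => n.
suff [a Ea xa] : exists2 a, E a & x = t ^+ n * a by exists 0, a; rewrite add0r.
elim: n => [|n [a Ea xa]]; first by exists x; rewrite ?mul1r.
have tn0 : t ^+ n != 0 by rewrite expf_neq0.
have [a0|[Ea'|Eat]] := uniformizer_div ut Ea.
- by exists 0; [exact: subring0|rewrite xa a0 !mulr0].
- by case: nex; exists n; rewrite xa mulrAC divff // mul1r invfM mulVKf.
- by exists (a / t) => //; rewrite xa exprSr -mulrA [t * _]mulrC divfK.
Qed.

Lemma dvr_unit_part t h : uniformizer E t -> h != 0 ->
  exists n : int, E (h / t ^ n) /\ E (t ^ n / h).
Proof.
move=> ut h0; have t0 := ut.1; have [_ _ fE _] := dE.
have [a [b [Ea Eb b0 hab]]] := fE h.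
have a0 : a != 0 by apply: contraNneq h0 => a0; rewrite hab a0 mul0r.
have [m [am ma]] := dvr_unit_part_nat ut Ea a0.
have [n [bn nb]] := dvr_unit_part_nat ut Eb b0.
have tm0 : t ^+ m != 0 by rewrite expf_neq0.
have tn0 : t ^+ n != 0 by rewrite expf_neq0.
exists (m%:Z - n%:Z); rewrite expfzDr // -exprnN -exprnP hab; split.
- rewrite (_ : _ / _ = (a / t ^+ m) * (t ^+ n / b)); first exact: subringM.
  by field; rewrite b0 tm0 tn0.
- rewrite (_ : _ / (a / b) = (t ^+ m / a) * (b / t ^+ n)); first exact: subringM.
  by field; rewrite b0 a0 tn0.
Qed.

Lemma uniformizer_change t t' (n : int) : uniformizer E t -> uniformizer E t' -> E (t ^ n / t' ^ n).
Proof.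
have aux u u' : uniformizer E u -> uniformizer E u' -> E (u / u').
  move=> uu uu'; have := uniformizer_nonunit uu; rewrite uu'.2 span1 // => -[a Ea <-].
  by rewrite mulfK //; case: uu'.
move=> ut ut'; have t0 := ut.1; have t0' := ut'.1.
case: n => n; first by rewrite -!exprnP -expr_div_n; apply: subringX => //; exact: aux.
rewrite NegzE -!exprnN invrK mulrC -expr_div_n; apply: subringX => //; exact: aux.
Qed.

Lemma ordE t h : uniformizer E t -> h != 0 -> E (h / t ^ ord E h) /\ E (t ^ ord E h / h).
Proof.
move=> ut h0; rewrite /ord; case: xgetP => [n _ [t' [ut' h1 h2]]|nex]; last first.
  have [n [h1 h2]] := dvr_unit_part ut h0.
  by case: (nex n); exists t.
have t0 := ut.1; have t0' := ut'.1.
have tn0 : t ^ n != 0 by rewrite expfz_neq0.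
have tn0' : t' ^ n != 0 by rewrite expfz_neq0.
split.
- rewrite (_ : h / _ = (h / t' ^ n) * (t' ^ n / t ^ n)).
    by apply: subringM => //; exact: uniformizer_change.
  by field; rewrite tn0 tn0'.
- rewrite (_ : _ / h = (t' ^ n / h) * (t ^ n / t' ^ n)).
    by apply: subringM => //; exact: uniformizer_change.
  by field; rewrite h0 tn0'.
Qed.

Lemma ord_leP t (n : int) h : uniformizer E t -> h != 0 -> E (h / t ^ n) <-> n <= ord E h.
Proof.
move=> ut h0; have t0 := ut.1; have [h1 h2] := ordE ut h0.
have tn0 : t ^ n != 0 by rewrite expfz_neq0.
have to0 : t ^ ord E h != 0 by rewrite expfz_neq0.
rewrite -subr_ge0 -(uniformizerXz _ ut) expfzDr // -invr_expz; split=> h3.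
- rewrite (_ : _ / _ = (t ^ ord E h / h) * (h / t ^ n)); first exact: subringM.
  by field; rewrite h0 tn0.
- rewrite (_ : _ / _ = (h / t ^ ord E h) * (t ^ ord E h / t ^ n)); first exact: subringM.
  by field; rewrite to0 tn0.
Qed.

Lemma dvr_ord_ge0 h : h != 0 -> E h <-> 0 <= ord E h.
Proof.
by move=> h0; have [_ _ _ [t ut]] := dE; rewrite -(ord_leP _ ut) // expr0z divr1.
Qed.

Lemma ord_ge0 h : h != 0 -> E h -> 0 <= ord E h.
Proof. by move=> h0 /(dvr_ord_ge0 h0). Qed.

Lemma ordM g h : g != 0 -> h != 0 -> ord E (g * h) = ord E g + ord E h.
Proof.
move=> g0 h0; have gh0 : g * h != 0 by rewrite mulf_neq0.
have [_ _ _ [t ut]] := dE; have t0 := ut.1.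
have [g1 g2] := ordE ut g0; have [h1 h2] := ordE ut h0; have [gh1 gh2] := ordE ut gh0.
have tg := expfz_neq0 (ord E g) t0; have th := expfz_neq0 (ord E h) t0.
have tgh := expfz_neq0 (ord E (g * h)) t0.
apply/eqP; rewrite eq_le; apply/andP; split; last first.
  apply/(ord_leP _ ut) => //; rewrite expfzDr // invfM mulrACA.
  exact: subringM.
rewrite -subr_ge0; apply/(uniformizerXz _ ut); rewrite !expfzDr // -invr_expz.
rewrite (_ : _ * _ = (t ^ ord E g / g) * (t ^ ord E h / h) * (g * h / t ^ ord E (g * h))).
  by apply: subringM => //; exact: subringM.
by field; rewrite g0 h0 tgh.
Qed.

Lemma ord1 : ord E 1 = 0.
Proof.
by apply: (addrI (ord E 1)); rewrite -ordM ?oner_eq0// mulr1 addr0.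
Qed.

Lemma ordV h : h != 0 -> ord E h^-1 = - ord E h.
Proof.
by move=> h0; apply: (addrI (ord E h)); rewrite -ordM ?invr_eq0// divff // ord1 subrr.
Qed.

Lemma ord_div g h : g != 0 -> h != 0 -> ord E (g / h) = ord E g - ord E h.
Proof. by move=> g0 h0; rewrite ordM ?invr_eq0// ordV. Qed.

Lemma ordX h (n : nat) : h != 0 -> ord E (h ^+ n) = ord E h * n%:Z.
Proof.
move=> h0; elim: n => [|n IH]; first by rewrite expr0 ord1 mulr0.
by rewrite exprS ordM ?expf_neq0// IH; lia.
Qed.

Lemma ord_unit h : h != 0 -> E h -> E h^-1 -> ord E h = 0.
Proof.
move=> h0 /(dvr_ord_ge0 h0) o1 /(ord_ge0 _); rewrite invr_eq0 ordV // oppr_ge0 => /(_ h0) o2.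
by apply/eqP; rewrite eq_le o1 o2.
Qed.

Lemma ord_gt0 h : h != 0 -> nonunits E h <-> 0 < ord E h.
Proof.
move=> h0; rewrite nonunitP // lt_def; split=> [[Eh [/eqP|nE]]|/andP[o0 o1]].
- by rewrite (negbTE h0).
- rewrite ord_ge0 // andbT; apply/eqP => o0; apply: nE.
  by apply/dvr_ord_ge0; rewrite ?invr_eq0 // ordV // o0.
- split; first exact/dvr_ord_ge0.
  right=> /(ord_ge0 _); rewrite invr_eq0 ordV // oppr_ge0 => /(_ h0) o2.
  by move: o0; rewrite eq_le o1 o2.
Qed.

Lemma ord_eq0 h : h != 0 -> ord E h = 0 -> E h /\ ~ nonunits E h.
Proof.
by move=> h0 o0; split; [apply/dvr_ord_ge0; rewrite ?o0|rewrite ord_gt0 // o0].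
Qed.

Lemma ord_uniformizer t : uniformizer E t -> ord E t = 1.
Proof.
move=> ut; have t0 := ut.1.
have o0 : 0 < ord E t by apply/ord_gt0 => //; exact: uniformizer_nonunit.
apply/eqP; rewrite eq_le; apply/andP; split; last by rewrite -gtz0_ge1.
have [h1 _] := ordE ut t0.
rewrite -subr_ge0; apply/(uniformizerXz _ ut); rewrite expfzDr // -invr_expz.
by rewrite expr1z.
Qed.

Lemma nonunits_dvr h : nonunits E h <-> h = 0 \/ 0 < ord E h.
Proof.
have [->|h0] := eqVneq h 0.
  by split=> _; [left|case: lE => _ [[]]].
by rewrite ord_gt0 //; split=> [|[/eqP|//]]; [right|rewrite (negbTE h0)].
Qed.

Lemma mem_dvr h : E h <-> h = 0 \/ 0 <= ord E h.
Proof.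
have [->|h0] := eqVneq h 0; first by split=> _; [left|exact: subring0].
by rewrite dvr_ord_ge0 //; split=> [|[/eqP|//]]; [right|rewrite (negbTE h0)].
Qed.

Lemma ord_geP (Q : archiRealDomainType) (c : Q) f :
  ord_ge E c f <-> f = 0 \/ c <= (ord E f)%:~R.
Proof.
have [_ _ _ [t ut]] := dE.
split=> [[u [n [u0 uE cn Ef]]]|[->|cf]].
- have [->|f0] := eqVneq f 0; [by left|right].
  by apply: le_trans cn _; rewrite ler_int; apply/(@ord_leP u).
- exists t, (Num.ceil c); split; rewrite ?mul0r; first by case: ut.
  + by case: ut.
  + exact: Num.Theory.ceil_ge.
  + exact: subring0.
- have [f0|f0] := eqVneq f 0.
    exists t, (ord E f); case: (ut) => ? ?; split=> //.
    by rewrite {1}f0 mul0r; exact: subring0.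
  by exists t, (ord E f); case: (ut) => ? ?; split=> //; apply/(@ord_leP t).
Qed.

Lemma dvr_neqT : exists x, ~ E x.
Proof. by have [_ _ _ [t ut]] := dE; exists t^-1; exact: uniformizer_inv. Qed.

End Ord.

(** An element of negative order has powers with arbitrarily high poles, so together with [E] it
    generates the whole field. *)
Lemma dvr_maximal E E' : dvr E -> is_subring E' -> E `<=` E' -> (exists x, ~ E' x) -> E' = E.
Proof.
move=> dE rE' EE' [z E'z]; apply/seteqP; split=> // x E'x.
have [->|x0] := eqVneq x 0; first by apply: subring0; case: dE => -[].
have z0 : z != 0 by apply/eqP => z0; apply: E'z; rewrite z0; exact: subring0.
apply/(dvr_ord_ge0 dE) => //; rewrite leNgt; apply/negP => xlt0; apply: E'z.
pose n := `|ord E z|%N.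
rewrite -(divfK (expf_neq0 n x0) z); apply: subringM => //; last exact: subringX.
apply: EE'; apply/(dvr_ord_ge0 dE); first by rewrite mulf_neq0 ?invr_eq0 ?expf_neq0.
rewrite ord_div ?expf_neq0// ordX //; rewrite /n; nia.
Qed.

End DVR.

(** * Derivations *)

Section PolyDerivation.
Variables (F K : fieldType) (j : {rmorphism F -> K}) (D : F -> K).
Hypothesis DD : forall x y, D (x + y) = D x + D y.
Hypothesis DM : forall x y, D (x * y) = D x * j y + j x * D y.

Let D0 : D 0 = 0.
Proof. by apply: (addrI (D 0)); rewrite -DD !addr0. Qed.

Definition dpoly (p : {poly F}) : {poly K} := \poly_(i < size p) D p`_i.

Lemma coef_dpoly p i : (dpoly p)`_i = D p`_i.
Proof. by rewrite coef_poly; case: ltnP => // h; rewrite nth_default. Qed.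

(** The value that an extension of [D] sending [u] to [v] must take at [p(u)]. *)
Definition extd (u v : K) (p : {poly F}) : K :=
  (dpoly p).[u] + (map_poly j p^`()).[u] * v.

Lemma extdD u v p q : extd u v (p + q) = extd u v p + extd u v q.
Proof.
rewrite /extd derivD rmorphD /= hornerD mulrDl addrACA -hornerD; congr (_.[_] + _).
by apply/polyP => i; rewrite coefD !coef_dpoly coefD DD.
Qed.

Lemma extdC u v c : extd u v c%:P = D c.
Proof.
rewrite /extd derivC rmorph0 horner0 mul0r addr0.
rewrite (_ : dpoly _ = (D c)%:P) ?hornerC//.
by apply/polyP => -[|i]; rewrite coef_dpoly !coefC.
Qed.

Lemma extd0 u v : extd u v 0 = 0.
Proof. by rewrite -polyC0 extdC D0. Qed.

Lemma extdMX u v p :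
  extd u v (p * 'X) = extd u v p * u + (map_poly j p).[u] * v.
Proof.
rewrite /extd derivM derivX mulr1 rmorphD rmorphM /= map_polyX !hornerE.
rewrite (_ : dpoly _ = dpoly p * 'X) ?hornerMX; first by ring.
by apply/polyP => -[|i]; rewrite coef_dpoly !coefMX //= coef_dpoly.
Qed.

Lemma extdCM u v c p : extd u v (c%:P * p) = D c * (map_poly j p).[u] + j c * extd u v p.
Proof.
rewrite /extd derivM derivC mul0r add0r rmorphM /= map_polyC !hornerE.
rewrite (_ : dpoly _ = (D c)%:P * map_poly j p + (j c)%:P * dpoly p).
  by rewrite !hornerE; ring.
by apply/polyP => i; rewrite coefD coef_dpoly !coefCM DM coef_map coef_dpoly.
Qed.

Lemma extdM u v p q :
  extd u v (p * q) = extd u v p * (map_poly j q).[u] + (map_poly j p).[u] * extd u v q.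
Proof.
elim/poly_ind: p => [|p c IH].
  by rewrite mul0r extd0 rmorph0 horner0 !mul0r addr0.
rewrite mulrDl extdD mulrAC extdMX IH extdCM extdD extdMX extdC.
rewrite rmorphD !rmorphM /= map_polyX map_polyC !(hornerD, hornerM, hornerX, hornerC) /=; ring.
Qed.

Hypothesis char0 : forall n, n.+1%:R != 0 :> F.

(* The value of an extension at [u] is forced by the minimal polynomial of [u]
   if [u] is algebraic, and arbitrary otherwise. *)
Lemma extd_value (u v0 : K) : exists v,
  (forall p, (map_poly j p).[u] = 0 -> extd u v p = 0) /\
  ((forall p, p != 0 -> (map_poly j p).[u] != 0) -> v = v0).
Proof.
have [tr|alg] := pselect (forall p, p != 0 -> (map_poly j p).[u] != 0).
  exists v0; split=> // p pu; have [->|/tr] := eqVneq p 0; last by rewrite pu eqxx.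
  exact: extd0.
have {}alg : exists n, `[< exists p : {poly F}, [/\ p != 0, (map_poly j p).[u] = 0 & size p = n] >].
  move/existsNP: alg => [p /not_implyP[p0 /negP]]; rewrite negbK => /eqP pu.
  by exists (size p); apply/asboolP; exists p.
have [n /asboolP[p [p0 pu sp]] minn] := ex_minnP alg.
have small (q : {poly F}) : (size q < n)%N -> (map_poly j q).[u] = 0 -> q = 0.
  move=> sq qu; apply/eqP; apply: contraTT sq => q0; rewrite -leqNgt.
  by apply: minn; apply/asboolP; exists q.
(* In characteristic zero the derivative is a nonzero polynomial of smaller degree, so minimality of
   [p] forbids it to vanish at [u]. *)
have p'u : (map_poly j p^`()).[u] != 0.
  apply/negP => /eqP /small h.
  have n1 : (1 < size p)%N.
    rewrite ltnNge; apply/negP => /size1_polyC pc.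
    by move: pu p0; rewrite pc map_polyC hornerC polyC_eq0 => /eqP; rewrite fmorph_eq0 => ->.
  have := h; rewrite -sp lt_size_deriv // => /(_ isT) /(congr1 (fun q : {poly F} => q`_(size p).-2)).
  rewrite coef_deriv coef0 -mulr_natr => /eqP; case: (size p) n1 (lead_coefE p) => [|[|m]] // _ /= <-.
  by rewrite mulf_eq0 lead_coef_eq0 (negbTE p0) (negbTE (char0 _)).
exists (- (dpoly p).[u] / (map_poly j p^`()).[u]).
have dp : extd u (- (dpoly p).[u] / (map_poly j p^`()).[u]) p = 0.
  by rewrite /extd mulrC divfK // subrr.
split=> [q qu|/(_ p p0)]; last by rewrite pu eqxx.
have qE := divp_eq q p.
have r0 : q %% p = 0.
  apply: small; first by rewrite -sp ltn_modp.
  by move: qu; rewrite {1}qE rmorphD rmorphM /= !hornerE pu mulr0 add0r.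
by rewrite qE r0 addr0 extdM pu dp mulr0 mulr0 addr0.
Qed.

End PolyDerivation.

Section Derivations.
Variable K : fieldType.
Implicit Types A C F S M : set K.

Definition subfield F : Prop := is_subring F /\ (forall x, F x -> F x^-1).

Definition derivation_on F (D : K -> K) : Prop :=
  (forall x y, F x -> F y -> D (x + y) = D x + D y) /\ (forall x y, F x -> F y -> D (x * y) = D x * y + x * D y).


Section SubfieldType.
Variables (F : set K) (sF : subfield F).

Let F_divring : GRing.divring_closed [in F].
Proof.
have [rF iF] := sF; split; first by rewrite inE; exact: subring1.
  by move=> x y; rewrite !inE; exact: subringB.
by move=> x y; rewrite !inE => Fx Fy; apply: subringM => //; exact: iF.
Qed.

(** Taking the closure proof as an argument lets the instance below recover it from the
    predicate. *)
Definition subfield_pred (_ : GRing.divring_closed [in F]) : {pred K} := [in F].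
HB.instance Definition _ := GRing.isDivringClosed.Build K (subfield_pred F_divring) F_divring.
Definition subfield_type : Type := {x | x \in subfield_pred F_divring}.
HB.instance Definition _ := SubType.on subfield_type.
HB.instance Definition _ := [Choice of subfield_type by <:].
HB.instance Definition _ := [SubChoice_isSubIntegralDomain of subfield_type by <:].
HB.instance Definition _ := [SubIntegralDomain_isSubField of subfield_type by <:].

(** Gives a subfield that is a mere set the structure of a field type, so that Euclidean division of
    polynomials over it applies. *)
Lemma subfield_type_ex : exists (F' : fieldType) (j : {rmorphism F' -> K}), range j = F.
Proof.
exists subfield_type, (\val : {rmorphism subfield_type -> K}).
apply/seteqP; split=> [_ [x _ <-]|x Fx].
  by have := valP x; rewrite /subfield_pred inE.
have hx : x \in subfield_pred F_divring by rewrite /subfield_pred inE.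
by exists (Sub x hx : subfield_type); rewrite //= SubK.
Qed.

End SubfieldType.
End Derivations.

Section DerivationExtension.
Variable K : fieldType.
Implicit Types A C F S M : set K.

Definition fadjoin F (u : K) := [set x / y | x in adjoin F u & y in [set y | adjoin F u y /\ y != 0]].

Lemma fadjoin_subfield F u : is_subring F -> subfield (fadjoin F u).
Proof.
move=> rF; have rA := adjoin_subring u rF; split.
  apply/subringP; split.
  - exists 1; first exact: subring1.
    by exists 1; rewrite ?divr1 // ; split; [exact: subring1|rewrite oner_eq0].
  - move=> _ _ [x Ax [y [Ay y0] <-]] [z Az [w [Aw w0] <-]].
    exists (x * w - z * y); first by apply: (subringB rA); exact: subringM.
    exists (y * w); last by field; rewrite y0 w0.
    by split; [exact: subringM|rewrite mulf_neq0].
  - move=> _ _ [x Ax [y [Ay y0] <-]] [z Az [w [Aw w0] <-]].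
    exists (x * z); first exact: subringM.
    exists (y * w); last by rewrite mulf_div.
    by split; [exact: subringM|rewrite mulf_neq0].
move=> _ [x Ax [y [Ay y0] <-]]; have [->|x0] := eqVneq x 0.
  exists 0; first exact: subring0.
  by exists 1; rewrite ?mul0r ?invr0 //; split; [exact: subring1|rewrite oner_eq0].
by exists y => //; exists x; rewrite ?invf_div.
Qed.

Lemma adjoin_fadjoin F u : is_subring F -> adjoin F u `<=` fadjoin F u.
Proof.
move=> rF x Ax; exists x => //; exists 1; rewrite ?divr1 //.
by split; [exact: (subring1 (adjoin_subring u rF))|rewrite oner_eq0].
Qed.

Lemma fadjoin_base F u : is_subring F -> F `<=` fadjoin F u.
Proof.
move=> rF x Fx; apply: adjoin_fadjoin => //; apply: adjoin_base => //; exact: subring0.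
Qed.

Lemma fadjoin_mem F u : is_subring F -> fadjoin F u u.
Proof. by move=> rF; apply: adjoin_fadjoin => //; exact: adjoin_mem. Qed.

Definition transcendental F (u : K) : Prop :=
  forall p : {poly K}, coefs_in F p -> p != 0 -> p.[u] != 0.

Hypothesis char0 : forall n, n.+1%:R != 0 :> K.

(** An extension exists for every [u], but its value at [u] is free only when [u] is transcendental;
    hence the conditional last clause. *)
Lemma derivation_extend F D (u v0 : K) : subfield F -> derivation_on F D ->
  exists D', [/\ derivation_on (fadjoin F u) D', (forall x, F x -> D' x = D x)
    & transcendental F u -> D' u = v0].
Proof.
move=> sF [DD DM]; have [F' [j jF]] := subfield_type_ex sF.
have Fj x : F (j x) by rewrite -jF; exists x.
pose d x := D (j x).
have dD x y : d (x + y) = d x + d y by rewrite /d rmorphD DD.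
have dM x y : d (x * y) = d x * j y + j x * d y by rewrite /d rmorphM DM.
have F'0 n : n.+1%:R != 0 :> F'.
  by rewrite -(fmorph_eq0 j) rmorph_nat.
have [v [v1 v2]] := extd_value dD dM F'0 u v0.
pose ev (p : {poly F'}) := (map_poly j p).[u].
have ev1 : ev 1 = 1 by rewrite /ev rmorph1 hornerC.
have evX : ev 'X = u by rewrite /ev map_polyX hornerX.
have evM p q : ev (p * q) = ev p * ev q by rewrite /ev rmorphM hornerM.
have evD p q : ev (p + q) = ev p + ev q by rewrite /ev rmorphD hornerD.
have evB p q : ev (p - q) = ev p - ev q by rewrite /ev rmorphB hornerD hornerN.
pose e p := extd j d u v p.
have eD p q : e (p + q) = e p + e q by exact: extdD.
have eM p q : e (p * q) = e p * ev q + ev p * e q by exact: extdM.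
have e1 : e 1 = 0.
  by have := eM 1 1; rewrite mulr1 ev1 mulr1 mul1r => /eqP; rewrite -subr_eq0 opprD addNKr oppr_eq0 => /eqP.
have lift x : adjoin F u x -> exists p, ev p = x.
  move=> [p Fp <-].
  have /choice[c hc] : forall i, exists c, j c = p`_i.
    by move=> i; have := Fp i; rewrite -jF => -[c _ hc]; exists c.
  exists (\poly_(i < size p) c i); rewrite /ev; congr (_.[_]).
  apply/polyP => i; rewrite coef_map coef_poly; case: ltnP => hi; first exact: hc.
  rewrite nth_default //; exact: rmorph0.
have val p : adjoin F u (ev p).
  by exists (map_poly j p) => // i; rewrite coef_map; exact: Fj.
pose dq p q := (e p * ev q - ev p * e q) / ev q ^+ 2.
pose G x := [set y | exists p q, [/\ ev q != 0, x = ev p / ev q & y = dq p q]].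
(* The quotient rule is independent of the fraction: [p * q' - p' * q] vanishes at [u], so by the
   choice of [v] its formal derivative [e] vanishes too. *)
have Gfun p q p' q' : ev q != 0 -> ev q' != 0 -> ev p / ev q = ev p' / ev q' -> dq p q = dq p' q'.
  move=> q0 q'0 /eqP; rewrite eqr_div // => /eqP h.
  have : e (p * q' - p' * q) = 0 by apply: v1; rewrite -/(ev _) evB !evM h subrr.
  have eB x y : e (x - y) = e x - e y.
    by apply: (addIr (e y)); rewrite -eD !subrK.
  rewrite eB !eM => /eqP; rewrite subr_eq0 => /eqP h2.
  have h1 : ev p' = ev p * ev q' / ev q by rewrite h mulfK.
  have h3 : e p' = (e p * ev q' + ev p * e q' - ev p' * e q) / ev q.
    by rewrite h2 addrK mulfK.
  by rewrite /dq h3 h1; field; rewrite q0 q'0.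
pose D' x := xget 0 (G x).
have D'E p q : ev q != 0 -> D' (ev p / ev q) = dq p q.
  move=> q0; rewrite /D'; case: xgetP => [y _ [p' [q' [q'0 h ->]]]|/(_ (dq p q))[]].
    by apply: Gfun => //; rewrite -h.
  by exists p, q.
have repr x : fadjoin F u x -> exists p q, ev q != 0 /\ x = ev p / ev q.
  by move=> [y /lift[p <-] [z [/lift[q <-] q0] <-]]; exists p, q.
have D'p p : D' (ev p) = e p.
  by rewrite -[ev p]divr1 -ev1 D'E ?ev1 ?oner_eq0// /dq ev1 e1 expr1n mulr0 subr0 mulr1 divr1.
exists D'; split.
- split=> x y /repr[p [q [q0 ->]]] /repr[p' [q' [q'0 ->]]].
    have -> : ev p / ev q + ev p' / ev q' = ev (p * q' + p' * q) / ev (q * q').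
      by rewrite evD !evM; field; rewrite q0 q'0.
    rewrite !D'E ?evM ?mulf_neq0 //.
    by rewrite /dq !(eM, eD, evM, evD); field; rewrite q0 q'0.
  have -> : ev p / ev q * (ev p' / ev q') = ev (p * p') / ev (q * q').
    by rewrite !evM; field; rewrite q0 q'0.
  rewrite !D'E ?evM ?mulf_neq0 //.
  by rewrite /dq !(eM, eD, evM, evD); field; rewrite q0 q'0.
- move=> x; rewrite -jF => -[c _ <-].
  have -> : j c = ev c%:P by rewrite /ev map_polyC hornerC.
  by rewrite D'p /e (extdC _ dD) /d /ev map_polyC hornerC.
- move=> tr; rewrite -{1}evX D'p -v2.
    rewrite (_ : 'X = 1 * 'X :> {poly F'}); last by rewrite mul1r.
    rewrite /e (extdMX _ dD).
    by rewrite -/(e _) -/(ev _) e1 ev1 mul0r add0r mul1r.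
  move=> p p0; apply: tr; last by rewrite map_poly_eq0.
  by move=> i; rewrite coef_map; exact: Fj.
Qed.

Definition derivation (D : K -> K) : Prop := derivation_on setT D.

(* [K] is finitely generated as a field over [F] *)
Definition fin_gen F : Prop := exists s : seq K, forall S, subfield S -> F `<=` S -> [set` s] `<=` S -> S = setT.

(** The value at [u] is prescribed first; then the finitely many generators of [K] are adjoined one
    by one, with whatever values the extension gives them. *)
Lemma derivation_extend_full F D (u v0 : K) : subfield F -> derivation_on F D -> fin_gen F ->
  transcendental F u ->
  exists D', [/\ derivation D', (forall x, F x -> D' x = D x) & D' u = v0].
Proof.
move=> sF dD [s fgs] tr.
have [D1 [dD1 D1F /(_ tr) D1u]] := derivation_extend u v0 sF dD.
suff [S [D' [sS FS sS' dD' D'E]]] : exists S D', [/\ subfield S, fadjoin F u `<=` S, [set` s] `<=` S,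
    derivation_on S D' & forall x, fadjoin F u x -> D' x = D1 x].
  have rF := sF.1.
  exists D'; split.
  - rewrite /derivation -(fgs S) //; apply: subset_trans FS; exact: fadjoin_base.
  - by move=> x Fx; rewrite D'E ?D1F //; exact: fadjoin_base.
  - by rewrite D'E //; exact: fadjoin_mem.
have sF1 := fadjoin_subfield u sF.1.
clear tr D1F D1u fgs; move: (fadjoin F u) D1 sF1 dD1.
elim: s => [|t s IH] F1 D1 sF1 dD1; first by exists F1, D1; split.
have [D2 [dD2 D2E _]] := derivation_extend t 0 sF1 dD1.
have rF1 := sF1.1.
have [S [D' [sS FS sS' dD' D'E]]] := IH _ _ (fadjoin_subfield t sF1.1) dD2.
exists S, D'; split=> //.
- by apply: subset_trans FS; exact: fadjoin_base.
- move=> x /=; rewrite inE => /orP[/eqP->|xs]; last exact: sS'.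
  by apply: FS; exact: fadjoin_mem.
- move=> x Fx; rewrite D'E ?D2E //; exact: fadjoin_base.
Qed.

Lemma derivation0 D : derivation D -> D 0 = 0.
Proof. by move=> [DD _]; apply: (addrI (D 0)); rewrite -DD // !addr0. Qed.

Lemma derivation1 D : derivation D -> D 1 = 0.
Proof.
move=> [_ DM]; have := DM 1 1 I I; rewrite !mulr1 mul1r => /eqP.
by rewrite -subr_eq0 opprD addNKr oppr_eq0 => /eqP.
Qed.

(* A field inside the localization at a prime [p i.+1], enlarged by an element of
   [p i.+1] outside [p i], stays inside the localization at [p i]; so the elements
   picked along a chain of primes are algebraically independent. *)
Lemma fadjoin_localization C p q F z : is_subring C -> prime_ideal C p -> prime_ideal C q ->
  p `<=` q -> q z -> ~ p z -> subfield F -> F `<=` localization C q ->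
  transcendental F z /\ fadjoin F z `<=` localization C p.
Proof.
move=> rC pp pq pqs qz pz sF Fq.
have lCq := loc_local rC pq; have lCp := loc_local rC pp.
have Cz := prime_subset pq qz.
have qp : localization C q `<=` localization C p.
  by move=> _ [x Cx [y [Cy qy] <-]]; exists x => //; exists y => //; split=> // /pqs.
have z0 : z != 0 by exact: prime_neq0 pp pz.
have [iCz Cz'] : localization C p z^-1 /\ localization C p z.
  by split; [exact: loc_inv|exact: loc_sub].
have rCq := lCq.1; have rCp := lCp.1; have [rF iF] := sF.
have nz : nonunits (localization C q) z.
  rewrite loc_nonunits //; exists z => //; exists 1; rewrite ?divr1 //.
  by split; [exact: subring1|case: pq].
(* Split off the constant term [c]. If it is nonzero, the value is [c] times one plus a nonunit of
   the local ring at [q]; if it is zero, a factor [z] comes out, which is a unit at [p]. *)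
have key (f : {poly K}) : coefs_in F f -> f != 0 ->
    [/\ localization C p f.[z], f.[z] != 0 & localization C p f.[z]^-1].
  elim/poly_ind: f => [|g c IH]; first by rewrite eqxx.
  move=> Ff f0.
  have Fg : coefs_in F g by move=> i; have := Ff i.+1; rewrite coefD coefMX coefC addr0.
  have Fc : F c by have := Ff 0%N; rewrite coefD coefMX coefC add0r.
  have [c0|c0] := eqVneq c 0.
    have g0 : g != 0 by apply: contraNneq f0 => ->; rewrite c0 mul0r addr0.
    have [g1 g2 g3] := IH Fg g0; rewrite c0 addr0 hornerMX; split.
    - exact: subringM.
    - by rewrite mulf_neq0.
    - by rewrite invfM; exact: subringM.
  have ngz : nonunits (localization C q) (c^-1 * (g.[z] * z)).
    rewrite mulrA; apply: (primeMl (nonunits_prime lCq)) => //.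
    apply: subringM => //; first exact/Fq/iF.
    rewrite horner_coef; apply: subring_sum => // i _; apply: subringM => //; first exact: Fq.
    by apply: subringX => //; exact: loc_sub.
  have [inv1 ne1] := nonunit_add1 lCq ngz.
  have -> : (g * 'X + c%:P).[z] = c * (1 + c^-1 * (g.[z] * z)).
    by rewrite hornerMXaddC; field.
  split.
  - apply: qp; apply: subringM => //; first exact: Fq.
    by apply: subringD => //; [exact: subring1|case: ngz].
  - by rewrite mulf_neq0.
  - by apply: qp; rewrite invfM; apply: subringM => //; exact/Fq/iF.
split; first by move=> f Ff f0; have [] := key f Ff f0.
move=> _ [_ [f Ff <-] [_ [[g Fg <-] g0] <-]].
have [_ _ h] : [/\ localization C p g.[z], g.[z] != 0 & localization C p g.[z]^-1].
  by apply: key => //; apply: contraNneq g0 => ->; rewrite horner0.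
apply: subringM => //; have [->|f0] := eqVneq f 0; first by rewrite horner0; exact: subring0.
by have [] := key f Ff f0.
Qed.

(** The chain is descended from its top. The derivation dual to the element chosen first is built
    over [F], the later ones over [F] enlarged by that element, so they kill it. The matrix of the
    [D i (z j)] is therefore triangular with ones on the diagonal. *)
Lemma chain_derivations C (p : nat -> set K) F d : is_subring C ->
  (forall i, (i <= d)%N -> prime_ideal C (p i)) ->
  (forall i, (i < d)%N -> p i `<` p i.+1) ->
  subfield F -> F `<=` localization C (p d) -> fin_gen F ->
  exists (z : nat -> K) (D : nat -> K -> K), forall i, (i < d)%N ->
    [/\ derivation (D i), (forall x, F x -> D i x = 0), D i (z i) = 1
      & forall j, (i < j < d)%N -> D i (z j) = 0].
Proof.
move=> rC; elim: d F => [|d IH] F pp pS sF Fp fg.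
  by exists (fun=> 0), (fun=> id).
have [pd pdn] := pS d (ltnSn d).
have [z [qz pz]] : exists z, p d.+1 z /\ ~ p d z.
  apply: contrapT => nz; apply: pdn => z qz; apply: contrapT => pz.
  by apply: nz; exists z.
have [trz F'p] : transcendental F z /\ fadjoin F z `<=` localization C (p d).
  by apply: (@fadjoin_localization C (p d) (p d.+1)) => //; apply: pp.
have FF' : F `<=` fadjoin F z by apply: fadjoin_base; case: sF.
have [Dd [dDd DdF Ddz]] : exists D', [/\ derivation D', (forall x, F x -> D' x = 0) & D' z = 1].
  have d0 : derivation_on F (fun=> 0 : K).
    by split=> x y _ _; rewrite ?mul0r ?mulr0 addr0.
  exact: (derivation_extend_full _ sF d0 fg trz).
have [||||z' [D' h]] := IH (fadjoin F z) _ _ _ F'p.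
- by move=> i id; apply: pp; exact: leqW.
- by move=> i id; apply: pS; exact: leqW.
- by apply: fadjoin_subfield; case: sF.
- have [s hs] := fg; exists s => S sS FS ss; apply: hs => //.
  exact: subset_trans FS.
exists (fun i => if i == d then z else z' i), (fun i => if i == d then Dd else D' i).
move=> i; rewrite ltnS leq_eqVlt => /orP[/eqP->|id].
  rewrite eqxx; split=> // j /andP[dj]; rewrite ltnS leqNgt dj //.
have [dDi DiF' Dizi Dizj] := h i id; rewrite (ltn_eqF id); split=> //.
- by move=> x Fx; apply: DiF'; exact: FF'.
- move=> j /andP[ij]; rewrite ltnS leq_eqVlt => /orP[/eqP->|jd].
    by rewrite eqxx; apply: DiF'; apply: fadjoin_mem; case: sF.
  by rewrite (ltn_eqF jd); apply: Dizj; rewrite ij.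
Qed.

End DerivationExtension.

(** * Derivations of local rings and finiteness of differentials *)

Section Differential.
Variable K : fieldType.
Implicit Types A B C E F L M R : set K.
Implicit Types D : K -> K.

(** A substitute for a coefficient field, which need not exist without completeness: the residue
    field of [C] is only algebraic over [L]. If [a] were transcendental modulo the maximal ideal,
    then [L(a)] would still lie in [C], against maximality. *)
Lemma max_subfield C k0 : is_local C -> subfield k0 -> k0 `<=` C ->
  exists L, [/\ subfield L, k0 `<=` L, L `<=` C
    & forall a, C a -> exists G : {poly K},
        [/\ coefs_in L G, ~ nonunits C (lead_coef G) & nonunits C G.[a]]].
Proof.
move=> lC sk kC; have rC := lC.1.
have [||L [[sL LC] kL maxL]] := @Zorn_above K [set L | subfield L /\ L `<=` C] k0 => //.
  move=> F FP F0 Ftot; split; last by move=> x [X /FP[_ XC] /XC].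
  split; first by apply: bigcup_subring => // X /FP[[]].
  by move=> x [X FX Xx]; exists X => //; have [[_ h] _] := FP X FX; exact: h.
have [rL iL] := sL.
exists L; split=> // a Ca; apply: contrapT => nG.
have unit G : coefs_in L G -> G != 0 -> ~ nonunits C G.[a].
  move=> LG G0 nGa; apply: nG; exists G; split=> // /(nonunitP lC)[_ [/eqP|]].
    by rewrite lead_coef_eq0 (negbTE G0).
  by apply; apply/LC/iL/LG.
have adjC : adjoin L a `<=` C by exact: adjoin_sub.
have aL : L a.
  rewrite -(maxL (fadjoin L a)); first exact: fadjoin_mem.
    split; first exact: fadjoin_subfield.
    move=> _ [x /adjC Cx [_ [[G LG <-] G0] <-]]; apply: subringM => //.
    apply: nonunit_inv => //; first by apply: adjC; exists G.
    by apply: unit => //; apply: contraNneq G0 => ->; rewrite horner0.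
  exact: fadjoin_base.
apply: (unit ('X - a%:P)); rewrite ?polyXsubC_eq0 //.
  move=> i; rewrite coefB coefX coefC; apply: subringB => //; first exact: subring_nat.
  by case: eqP => // _; exact: subring0.
by rewrite hornerXsubC subrr; apply/(nonunitP lC); split; [exact: subring0|left].
Qed.

Lemma derivationD D x y : derivation D -> D (x + y) = D x + D y.
Proof. by move=> [DD _]; exact: DD. Qed.
Lemma derivationM D x y : derivation D -> D (x * y) = D x * y + x * D y.
Proof. by move=> [_ DM]; exact: DM. Qed.
Lemma derivationB D x y : derivation D -> D (x - y) = D x - D y.
Proof. by move=> dD; apply: (addIr (D y)); rewrite -derivationD // !subrK. Qed.

Lemma derivation_horner D (p : {poly K}) a : derivation D ->
  D p.[a] = \sum_(i < size p) D p`_i * a ^+ i + p^`().[a] * D a.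
Proof.
move=> dD; pose j : {rmorphism K -> K} := idfun.
have DD x y : D (x + y) = D x + D y by exact: derivationD.
have mapj (q : {poly K}) : map_poly j q = q by apply: map_poly_id.
transitivity (extd j D a (D a) p); last first.
  rewrite /extd mapj; congr (_ + _); rewrite /dpoly horner_poly //.
elim/poly_ind: p => [|p c IH].
  by rewrite horner0 derivation0 // -polyC0 (extdC _ DD) derivation0.
rewrite (extdD _ DD) (extdMX _ DD) -IH (extdC _ DD) mapj.
by rewrite hornerMXaddC derivationD // derivationM.
Qed.

Lemma derivation_frac0 D E : derivation D -> frac_field E -> (forall x, E x -> D x = 0) ->
  forall x, D x = 0.
Proof.
move=> dD fE DE x; have [a [b [Ea Eb b0 ->]]] := fE x.
have := derivationM (a / b) b dD; rewrite divfK // (DE a Ea) (DE b Eb) mulr0 addr0.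
by move/esym/eqP; rewrite mulf_eq0 (negbTE b0) orbF => /eqP.
Qed.

Section DerivationModulo.
Variables (C M : set K) (D : K -> K) (w x : seq K).
Hypotheses (lC : is_local C) (hM : is_submodule C M) (dD : derivation D).
Hypotheses (hw : forall c, C c -> span C [set` w] (D c))
  (mx : nonunits C = span C [set` x]) (hx : forall t, t \in x -> M (D t))
  (char0 : forall n, n.+1%:R != 0 :> K) (Qinv : forall n, C n.+1%:R^-1).
Let rC : is_subring C := lC.1.

Let good a := addm C M w (D a).
Let hN := addm_submodule lC hM w.

Let good_nonunits m : nonunits C m -> good m.
Proof.
have [N0 ND NM] := hN; have [_ [[m0 mD mM] _]] := lC.
move=> nm; apply: (proj2 (A := nonunits C m)).
have : span C [set` x] m by rewrite -mx.
apply: (@span_min _ C [set` x] [set m | nonunits C m /\ good m]).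
  split.
  - by split; [|rewrite /good derivation0].
  - by move=> a b [na ga] [nb gb]; split; [exact: mD|rewrite /good derivationD //; exact: ND].
  - move=> a b Ca [nb gb]; split; first exact: mM.
    rewrite /good derivationM //; apply: (ND); last exact: NM.
    by rewrite mulrC; apply: addmM => //; exact: hw.
move=> t tx; split; first by rewrite mx; exact: sub_span.
by apply: addm_base => //; exact: hx.
Qed.

(** Take [G] of least degree. Its derivative has smaller degree and, in characteristic zero, a unit
    as leading coefficient, so [G'(a)] is a unit and differentiating [G(a)] isolates [D a]. The
    coefficients range over any subring already known to be good, which allows two successive uses
    in a tower: over a subfield, then over a local ring. *)
Lemma good_algebraic A a : is_subring A -> A `<=` C -> (forall c, A c -> addm C M w (D c)) ->
  C a -> (exists G : {poly K}, [/\ coefs_in A G, ~ nonunits C (lead_coef G) & nonunits C G.[a]]) ->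
  addm C M w (D a).
Proof.
move=> rA AC gA Ca [G0 hG0].
have [N0 ND NM] := hN.
have ex : exists n, `[< exists G : {poly K},
    [/\ coefs_in A G, ~ nonunits C (lead_coef G) & nonunits C G.[a]] /\ size G = n >].
  by exists (size G0); apply/asboolP; exists G0.
have [n /asboolP[G [[AG lG nG] sG]] minG] := ex_minnP ex.
have n1 : (1 < size G)%N.
  rewrite ltnNge; apply/negP => /size1_polyC Gc; apply: lG.
  by move: nG; rewrite Gc hornerC lead_coefC.
have adjC : adjoin A a `<=` C by exact: adjoin_sub.
have AG' : coefs_in A G^`() by move=> i; rewrite coef_deriv -mulr_natr; apply: subringM => //; exact: subring_nat.
have CG'a : C G^`().[a] by apply: adjC; exists G^`().
have G'unit : ~ nonunits C G^`().[a].
  move=> nG'; have G00 : G != 0 by rewrite -size_poly_gt0 (leq_trans _ n1).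
  have sG' := lt_size_deriv G00.
  suff lG' : ~ nonunits C (lead_coef G^`()).
    have : (n <= size G^`())%N by apply: minG; apply/asboolP; exists G^`().
    by rewrite leqNgt -sG sG'.
  have cG' : G^`()`_(size G).-2 = lead_coef G * (size G).-2.+1%:R.
    by rewrite mulr_natr coef_deriv lead_coefE; case: (size G) n1 => [|[|m]].
  have lcu : ~ nonunits C (lead_coef G * (size G).-2.+1%:R).
    move=> h; apply: lG; rewrite -(mulfK (char0 (size G).-2) (lead_coef G)).
    exact: (primeMr (nonunits_prime lC) (Qinv _) h).
  suff -> : lead_coef G^`() = G^`()`_(size G).-2 by rewrite cG'.
  rewrite lead_coefE; congr (_`_ _).
  have : G^`()`_(size G).-2 != 0.
    by rewrite cG'; apply/eqP => e0; apply: lcu; rewrite e0; apply/(nonunitP lC); split; [exact: subring0|left].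
  move=> c0; have : ((size G).-2 < size G^`())%N.
    by rewrite ltnNge; apply: contra c0 => h; rewrite nth_default.
  by move: sG'; case: (size G) n1 => [|[|m]] //= _; rewrite ltnS => h1 h2; apply/eqP; rewrite -eqSS eqn_leq; case: (size G^`()) h1 h2 => //= k; rewrite ltnS => -> ->.
have : addm C M w (D G.[a]) by exact: good_nonunits.
rewrite derivation_horner // => h.
rewrite -[D a](mulKf (_ : G^`().[a] != 0)); last first.
  by apply/eqP => e0; apply: G'unit; rewrite e0; apply/(nonunitP lC); split; [exact: subring0|left].
apply: (NM); first exact: nonunit_inv.
rewrite -[X in addm C M w X](addKr (\sum_(i < size G) D G`_i * a ^+ i)) addrC.
apply: (submoduleB rC hN) => //.
apply: (submodule_sum _ hN) => i _; rewrite mulrC; apply: (NM); first exact: subringX.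
exact: gA.
Qed.

Lemma derivation_modulo : [set` w] `<=` [set D c | c in C] ->
  (forall c, C c -> addm C M w (D c)) -> forall c, C c -> M (D c).
Proof.
move=> wC gC c /hw; apply: span_min => //; apply: (nakayama lC hM) => u /wC[a Ca <-].
exact: gC.
Qed.

End DerivationModulo.

(* [Omega_{C/k0}] is finitely generated *)
Definition fin_diff k0 C : Prop := exists s : seq K, [set` s] `<=` C /\
  forall D, derivation D -> (forall x, k0 x -> D x = 0) ->
    forall x, C x -> span C [set` map D s] (D x).

Lemma span_subring_mono A B S S' : A `<=` B -> S `<=` S' -> span A S `<=` span B S'.
Proof.
move=> AB SS; have [s0 sD sM] := span_submodule B S'.
apply: span_min; last by move=> x /SS; exact: sub_span.
by split=> // a x /AB; exact: sM.
Qed.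

Lemma fin_diff_base k0 : is_subring k0 -> fin_diff k0 k0.
Proof.
move=> rk; exists [::]; split=> // D dD Dk x /Dk ->.
by case: (span_submodule k0 [set` map D [::]]).
Qed.

Lemma fin_diff_finite_type k0 A B : fin_diff k0 A -> is_subring A -> finite_type A B -> fin_diff k0 B.
Proof.
move=> [s [sA hs]] rA [s' Bs].
have rB : is_subring B by rewrite Bs; exact: smallest_subring.
have AB : A `<=` B by rewrite Bs => x Ax; apply: sub_gen_smallest; left.
have sB : [set` s'] `<=` B by rewrite Bs => x Ax; apply: sub_gen_smallest; right.
exists (s ++ s'); split.
  by move=> x /=; rewrite mem_cat => /orP[/sA/AB|/sB].
move=> D dD Dk x Bx; pose S := span B [set` map D (s ++ s')].
have [S0 SD SM] := span_submodule B [set` map D (s ++ s')].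
suff : B `<=` [set x | B x /\ S (D x)] by move=> /(_ x Bx)[].
rewrite {1}Bs; apply: smallest_sub.
  apply/subringP; split.
  - by split; [exact: subring1|rewrite derivation1].
  - move=> u v [Bu Su] [Bv Sv]; split; first exact: subringB.
    by rewrite derivationB //; apply: (submoduleB rB (span_submodule _ _)).
  - move=> u v [Bu Su] [Bv Sv]; split; first exact: subringM.
    by rewrite derivationM //; apply: (SD); [rewrite mulrC|]; exact: SM.
move=> u [Au|us]; split; [exact: AB| |exact: sB|].
  apply: (span_subring_mono AB _ (hs D dD Dk u Au)) => v /=.
  by rewrite map_cat mem_cat => ->.
by apply: sub_span; rewrite /= map_cat mem_cat orbC map_f.
Qed.

Lemma fin_diff_localization k0 A p : fin_diff k0 A -> is_subring A -> prime_ideal A p ->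
  fin_diff k0 (localization A p).
Proof.
move=> [s [sA hs]] rA pp; have AL := loc_sub rA pp; have rL := loc_subring rA pp.
exists s; split; first by move=> x /sA /AL.
move=> D dD Dk _ [x Ax [y [Ay py] <-]].
have y0 := prime_neq0 pp py; have Li := loc_inv rA Ay py.
have [S0 SD SM] := span_submodule (localization A p) [set` map D s].
have sub : span A [set` map D s] `<=` span (localization A p) [set` map D s].
  exact: span_subring_mono.
have -> : D (x / y) = y^-1 * D x + (- (x / y) * y^-1) * D y.
  have := derivationM (x / y) y dD; rewrite divfK // => ->.
  by field.
apply: (SD); apply: (SM) => //; try by apply: sub; exact: hs.
apply: subringM => //; apply: subringN => //; apply: subringM => //; exact: AL.
Qed.

End Differential.

(** * Regular local rings *)

Section RegularLocal.
Variable K : fieldType.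
Implicit Types A B C E F L M R : set K.
Implicit Types D : K -> K.
Variable k0 : set K.
Hypotheses (sk : subfield k0) (char0 : forall n, n.+1%:R != 0 :> K) (fg : fin_gen k0).

Let Qinv n : k0 n.+1%:R^-1.
Proof. by apply: sk.2; apply: subring_nat; exact: sk.1. Qed.

Lemma fin_gen_sub F F' : F `<=` F' -> fin_gen F -> fin_gen F'.
Proof.
by move=> FF' [s hs]; exists s => S sS F'S; apply: hs => //; exact: subset_trans F'S.
Qed.

Lemma derivation_lin (n : nat) (c : 'I_n -> K) (D : 'I_n -> K -> K) :
  (forall i, derivation (D i)) -> derivation (fun x => \sum_i c i * D i x).
Proof.
move=> dD; split=> x y _ _.
  by rewrite -big_split; apply: eq_bigr => i _; rewrite derivationD // mulrDr.
rewrite mulr_suml mulr_sumr -big_split; apply: eq_bigr => i _ /=.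
by rewrite derivationM //; ring.
Qed.

Lemma derivation_comb (c d : K) f g : derivation f -> derivation g ->
  derivation (fun x => c * f x - d * g x).
Proof.
move=> df dg; split=> x y _ _.
  by rewrite (derivationD x y df) (derivationD x y dg) !mulrDr opprD addrACA.
rewrite (derivationM x y df) (derivationM x y dg).
move: (f x) (f y) (g x) (g y) => fx fy gx gy; ring.
Qed.

Lemma zero_submodule C : is_submodule C [set (0 : K)].
Proof. by split=> // [x y -> ->|a x _ ->]; rewrite ?addr0 ?mulr0. Qed.

(* For a minimal relation [G] one has [G'(a) D(a) = D(G(a))] modulo [D(L) = 0], and
   [G(a)] lies in the maximal ideal; Nakayama's lemma does the rest. *)
Lemma derivation_generators C L D (x : seq K) M : is_local C -> k0 `<=` L -> L `<=` C -> subfield L ->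
  (forall a, C a -> exists G : {poly K},
     [/\ coefs_in L G, ~ nonunits C (lead_coef G) & nonunits C G.[a]]) ->
  fin_diff k0 C -> nonunits C = span C [set` x] -> is_submodule C M ->
  derivation D -> (forall a, L a -> D a = 0) -> (forall t, t \in x -> M (D t)) ->
  forall a, C a -> M (D a).
Proof.
move=> lC kL LC sL alg [s [sC hs]] mx hM dD DL Dx.
have hw : forall c, C c -> span C [set` map D s] (D c).
  by apply: hs => // a /kL; exact: DL.
have QC n : C n.+1%:R^-1 by apply/LC/kL/Qinv.
have wC : [set` map D s] `<=` [set D c | c in C].
  by move=> _ /mapP[c cs ->]; exists c => //; exact: sC.
apply: (derivation_modulo lC hM hw wC) => c Cc.
apply: (good_algebraic lC hM dD hw mx Dx char0 QC (sL.1) LC) => //; last exact: alg.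
move=> a La; rewrite DL //; by case: (addm_submodule lC hM (map D s)).
Qed.

(** The derivations are dual to the parameters. A maximal chain of primes gives as many derivations,
    killing [L] and independent by triangularity. A combination of them that kills the parameters
    kills [C], hence [K]; so the matrix of their values at the parameters is invertible, and its
    inverse corrects them. The corrected ones preserve [C] because they take the generators of the
    maximal ideal into [C]. *)
Lemma regular_derivations C (x : seq K) : is_local C -> k0 `<=` C -> frac_field C ->
  fin_diff k0 C -> regular_parameters C x ->
  exists D : 'I_(size x) -> K -> K, forall i, [/\ derivation (D i),
    (forall a, k0 a -> D i a = 0), (forall a, C a -> C (D i a))
    & forall j : 'I_(size x), D i x`_j = (i == j)%:R].
Proof.
move=> lC kC fC dC [[[p [pp pS]] _] mx]; have rC := lC.1.
have [L [sL kL LC alg]] := max_subfield lC sk kC.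
have Lp : L `<=` localization C (p (size x)).
  by apply: subset_trans LC _; apply: loc_sub => //; exact: pp.
have [z [D0 hD0]] := chain_derivations char0 rC pp pS sL Lp (fin_gen_sub kL fg).
pose n := size x.
pose D (i : 'I_n) := D0 i.
have dD (i : 'I_n) : derivation (D i) by have [] := hD0 i (ltn_ord i).
have DL (i : 'I_n) a : L a -> D i a = 0.
  by have [_ h _ _] := hD0 i (ltn_ord i); exact: h.
have kill (c : 'I_n -> K) : (forall j : 'I_n, \sum_i c i * D i x`_j = 0) ->
    forall a, \sum_i c i * D i a = 0.
  move=> hx; apply: (derivation_frac0 (derivation_lin c dD) fC).
  apply: (derivation_generators lC kL LC sL alg dC mx (zero_submodule C) (derivation_lin c dD)).
    by move=> a La; apply: big1 => i _; rewrite DL // mulr0.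
  move=> t tx /=; have ti : (index t x < n)%N by rewrite index_mem.
  by rewrite -(nth_index 0 tx); exact: (hx (Ordinal ti)).
have indep (c : 'I_n -> K) : (forall a, \sum_i c i * D i a = 0) -> forall i, c i = 0.
  move=> hc i; have [m] := ubnP (n - i); elim: m i => // m IH i hi.
  have := hc (z i); rewrite (bigD1 i) //=.
  have [_ _ h1 _] := hD0 i (ltn_ord i); rewrite /D h1 mulr1 big1 ?addr0// => j ji.
  have [lt|gt|/val_inj e] := ltngtP j i.
  - by have [_ _ _ ->] := hD0 j (ltn_ord j); rewrite ?mulr0 // lt ltn_ord.
  - rewrite (IH j) ?mul0r //; have := ltn_ord j; lia.
  - by rewrite e eqxx in ji.
pose A := \matrix_(i < n, j < n) D i x`_j.
have uA : A \in unitmx.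
  rewrite -row_free_unit; apply: inj_row_free => v vA; apply/rowP => i; rewrite mxE.
  apply: (indep (fun i => v 0 i)); apply: kill => j.
  by have := congr1 (fun B : 'rV_n => B 0 j) vA; rewrite !mxE => e; rewrite -[RHS]e; apply: eq_bigr => l _; rewrite mxE.
pose D' (i : 'I_n) := fun a => \sum_l invmx A i l * D l a.
have dD' i : derivation (D' i) by exact: derivation_lin.
have D'L i a : L a -> D' i a = 0.
  by move=> La; apply: big1 => l _; rewrite DL // mulr0.
have D'x i (j : 'I_n) : D' i x`_j = (i == j)%:R.
  have := congr1 (fun B : 'M_n => B i j) (mulVmx uA); rewrite !mxE => <-.
  by apply: eq_bigr => l _; rewrite !mxE.
exists D' => i; split=> // [a /kL|]; first exact: D'L.
apply: (derivation_generators lC kL LC sL alg dC mx (subring_submodule rC) (dD' i) (D'L i)).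
move=> t tx; have ti : (index t x < n)%N by rewrite index_mem.
by rewrite -(nth_index 0 tx) (D'x i (Ordinal ti)); exact: subring_nat.
Qed.

(* With [d = d/dx_1], the element [x_1^n d^n(y)] is [(-1)^n n! y] modulo [C], while
   [x_2 d^n(y) = d^n(x_2 y)] lies in [C]; so [x_2 y] lies in [(x_1^n, x_2)] for all [n]. *)
Lemma regular_depth C (x : seq K) (y : K) : is_local C -> noetherian C -> k0 `<=` C ->
  frac_field C -> fin_diff k0 C -> regular_parameters C x -> (1 < size x)%N ->
  (forall m, nonunits C m -> C (y * m)) -> C y.
Proof.
move=> lC nC kC fC dC rp sx hy; have rC := lC.1; have [_ mx] := rp.
have [D hD] := regular_derivations lC kC fC dC rp.
have s0 : (0 < size x)%N by exact: ltnW.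
pose i1 := Ordinal s0; pose i2 := Ordinal sx.
have [dD _ DC Dx] := hD i1; set d := D i1 in dD DC Dx.
have dx1 : d x`_0 = 1 by have := Dx i1; rewrite eqxx.
have dx2 : d x`_1 = 0 by have := Dx i2.
have x20 : x`_1 != 0.
  have [dD2 _ _ Dx2] := hD i2; apply/eqP => x20.
  by have := Dx2 i2; rewrite eqxx /= x20 derivation0 // => /eqP; rewrite eq_sym oner_eq0.
have nx1 : nonunits C x`_0 by rewrite mx; apply: sub_span; exact: mem_nth.
have nx2 : nonunits C x`_1 by rewrite mx; apply: sub_span; exact: mem_nth.
have Cx1 : C x`_0 by case: nx1. have Cx2 : C x`_1 by case: nx2.
set x1 := x`_0 in dx1 nx1 Cx1; set x2 := x`_1 in dx2 x20 nx2 Cx2.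
have dX n : d (x1 ^+ n.+1) = n.+1%:R * x1 ^+ n.
  elim: n => [|n IH]; first by rewrite expr1 dx1 mulr1.
  by rewrite exprS derivationM // IH dx1 -[n.+2%:R]natr1 !exprS; ring.
pose y_ n := iter n d y.
have step n : C (x1 ^+ n.+1 * y_ n) /\ C (x1 ^+ n * y_ n - (-1) ^+ n * n`!%:R * y).
  elim: n => [|n [h1 h2]].
    rewrite expr1 /y_ /= mulrC; split; first exact: hy.
    by rewrite !mul1r subrr; exact: subring0.
  have h3 : C (x1 ^+ n.+1 * y_ n.+1 - (-1) ^+ n.+1 * (n.+1)`!%:R * y).
    have := DC _ h1; rewrite derivationM // dX -/(y_ n.+1) => h.
    have -> : x1 ^+ n.+1 * y_ n.+1 - (-1) ^+ n.+1 * (n.+1)`!%:R * y =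
       (n.+1%:R * x1 ^+ n * y_ n + x1 ^+ n.+1 * y_ n.+1)
       - n.+1%:R * (x1 ^+ n * y_ n - (-1) ^+ n * n`!%:R * y).
      by rewrite factS natrM !exprS; ring.
    apply: subringB => //; apply: subringM => //; exact: subring_nat.
  split=> //; rewrite exprS -mulrA.
  rewrite -[_ * y_ n.+1](subrK ((-1) ^+ n.+1 * (n.+1)`!%:R * y)) mulrDr.
  apply: subringD => //; first exact: subringM.
  rewrite mulrCA; apply: subringM => //; last by rewrite mulrC; exact: hy.
  apply: subringM => //; last exact: subring_nat.
  by apply: subringX => //; apply: subringN => //; exact: subring1.
pose b := x2 * y.
have Cb n : C (x2 * y_ n).
  elim: n => [|n IH]; first by rewrite mulrC; exact: hy.
  by have := DC _ IH; rewrite derivationM // dx2 mul0r add0r.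
have facinv n : C (n`!%:R^-1) /\ n`!%:R != 0 :> K.
  have := fact_gt0 n; case: (n`!) => // m _; split; [exact/kC/Qinv|exact: char0].
have idI : is_ideal C (span C [set x2]).
  split; first exact: span_submodule.
  by apply: span_min; [exact: subring_submodule|move=> _ ->].
have : span C [set x2] b.
  apply: (krull_intersection lC nC idI nx1) => n.
  have [_ h] := step n; have [fi f0] := facinv n.
  have sq : (-1) ^+ n * (-1) ^+ n = 1 :> K by rewrite -expr2 sqrr_sign.
  pose u := (-1) ^+ n * n`!%:R^-1 : K.
  have Cu : C u.
    by apply: subringM => //; apply: subringX => //; apply: subringN => //; exact: subring1.
  exists (- (u * (x1 ^+ n * y_ n - (-1) ^+ n * n`!%:R * y)) * x2), (u * (x2 * y_ n)); split.
  - rewrite span1 //; exists (- (u * (x1 ^+ n * y_ n - (-1) ^+ n * n`!%:R * y))) => //.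
    by apply: subringN => //; exact: subringM.
  - exact: subringM.
  - have e : u * ((-1) ^+ n * n`!%:R) = 1.
      by rewrite /u mulrACA sq mul1r mulVf.
    rewrite /b; transitivity (u * ((-1) ^+ n * n`!%:R) * (x2 * y)); first by rewrite e mul1r.
    by ring.
by rewrite span1 // => -[c Cc]; rewrite /b mulrC => /(mulfI x20) <-.
Qed.

(* Otherwise a derivation killing a uniformizer and a subfield [L] of [R'] maximal for
   inclusion would vanish; but [R'] contains two elements independent over [L]. *)
Lemma dvr_residue_transcendental E R' : dvr E -> fin_diff k0 E -> is_local R' -> k0 `<=` R' ->
  R' `<=` E -> nonunits R' `<=` nonunits E -> prime_chain R' 2 ->
  exists u, E u /\ forall G : {poly K}, coefs_in R' G -> ~ nonunits R' (lead_coef G) ->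
    ~ nonunits E G.[u].
Proof.
move=> dE fdE lR kR RE nRE [p [pp pS]]; have rR := lR.1.
have [lE nE fE [t [t0 ut]]] := dE.
apply: contrapT => nalg.
have [L [sL kL LR alg]] := max_subfield lR sk kR.
have Lp : L `<=` localization R' (p 2%N).
  by apply: subset_trans LR _; apply: loc_sub => //; exact: pp.
have [z [D hD]] := chain_derivations char0 rR pp pS sL Lp (fin_gen_sub kL fg).
have [d0 D0L D0z0 D0z1] := hD 0%N isT.
have [d1 D1L D1z1 _] := hD 1%N isT.
have {}D0z1 := D0z1 1%N isT.
have unitRE a : R' a -> ~ nonunits R' a -> ~ nonunits E a.
  move=> Ra nRa /(nonunitP lE)[_ [a0|]].
    by apply: nRa; apply/(nonunitP lR); rewrite a0; split; [exact: subring0|left].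
  by apply; apply: RE; exact: nonunit_inv.
have algE a : E a -> exists G : {poly K},
    [/\ coefs_in R' G, ~ nonunits E (lead_coef G) & nonunits E G.[a]].
  move=> Ea; apply: contrapT => nG; apply: nalg; exists a; split=> // G RG lG nGa.
  by apply: nG; exists G; split=> //; apply: unitRE => //; rewrite lead_coefE.
have mE : nonunits E = span E [set` [:: t]].
  by rewrite ut; congr (span E); apply/seteqP; split=> v /=; rewrite inE => /eqP.
have kill d : derivation d -> (forall a, L a -> d a = 0) -> d t = 0 -> forall a, d a = 0.
  move=> dd dL dt; apply: (derivation_frac0 dd fE).
  have [s [sE hs]] := fdE.
  have hw : forall c, E c -> span E [set` map d s] (d c).
    by apply: hs => // a /kL; exact: dL.
  have QE n : E n.+1%:R^-1 by apply/RE/kR/Qinv.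
  have wE : [set` map d s] `<=` [set d c | c in E].
    by move=> _ /mapP[c cs ->]; exists c => //; exact: sE.
  have dx : forall u, u \in [:: t] -> [set (0 : K)] (d u).
    by move=> u; rewrite inE => /eqP->.
  have hM := zero_submodule E.
  have goodL a : L a -> addm E [set 0] (map d s) (d a).
    by move=> /dL->; case: (addm_submodule lE hM (map d s)).
  have goodR a : R' a -> addm E [set 0] (map d s) (d a).
    move=> Ra; apply: (good_algebraic lE hM dd hw mE dx char0 QE sL.1 _ goodL).
    - by move=> c /LR/RE.
    - exact: RE.
    - have [G [LG lG nG]] := alg a Ra; exists G; split=> //; last exact: nRE.
      by apply: unitRE => //; rewrite lead_coefE; apply: LR.
  apply: (derivation_modulo lE hM hw wE) => a Ea.
  exact: (good_algebraic lE hM dd hw mE dx char0 QE rR RE goodR Ea (algE a Ea)).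
(* This combination kills [t] by construction, hence vanishes. At [z 1] it gives [D 0 t = 0]; then
   [D 0] itself kills [t] and vanishes, although it takes the value 1 at [z 0]. *)
have hz : forall a, D 0%N t * D 1%N a - D 1%N t * D 0%N a = 0.
  apply: kill.
  - exact: derivation_comb.
  - by move=> a La; rewrite (D0L a La) (D1L a La) !mulr0 subrr.
  - by rewrite mulrC subrr.
have D0t : D 0%N t = 0 by have := hz (z 1%N); rewrite D1z1 D0z1 mulr0 subr0 mulr1.
by have := kill _ d0 D0L D0t (z 0%N); rewrite D0z0 => /eqP; rewrite oner_eq0.
Qed.

End RegularLocal.

(** * Models of a germ *)

Section Finiteness.
Variable K : fieldType.
Implicit Types A B C E I p q : set K.

Lemma finite_set_enum (T : Type) (S : set T) : finite_set S ->
  exists (n : nat) (f : 'I_n -> T), forall x, S x <-> exists i, f i = x.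
Proof.
move=> fS; have /finite_seqP[s Ss] := fS : finite_set (S : set {classic T}).
exists (size s), (fun i => tnth (in_tuple s) i) => x; split.
  rewrite {}Ss => xs; have xs' : (index (x : {classic T}) s < size s)%N by rewrite index_mem.
  by exists (Ordinal xs'); rewrite (tnth_nth (x : {classic T})) /= nth_index.
by move=> [i <-]; rewrite Ss /=; exact: (mem_tnth i (in_tuple s)).
Qed.

Definition height_le1 A p : Prop :=
  prime_ideal A p /\ forall q, prime_ideal A q -> q `<=` p -> q = p \/ q = [set 0].

Lemma ideal_adjoin A I a : is_subring A -> is_ideal A I -> A a ->
  is_ideal A [set x | exists i b, [/\ I i, A b & x = i + b * a]].
Proof.
move=> rA [[I0 ID IM] IA] Aa; split; last first.
  by move=> _ [i [b [/IA Ai Ab ->]]]; apply: subringD => //; exact: subringM.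
split.
- by exists 0, 0; rewrite mul0r addr0; split=> //; exact: subring0.
- move=> _ _ [i [b [Ii Ab ->]]] [i' [b' [Ii' Ab' ->]]]; exists (i + i'), (b + b').
  by split; [exact: ID|exact: subringD|ring].
- move=> c _ Ac [i [b [Ii Ab ->]]]; exists (c * i), (c * b).
  by split; [exact: IM|exact: subringM|ring].
Qed.

(** Noetherian induction on an ideal [I] containing [x]. If [I] is prime, it is the only prime of
    height at most one above it, as [x] is nonzero. Otherwise [I] contains a product [a * b] of
    elements outside it, and each prime above [I] contains [a] or [b]. *)
Lemma finite_height_le1 A (x : K) : is_subring A -> noetherian A -> A x -> x != 0 ->
  finite_set [set p | height_le1 A p /\ p x].
Proof.
move=> rA nA Ax x0.
pose over I := [set p | height_le1 A p /\ I `<=` p].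
suff key I : is_ideal A I -> I x -> finite_set (over I).
  have hx : is_ideal A (span A [set x]).
    split; first exact: span_submodule.
    by apply: span_min; [exact: subring_submodule|move=> _ ->].
  have := key _ hx (sub_span _); rewrite /over => /(_ erefl).
  apply: sub_finite_set => p [hp px]; split=> //.
  by apply: span_min; [case: hp => [[[]]]|move=> _ ->].
move=> idI Ix; apply: contrapT => infI.
have [||I' [[idI' I'x infI'] _ maxI]] := @noetherian_max K A
    [set J | [/\ is_ideal A J, J x & ~ finite_set (over J)]] I nA => //.
  by move=> J [].
apply: infI'.
have [I'0 I'A] := idI'; have [i0 iD iM] := I'0.
have [I1|I1] := pselect (I' 1).
  apply: (@sub_finite_set _ _ set0) => // p [[[_ p1 _] _] I'p].
  by apply: p1; exact: I'p.
have [pI|npI] := pselect (prime_ideal A I').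
  apply: (@sub_finite_set _ _ [set I']) => // p [[pp hp] I'p].
  case: (hp I' pI I'p) => [->//|I'z]; move: I'x; rewrite I'z => /eqP.
  by rewrite (negbTE x0).
have [a [b [Aa Ab Iab na nb]]] : exists a b, [/\ A a, A b, I' (a * b), ~ I' a & ~ I' b].
  apply: contrapT => nab; apply: npI; split=> // a b Aa Ab Iab.
  by apply: contrapT => /not_orP[na nb]; apply: nab; exists a, b.
have fin c : A c -> ~ I' c -> finite_set (over [set x | exists i b, [/\ I' i, A b & x = i + b * c]]).
  move=> Ac nc; apply: contrapT => inf; apply: nc.
  set J := [set x | _] in inf.
  have I'J : I' `<=` J.
    by move=> i Ii; exists i, 0; rewrite mul0r addr0; split=> //; exact: subring0.
  rewrite -(maxI J) //.
    by exists 0, 1; rewrite mul1r add0r; split=> //; exact: subring1.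
  by split=> //; [exact: ideal_adjoin|exact: I'J].
have := conj (fin a Aa na) (fin b Ab nb); rewrite -finite_setU.
apply: sub_finite_set => p [[pp hp] I'p].
have [_ _ h] := pp.
case: (h a b Aa Ab (I'p _ Iab)) => [pa|pb]; [left|right]; split=> // _ [i [c [Ii Ac ->]]].
  by apply: (primeD pp); [exact: I'p|exact: (primeMl pp)].
by apply: (primeD pp); [exact: I'p|exact: (primeMl pp)].
Qed.

Lemma prime_chainW A d d' : (d' <= d)%N -> prime_chain A d -> prime_chain A d'.
Proof.
move=> dd' [p [pp pS]]; exists p; split=> i id.
  by apply: pp; exact: leq_trans id dd'.
by apply: pS; exact: leq_trans id dd'.
Qed.

Lemma krull_dim_unique A d d' : krull_dim A d -> krull_dim A d' -> d = d'.
Proof.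
move=> [c nc] [c' nc']; apply/eqP; rewrite eqn_leq; apply/andP; split.
  by rewrite leqNgt; apply/negP => h; apply: nc'; apply: prime_chainW c.
by rewrite leqNgt; apply/negP => h; apply: nc; apply: prime_chainW c'.
Qed.

Lemma prime_chain2 A p0 p1 p2 : prime_ideal A p0 -> prime_ideal A p1 -> prime_ideal A p2 ->
  p0 `<` p1 -> p1 `<` p2 -> prime_chain A 2.
Proof.
move=> h0 h1 h2 h01 h12; exists (fun i => if i is i'.+1 then if i' is _.+1 then p2 else p1 else p0).
by split=> [[|[|[|i]]]|[|[|i]]].
Qed.

Lemma loc_dim1_height A p : is_subring A -> prime_ideal A p -> krull_dim (localization A p) 1 ->
  height_le1 A p.
Proof.
move=> rA pp [_ nc]; split=> // q pq qp; apply: contrapT => /not_orP[qnp qn0]; apply: nc.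
have z := prime_zero rA; have rL := loc_subring rA pp.
have zq : [set 0] `<=` q by move=> _ ->; exact: prime0 pq.
have inj a b : prime_ideal A a -> prime_ideal A b -> a `<=` p -> b `<=` p -> locp A p a `<=` locp A p b -> a `<=` b.
  move=> pa pb ap bp ab; rewrite -(locpI rA pp pa ap) -(locpI rA pp pb bp).
  by move=> x [/ab].
have mono a b : a `<=` b -> locp A p a `<=` locp A p b.
  by move=> ab _ [x ax [y hy <-]]; exists x; [exact: ab|exists y].
have zp := subset_trans zq qp.
apply: (@prime_chain2 _ (locp A p [set 0]) (locp A p q) (locp A p p)).
- exact: locp_prime.
- exact: locp_prime.
- exact: locp_prime.
- split; first exact: mono.
  by move=> /(inj _ _ pq z qp zp) h; apply: qn0; apply/seteqP.
- split; first exact: mono.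
  by move=> /(inj _ _ pp pq (@subset_refl _ p) qp) h; apply: qnp; apply/seteqP.
Qed.

Lemma regular_dim1_dvr E : regular_local E -> frac_field E -> krull_dim E 1 -> dvr E.
Proof.
move=> [lE nE [x [dx mx]]] fE d1; split=> //.
have sx := krull_dim_unique dx d1.
case: x sx mx dx => [|t [|//]] // _ mx _; exists t.
have mt : nonunits E = span E [set t].
  by rewrite mx; congr (Defs.span E); apply/seteqP; split=> v /=; rewrite inE => /eqP.
split=> //; apply/eqP => t0.
have [[p [pp pS]] _] := d1.
have [_] := pS 0%N isT; apply=> a pa.
have := prime_sub_nonunits (pp 1%N isT) pa.
rewrite mt t0 span1; last by case: lE.
by move=> [c _ <-]; rewrite mulr0; exact: prime0 (pp 0%N isT).
Qed.

End Finiteness.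

(** The working hypotheses: the ground field has become the subfield [k0] of [K], and smoothness
    appears as regularity of all localizations of [R] together with finiteness of differentials. *)
Record germ_model (K : fieldType) (k0 R : set K) (Y : set (set K)) : Prop := GermModel {
  gm_subfield : subfield k0;
  gm_char0 : forall n, n.+1%:R != 0 :> K;
  gm_fin_gen : fin_gen k0;
  gm_sub : k0 `<=` R;
  gm_subring : is_subring R;
  gm_frac : frac_field R;
  gm_fin_diff : fin_diff k0 R;
  gm_noetherian : noetherian R;
  gm_regular : forall p, prime_ideal R p -> regular_local (localization R p);
  gm_proper : proper_model R Y;
  gm_points : forall C, Y C -> regular_local C
}.

Section Model.
Variables (K : fieldType) (R : set K) (Y : set (set K)) (k0 : set K).
Implicit Types C B E p q : set K.
Hypothesis M : germ_model k0 R Y.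
Let sk := gm_subfield M. Let char0 := gm_char0 M. Let fg := gm_fin_gen M.
Let kR := gm_sub M. Let rR := gm_subring M. Let nR := gm_noetherian M.
Let fR := gm_frac M. Let dR := gm_fin_diff M. Let regR := gm_regular M.
Let pY := gm_proper M. Let regY := gm_points M.

Lemma point_chart C : Y C -> exists A p,
  [/\ is_subring A, noetherian A, R `<=` A & fin_diff k0 A] /\
  [/\ prime_ideal A p, C = localization A p
    & forall q, prime_ideal A q -> Y (localization A q)].
Proof.
have [[n [A [fA YE]]] _] := pY; rewrite YE => -[i _ [p pp <-]].
have ftA := fA i; have [s As] := ftA.
have rA : is_subring (A i) by rewrite As; exact: smallest_subring.
have RA : R `<=` A i by rewrite As => x Rx; apply: sub_gen_smallest; left.
exists (A i), p; split; split=> //.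
- exact: finite_type_noetherian ftA.
- exact: fin_diff_finite_type ftA.
- by move=> q pq; exists i => //; exists q.
Qed.

Lemma frac_sub C : R `<=` C -> frac_field C.
Proof. by move=> RC x; have [a [b [Ra Rb b0 ->]]] := fR x; exists a, b; split=> //; exact: RC. Qed.

Lemma point_sub C : Y C -> R `<=` C.
Proof.
by move=> /point_chart[A [p [[rA _ RA _] [pp -> _]]]]; apply: subset_trans RA _; exact: loc_sub.
Qed.

Lemma point_local C : Y C -> is_local C. Proof. by case/regY. Qed.
Lemma point_subring C : Y C -> is_subring C. Proof. by case/point_local. Qed.
Lemma point_noetherian C : Y C -> noetherian C. Proof. by case/regY. Qed.
Lemma point_frac C : Y C -> frac_field C.
Proof. by move=> /point_sub; exact: frac_sub. Qed.
Lemma point_fin_diff C : Y C -> fin_diff k0 C.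
Proof.
by move=> /point_chart[A [p [[rA _ RA dA] [pp -> _]]]]; exact: fin_diff_localization.
Qed.

Lemma point_localization C q : Y C -> prime_ideal C q -> Y (localization C q).
Proof.
move=> /point_chart[A [p [[rA _ RA _] [pp -> YA]]]] pq; rewrite loc_loc //.
by apply: YA; apply: prime_contract pq => //; exact: loc_sub.
Qed.

(** Separatedness at work: a valuation ring dominating [B] also dominates the localization of [C] at
    the prime below [B], and it is centered at a single point of [Y]. *)
Lemma point_eq B C : Y B -> Y C -> C `<=` B -> B = localization C (nonunits B `&` C).
Proof.
move=> YB YC CB; have lB := point_local YB; have rC := point_subring YC.
have pq := prime_contract rC CB (nonunits_prime lB).
set q := nonunits B `&` C in pq *.
have [V vV [BV mBV]] := dominating_valuation lB.
have RV : R `<=` V by apply: subset_trans BV; exact: point_sub.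
have [_ /(_ V vV RV)[D [_ uD]]] := pY.
have uB : D = B by apply: uD.
rewrite -uB; apply: uD; split; first exact: point_localization.
have inv y : C y -> ~ q y -> B y^-1.
  by move=> Cy qy; apply: nonunit_inv => //; [exact: CB|move=> ny; apply: qy].
split.
  move=> _ [x Cx [y [Cy qy] <-]]; apply: BV; apply: subringM; first by case: lB.
    exact: CB.
  exact: inv.
rewrite loc_nonunits // => _ [x [nx Cx] [y [Cy qy] <-]]; apply: mBV.
by apply: (primeMr (nonunits_prime lB)) => //; exact: inv.
Qed.

Lemma divisor_dvr E : prime_divisor Y E -> dvr E.
Proof. by move=> [YE dE]; apply: regular_dim1_dvr => //; [exact: regY|exact: point_frac]. Qed.

Lemma divisor_eq E E' : prime_divisor Y E -> prime_divisor Y E' -> E' `<=` E -> E' = E.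
Proof.
move=> pE pE' EE'; symmetry; apply: (dvr_maximal (divisor_dvr pE')) => //.
  by apply: point_subring; case: pE.
exact/dvr_neqT/divisor_dvr.
Qed.

(* A maximal ideal of denominators is prime, and localizing there contradicts
   [regular_depth]. *)
Theorem hartogs C h : Y C -> (forall E, prime_divisor Y E -> C `<=` E -> E h) -> C h.
Proof.
move=> YC hE; have rC := point_subring YC; have nC := point_noetherian YC.
apply: contrapT => nCh.
pose I c := [set a | C a /\ C (a * (c * h))].
have idI c : is_ideal C (I c).
  split; last by move=> a [].
  split.
  - by split; rewrite ?mul0r; exact: subring0.
  - by move=> a b [Ca Ia] [Cb Ib]; split; rewrite ?mulrDl; exact: subringD.
  - by move=> a b Ca [Cb Ib]; split; rewrite -?mulrA; exact: subringM.
have [||J [[c [Cc nch] <-] _ maxc]] := @noetherian_max K C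
   [set J | exists2 c, C c /\ ~ C (c * h) & I c = J] (I 1) nC.
- by move=> _ [c _ <-].
- by exists 1; rewrite ?mul1r //; split=> //; exact: subring1.
have pI : prime_ideal C (I c).
  split=> //; first by case=> _; rewrite mul1r.
  move=> a b Ca Cb [Cab Iab]; have [Ib|nIb] := pselect (I c b); [by right|left].
  have nb : ~ C (b * (c * h)) by move=> h'; apply: nIb.
  rewrite -(maxc (I (b * c))).
  - by split=> //; rewrite -mulrA mulrA.
  - by exists (b * c) => //; rewrite -mulrA; split=> //; exact: subringM.
  - move=> e [Ce Ie]; split=> //; rewrite -mulrA mulrCA; exact: subringM.
set y := c * h in nch.
have YB := point_localization YC pI; set B := localization C (I c) in YB.
have CB : C `<=` B by exact: loc_sub.
have rB := point_subring YB.
have nBy : ~ B y.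
  move=> [a Ca [b [Cb nIb] ab]]; apply: nIb; split=> //.
  have b0 : b != 0 by apply/eqP => b0; rewrite -/y -ab b0 invr0 mulr0 in nch; apply: nch; exact: subring0.
  by rewrite -/y -ab mulrC divfK.
have By m : nonunits B m -> B (y * m).
  rewrite loc_nonunits // => -[a [Ca Ia] [b [Cb nIb] <-]].
  by rewrite mulrCA mulrA; exists (a * y) => //; exists b.
have [lB nB [x rp]] := regY YB; have [dx mx] := rp.
have kB : k0 `<=` B by apply: subset_trans kR (point_sub YB).
case: x rp dx mx => [|t [|t' x]] rp dx mx.
- (* [B] is a field: the ideal of denominators of [y] would be zero *)
  have [a [b [Ca Cb b0 yab]]] := point_frac YC y.
  apply: nBy; rewrite yab; apply: subringM => //; first exact: CB.
  apply: nonunit_inv => //; first exact: CB.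
  by rewrite mx span_nil => /eqP; rewrite (negbTE b0).
- have pB : prime_divisor Y B by [].
  by apply: nBy; apply: subringM; [|exact: CB|exact: hE].
- apply: nBy; exact: (regular_depth sk char0 fg lB nB kB (point_frac YB) (point_fin_diff YB) rp).
Qed.

End Model.

(** * Divisors and their restrictions *)

Section OrdGe.
Variables (K : fieldType) (Q : archiRealDomainType) (E : set K) (dE : dvr E).
Implicit Types (c d : Q) (f g : K).

Lemma ord_ge_zero c : ord_ge E c 0.
Proof. by apply/(ord_geP dE); left. Qed.

Lemma ord_geW c d f : c <= d -> ord_ge E d f -> ord_ge E c f.
Proof.
move=> cd /(ord_geP dE)[->|h]; first exact: ord_ge_zero.
by apply/(ord_geP dE); right; exact: le_trans h.
Qed.

Lemma ord_ge_submodule c : is_submodule E (ord_ge E c).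
Proof.
have [lE _ _ [t ut]] := dE; have rE := lE.1.
have P f : ord_ge E c f <-> E (f / t ^ Num.ceil c).
  have [->|f0] := eqVneq f 0.
    by rewrite mul0r; split=> _; [exact: subring0|exact: ord_ge_zero].
  rewrite (ord_leP dE _ ut) // ceil_le_int (ord_geP dE); split; last by right.
  by case=> // /eqP; rewrite (negbTE f0).
split.
- exact: ord_ge_zero.
- by move=> f g /P Ef /P Eg; apply/P; rewrite mulrDl; exact: subringD.
- by move=> a f Ea /P Ef; apply/P; rewrite -mulrA; exact: subringM.
Qed.

Lemma ord_geB c f g : ord_ge E c f -> ord_ge E c g -> ord_ge E c (f - g).
Proof. by apply: (submoduleB _ (ord_ge_submodule c)); case: dE => -[]. Qed.

Lemma ord_geM c d f g : ord_ge E c f -> ord_ge E d g -> ord_ge E (c + d) (f * g).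
Proof.
move=> /(ord_geP dE) hf /(ord_geP dE) hg; apply/(ord_geP dE).
case: hf => [->|hf]; first by rewrite mul0r; left.
case: hg => [->|hg]; first by rewrite mulr0; left.
have [->|f0] := eqVneq f 0; first by rewrite mul0r; left.
have [->|g0] := eqVneq g 0; first by rewrite mulr0; left.
by right; rewrite ordM // intrD lerD.
Qed.

Lemma ord_ge_ord f c : f != 0 -> ord_ge E c f <-> c <= (ord E f)%:~R.
Proof.
by move=> f0; rewrite (ord_geP dE); split=> [[/eqP|//]|]; [rewrite (negbTE f0)|right].
Qed.

Lemma ord_ge_nonunit f : ord_ge E (1 : Q) f <-> nonunits E f.
Proof. by rewrite (ord_geP dE) (nonunits_dvr dE) ler1z gtz0_ge1. Qed.

End OrdGe.

Section ModelDivisors.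
Variables (K : fieldType) (R : set K) (Y : set (set K)) (k0 : set K).
Implicit Types C B E p q : set K.
Hypothesis M : germ_model k0 R Y.

(** Write [h = a / b] with [a] and [b] in [R]. On each of the finitely many charts, a divisor where
    [h] has nonzero order is a prime of height at most one containing [a] or [b]. *)
Lemma finite_ord_neq0 (h : K) : h != 0 -> finite_set [set E | prime_divisor Y E /\ ord E h != 0].
Proof.
move=> h0; have [a [b [Ra Rb b0 hab]]] := gm_frac M h.
have a0 : a != 0 by apply: contraNneq h0 => a0; rewrite hab a0 mul0r.
have [[n [A [fA YE]]] _] := gm_proper M.
pose F (i : 'I_n) (x : K) := localization (A i) @` [set p | height_le1 (A i) p /\ p x].
have rA i : is_subring (A i) by have [s ->] := fA i; exact: smallest_subring.
have RA i : R `<=` A i by have [s ->] := fA i => x Rx; apply: sub_gen_smallest; left.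
have fin : finite_set (\bigcup_(i in [set: 'I_n]) (F i a `|` F i b)).
  apply: bigcup_finite => [|i _]; first exact: finite_finset.
  have nA := finite_type_noetherian (gm_subring M) (gm_noetherian M) (fA i).
  by rewrite finite_setU; split; apply: finite_image; apply: finite_height_le1 => //; exact: RA.
apply: sub_finite_set fin => E [pE oE].
have dE := divisor_dvr M pE; have [YE' d1] := pE; move: YE'; rewrite YE => -[i _ [p pp Ep]].
have hp : height_le1 (A i) p by apply: loc_dim1_height => //; rewrite Ep.
exists i => //.
have unit x : A i x -> x != 0 -> ~ p x -> ord E x = 0.
  move=> Ax x0 px; apply: ord_unit => //; rewrite -Ep; [exact: loc_sub|exact: loc_inv].
have [pa|pa] := pselect (p a); first by left; exists p.
have [pb|pb] := pselect (p b); first by right; exists p.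
move: oE; rewrite hab ord_div // (unit a) ?(unit b) ?subr0 ?eqxx //; exact: RA.
Qed.

(** Geometrically, [C] has a basic neighborhood that avoids each of finitely many divisors not
    passing through [C]. *)
Lemma separating_seq (S : set (set K)) C : finite_set S -> exists u : seq K,
  [set` u] `<=` C /\ forall E, S E -> [set` u] `<=` E -> C `<=` E.
Proof.
move=> /finite_set_enum[n [f Sf]].
have /choice[c hc] : forall i : 'I_n, exists c, (C c \/ C `<=` f i) /\ (C c -> f i c -> C `<=` f i).
  move=> i; have [Cf|nCf] := pselect (C `<=` f i); first by exists 0; split; [right|].
  have [c [Cc nc]] : exists c, C c /\ ~ f i c.
    apply: contrapT => nc; apply: nCf => x Cx; apply: contrapT => nx.
    by apply: nc; exists x.
  by exists c; split=> //; left.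
exists [seq c i | i <- enum 'I_n & `[< C (c i) >]]; split.
  by move=> x /mapP[i]; rewrite mem_filter => /andP[/asboolP Cc _] ->.
move=> E /Sf[i <-] ui; have [Ci|//] := (hc i).1.
apply: (hc i).2 => //; apply: ui; apply/mapP; exists i => //.
by rewrite mem_filter mem_enum andbT; apply/asboolP.
Qed.

Variable Q : archiRealDomainType.
Implicit Types D : set K -> Q.

Lemma OYoppS D D' U : div_le D D' -> OYopp Y D' U `<=` OYopp Y D U.
Proof.
move=> DD f hf E pE UE; exact: (ord_geW (divisor_dvr M pE) (DD E) (hf E pE UE)).
Qed.

Lemma OYopp_stalkS D D' C : div_le D D' -> OYopp_stalk Y D' C `<=` OYopp_stalk Y D C.
Proof. by move=> DD f [u uC hf]; exists u => //; exact: OYoppS hf. Qed.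

Lemma IE_OYopp_stalkS D D' E C : div_le D D' ->
  IE_OYopp_stalk Y D' E C `<=` IE_OYopp_stalk Y D E C.
Proof.
move=> DD; apply: spanS => _ [x hx [y hy <-]]; exists x => //; exists y => //.
exact: OYopp_stalkS hy.
Qed.

Lemma IE_OYopp_generic D E g : prime_divisor Y E -> IE_OYopp_stalk Y D E E g ->
  ord_ge E (D E + 1) g.
Proof.
move=> pE; have dE := divisor_dvr M pE.
apply: (@span_min _ E _ (ord_ge E (D E + 1))); first exact: ord_ge_submodule.
move=> _ [x [nx _] [y [u [_ uE] hy] <-]]; rewrite addrC; apply: ord_geM => //.
  exact/ord_ge_nonunit.
by apply: hy => //; split=> //; case: pE.
Qed.

Hypothesis exc_principal : forall E C, exceptional R Y E -> Y C -> C `<=` E ->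
  exists t, ideal_stalk E C = span C [set t].

Lemma exceptional_divisor E : exceptional R Y E -> prime_divisor Y E.
Proof. by case. Qed.

(* [O_Y(-D)|_E] is torsion-free: [I_E] is invertible at [C], so a section of
   [O_Y(-D)] vanishing at the generic point of [E] is divisible by its generator. *)
Lemma restriction_torsion_free D E C u f : exceptional R Y E -> Y C -> C `<=` E ->
  basic_open Y u C -> OYopp Y D (basic_open Y u) f -> ord_ge E (D E + 1) f ->
  IE_OYopp_stalk Y D E C f.
Proof.
move=> eE YC CE [_ uC] hf of_; have pE := exceptional_divisor eE; have dE := divisor_dvr M pE.
have YE : Y E by case: pE.
have [t tq] := exc_principal eE YC CE; have EC := point_eq M YE YC CE.
have rC := point_subring M YC; have rE := point_subring M YE.
have pq : prime_ideal C (nonunits E `&` C).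
  exact: (prime_contract rC CE (nonunits_prime (point_local M YE))).
have nEt : (nonunits E `&` C) t by rewrite -/(ideal_stalk E C) tq; exact: sub_span.
have mEq : nonunits E = locp C (span C [set t]) (span C [set t]).
  by rewrite -tq {1}EC; exact: loc_nonunits.
have Einv y : C y -> ~ span C [set t] y -> E y^-1.
  by move=> Cy ny; rewrite [X in X _]EC; apply: loc_inv => // nEy; apply: ny; rewrite -tq.
have mE : nonunits E = span E [set t].
  rewrite span1 //; apply/seteqP; split.
    rewrite mEq => _ [x tx [y [Cy ny] <-]]; move: tx; rewrite span1 // => -[a Ca <-].
    exists (a / y); last by rewrite mulrAC.
    by apply: subringM => //; [exact: CE|exact: Einv].
  move=> _ [a Ea <-].
  by apply: (primeMl (nonunits_prime (point_local M YE))) => //; case: nEt.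
have t0 : t != 0.
  have [_ _ _ [t' [t'0 ut']]] := dE.
  apply: contraNneq t'0 => t0; have : nonunits E t' by rewrite ut'; exact: sub_span.
  by rewrite mE t0 span1 // => -[a _ <-]; rewrite mulr0.
have ot : ord E t = 1 by apply: ord_uniformizer.
(* [t] generates the prime of [E] in [C]; if it vanished along [E'], that prime would lie in the
   prime of [E'], making the ring [E'] a subring of [E]. *)
have ord0 E' : prime_divisor Y E' -> C `<=` E' -> E' <> E -> ord E' t = 0.
  move=> pE' CE' E'E; have dE' := divisor_dvr M pE'; have YE' : Y E' by case: pE'.
  have E't : E' t by apply: CE'; case: nEt.
  apply/eqP; rewrite eq_le; apply/andP; split; last exact: (ord_ge0 dE' t0 E't).
  rewrite leNgt; apply/negP => /(ord_gt0 dE' t0) nE't; apply: E'E.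
  apply: (divisor_eq M) => //; rewrite (point_eq M YE' YC CE') EC.
  move=> _ [x Cx [y [Cy ny] <-]]; exists x => //; exists y => //; split=> // nEy; apply: ny.
  have : span C [set t] y by rewrite -tq.
  rewrite span1 // => -[a Ca <-]; split; last by apply: subringM => //; case: nEt.
  by apply: (primeMl (nonunits_prime (point_local M YE'))) => //; exact: CE'.
(* [f / t] is a section only away from the other components of the divisor of [t]. None of them
   passes through [C], so shrinking the neighborhood removes them. *)
have [v [vC hv]] := separating_seq C (finite_ord_neq0 t0).
apply: sub_span; exists t; first exact: nEt.
exists (f / t); last by rewrite mulrC divfK.
exists (u ++ v).
  by split=> // x /=; rewrite mem_cat => /orP[/uC|/vC].
move=> E' pE' [YE' uvE']; have dE' := divisor_dvr M pE'.
have [->|f0] := eqVneq f 0; first by rewrite mul0r; exact: ord_ge_zero.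
have uE' : [set` u] `<=` E' by move=> x xu; apply: uvE'; rewrite /= mem_cat (_ : x \in u).
have vE' : [set` v] `<=` E' by move=> x xv; apply: uvE'; rewrite /= mem_cat orbC (_ : x \in v).
apply/ord_ge_ord => //; first by rewrite mulf_neq0 // invr_eq0.
rewrite ord_div //; have [E'E|E'E] := pselect (E' = E).
  by move: of_; rewrite E'E ot intrB lerBrDr => /ord_ge_ord; apply.
have [o0|o0] := eqVneq (ord E' t) 0.
  by rewrite o0 subr0; apply/ord_ge_ord => //; apply: hf.
by rewrite (ord0 E') ?subr0; [apply/ord_ge_ord => //; apply: hf|
  |apply: hv => //|].
Qed.

(** By torsion-freeness, a section that vanishes at the generic point of [E] vanishes at every point
    of [E]. *)
Lemma H0_generic_value D E : exceptional R Y E -> H0_restriction_neq0 Y D E ->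
  exists2 s, restricted_section Y D E s & ~ ord_ge E (D E + 1) (s E).
Proof.
move=> eE [s hs [C [YC CE nsC]]]; exists s => // osE; apply: nsC.
have pE := exceptional_divisor eE; have dE := divisor_dvr M pE; have YE : Y E by case: pE.
have [u uC [f hf hsf]] := hs C YC CE.
have uE : basic_open Y u E by split=> //; apply: subset_trans CE; case: uC.
have h1 := IE_OYopp_generic pE (hsf E uE (@subset_refl _ E)).
have of_ : ord_ge E (D E + 1) f.
  by rewrite -(subKr (s E) f); apply: ord_geB.
rewrite -(subrK f (s C)); have [_ h _] := span_submodule C
  [set x * y | x in ideal_stalk E C & y in OYopp_stalk Y D C].
by apply: h; [exact: hsf|exact: (restriction_torsion_free eE YC CE uC)].
Qed.

Lemma H0_restriction_mono D1 D2 E : exceptional R Y E -> div_le D2 D1 -> D2 E = D1 E ->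
  H0_restriction_neq0 Y D1 E -> H0_restriction_neq0 Y D2 E.
Proof.
move=> eE D21 DE /(H0_generic_value eE)[s hs nsE]; exists s.
  move=> C YC CE; have [u uC [f hf hsf]] := hs C YC CE.
  exists u => //; exists f; first exact: OYoppS hf.
  by move=> C' uC' C'E; apply: IE_OYopp_stalkS (hsf C' uC' C'E).
have pE := exceptional_divisor eE.
exists E; split=> //; first by case: pE.
by move=> /(IE_OYopp_generic pE); rewrite DE.
Qed.

Lemma H0_restriction_global D E f : exceptional R Y E -> f != 0 -> pushforward Y D f ->
  D E = (ord E f)%:~R -> H0_restriction_neq0 Y D E.
Proof.
move=> eE f0 hf DE; have pE := exceptional_divisor eE; have dE := divisor_dvr M pE.
exists (fun=> f); last first.
  exists E; split=> //; first by case: pE.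
  move=> /(IE_OYopp_generic pE) /ord_ge_ord => /(_ dE f0).
  by rewrite DE -[X in _ + X]/(1%:~R) -intrD ler_int; lia.
move=> C YC CE; exists [::]; first by split.
exists f; first by move=> E' pE' _; apply: hf => //; case: pE'.
by move=> C' _ _; rewrite subrr; case: (span_submodule C'
  [set x * y | x in ideal_stalk E C' & y in OYopp_stalk Y D C']).
Qed.

(** Turns a nonzero section into rational functions: [sigma] is its germ at the generic point of
    [E], and each [g] is a local lift agreeing with it there. From here on only orders matter. *)
Lemma H0_representatives D E (m : int) : exceptional R Y E -> D E = m%:~R ->
  H0_restriction_neq0 Y D E ->
  exists sigma, [/\ sigma != 0, ord E sigma = m & forall C, Y C -> C `<=` E ->
    exists g, (forall E', prime_divisor Y E' -> C `<=` E' -> ord_ge E' (D E') g) /\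
      ord_ge E ((m + 1)%:~R : Q) (g - sigma)].
Proof.
move=> eE DE /(H0_generic_value eE)[s hs nsE].
have pE := exceptional_divisor eE; have dE := divisor_dvr M pE; have YE : Y E by case: pE.
have sE0 : s E != 0 by apply/eqP => s0; apply: nsE; rewrite s0; exact: ord_ge_zero.
have repr C : Y C -> C `<=` E -> exists g, (forall E', prime_divisor Y E' -> C `<=` E' -> ord_ge E' (D E') g) /\
      ord_ge E ((m + 1)%:~R : Q) (g - s E).
  move=> YC CE; have [u uC [g hg hsg]] := hs C YC CE; exists g; split.
    move=> E' pE' CE'; apply: hg => //; split; first by case: pE'.
    by apply: subset_trans CE'; case: uC.
  have uE : basic_open Y u E by split=> //; apply: subset_trans CE; case: uC.
  have := IE_OYopp_generic pE (hsg E uE (@subset_refl _ E)).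
  rewrite DE intrD => h; rewrite -opprB -sub0r; apply: ord_geB => //; exact: ord_ge_zero.
exists (s E); split=> //.
have [g [hg hgs]] := repr E YE (@subset_refl _ E).
have h1 : ord_ge E (m%:~R : Q) (s E).
  rewrite -(subKr g (s E)); apply: ord_geB => //; first by rewrite -DE; exact: hg.
  by apply: ord_geW hgs => //; rewrite ler_int; lia.
move: h1 nsE => /(ord_ge_ord dE m%:~R sE0) + h2; rewrite ler_int => h1.
apply/eqP; rewrite eq_le h1 andbT leNgt; apply/negP => h3; apply: h2.
by apply/ord_ge_ord => //; rewrite DE -[X in _ + X]/(1%:~R) -intrD ler_int; lia.
Qed.

End ModelDivisors.

(** * Negativity *)

Section Residue.
Variables (K : fieldType) (R : set K) (Y : set (set K)) (k0 : set K).
Implicit Types C B E p q : set K.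
Hypothesis M : germ_model k0 R Y.
Let rR : is_subring R := gm_subring M.

(** The image of the point [E] in [Spec R], as a prime ideal of [R]. *)
Definition center E := nonunits E `&` R.

Lemma center_prime E : Y E -> prime_ideal R (center E).
Proof.
move=> YE; have RE := point_sub M YE.
exact: (prime_contract rR RE (nonunits_prime (point_local M YE))).
Qed.

Lemma center_loc_sub E : Y E -> localization R (center E) `<=` E.
Proof.
move=> YE _ [x Rx [y [Ry ny] <-]]; have lE := point_local M YE.
have RE := point_sub M YE; apply: (subringM lE.1); first exact: RE.
by apply: nonunit_inv => //; [exact: RE|move=> h; apply: ny].
Qed.

Lemma center_loc_nonunits E : Y E ->
  nonunits (localization R (center E)) `<=` nonunits E.
Proof.
move=> YE; rewrite (loc_nonunits (center_prime YE)) => _ [x [nx Rx] [y [Ry ny] <-]].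
have lE := point_local M YE; have RE := point_sub M YE.
apply: (primeMr (nonunits_prime lE)) => //.
by apply: nonunit_inv => //; [exact: RE|move=> h; apply: ny].
Qed.

(* [u] restricts to a regular function on the closure of [E0], at least over the
   local ring of [R] at the center of [E0] *)
Definition regular_residue E0 u : Prop :=
  forall C, Y C -> C `<=` E0 -> center C = center E0 ->
    exists2 v, nonunits E0 (v - u) & forall E, prime_divisor Y E -> C `<=` E -> E v.

(* Otherwise a valuation ring inside [E0] containing [u^-1] as a nonunit is centered
   at a point [C] of [Y] by properness, and [u] has a pole there. *)
Lemma regular_residue_algebraic E0 u : dvr E0 -> Y E0 -> E0 u -> regular_residue E0 u ->
  exists G : {poly K}, [/\ coefs_in (localization R (center E0)) G,
    ~ nonunits (localization R (center E0)) (lead_coef G) & nonunits E0 G.[u]].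
Proof.
move=> dE YE Eu ru; have lE := point_local M YE; have rE := lE.1.
have valE y : E0 y \/ E0 y^-1.
  have [->|y0] := eqVneq y 0; first by left; exact: subring0.
  rewrite !(mem_dvr dE) (ordV dE y0); have [o|o] := lerP 0 (ord E0 y); first by left; right.
  by right; right; rewrite oppr_ge0 ltW.
have pm := nonunits_prime lE.
pose P := localization R (center E0).
have rP : is_subring P by apply: (loc_subring rR); exact: center_prime.
have lP : is_local P by apply: (loc_local rR); exact: center_prime.
have PE : P `<=` E0 := center_loc_sub YE.
have RP : R `<=` P by apply: loc_sub => //; exact: center_prime.
have nP1 : ~ nonunits P 1 by case: (nonunits_prime lP).
apply: contrapT => nalg.
have nu : ~ nonunits E0 u.
  move=> nu; apply: nalg; exists 'X; rewrite lead_coefX hornerX; split=> // i.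
  by rewrite coefX; exact: subring_nat.
have u0 : u != 0 by exact: (prime_neq0 pm nu).
have Eu' := nonunit_inv Eu nu.
have adjE : adjoin P u^-1 `<=` E0 by exact: adjoin_sub.
have rA := adjoin_subring u^-1 rP.
have [[m0 mD mM] mE] := lE.2.
(* [A] is the preimage in [E0] of the subring of the residue field generated by [P] and the inverse
   of [u]; [I] is the preimage of the ideal generated by that inverse. *)
pose A := [set x | exists g mu, [/\ adjoin P u^-1 g, nonunits E0 mu & x = g + mu]].
pose I := [set x | exists g mu, [/\ adjoin P u^-1 g, nonunits E0 mu & x = u^-1 * g + mu]].
have uA : adjoin P u^-1 u^-1 by exact: adjoin_mem.
have rA' : is_subring A.
  apply/subringP; split.
  - by exists 1, 0; rewrite addr0; split=> //; exact: subring1.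
  - move=> _ _ [g [mu [hg hmu ->]]] [g' [mu' [hg' hmu' ->]]]; exists (g - g'), (mu - mu').
    split; [exact: subringB| |by ring].
    by apply: (submoduleB rE (M := nonunits E0)).
  - move=> _ _ [g [mu [hg hmu ->]]] [g' [mu' [hg' hmu' ->]]].
    exists (g * g'), (mu * (g' + mu') + g * mu'); split; [exact: subringM| |by ring].
    apply: (mD); last by apply: (mM) => //; exact: adjE.
    by rewrite mulrC; apply: (mM) => //; apply: subringD => //; [exact: adjE|exact: mE].
have idI : is_ideal A I.
  split; last first.
    move=> _ [g [mu [hg hmu ->]]]; exists (u^-1 * g), mu; split=> //; exact: subringM.
  split.
  - by exists 0, 0; rewrite mulr0 addr0; split=> //; exact: subring0.
  - move=> _ _ [g [mu [hg hmu ->]]] [g' [mu' [hg' hmu' ->]]]; exists (g + g'), (mu + mu').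
    by split; [exact: subringD|exact: mD|ring].
  - move=> _ _ [g [mu [hg hmu ->]]] [g' [mu' [hg' hmu' ->]]].
    exists (g * g'), (mu * (u^-1 * g' + mu') + g * mu'); split; [exact: subringM| |by ring].
    apply: (mD); last by apply: (mM) => //; exact: adjE.
    rewrite mulrC; apply: (mM) => //; apply: subringD => //; last exact: mE.
    by apply: subringM => //; exact: adjE.
(* If 1 were in [I], multiplying by [u ^+ n] would make [u] a root, modulo the maximal ideal of
   [E0], of a monic polynomial over [P]; [H] carries the coefficients of [g] in reverse order. *)
have I1 : ~ I 1.
  move=> [_ [mu [[g Pg <-] hmu e]]]; apply: nalg.
  pose n := size g.
  pose H := \poly_(i < n) g`_(n.-1 - i).
  have lG : lead_coef ('X^n - H) = 1.
    rewrite lead_coefDl ?lead_coefXn // size_polyN size_polyXn ltnS.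
    exact: size_poly.
  exists ('X^n - H); rewrite lG; split=> //.
    move=> i; rewrite coefB coefXn coef_poly; apply: subringB => //; first exact: subring_nat.
    by case: ifP => _; [exact: Pg|exact: subring0].
  suff -> : ('X^n - H).[u] = u ^+ n * mu by apply: mM => //; exact: subringX.
  rewrite hornerD hornerN hornerXn horner_poly.
  have -> : mu = 1 - u^-1 * g.[u^-1] by rewrite e addrAC subrr add0r.
  rewrite mulrBr mulr1; congr (_ - _); rewrite horner_coef mulr_sumr mulr_sumr.
  rewrite (reindex_inj rev_ord_inj) /=; apply: eq_bigr => i _.
  have i_n : (i < n)%N by exact: ltn_ord.
  have -> : (n.-1 - (n - i.+1))%N = i by lia.
  have -> : u ^+ (n - i.+1) = u ^+ n * u^-1 ^+ i.+1; last by rewrite exprS; ring.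
  by apply: (mulIf (expf_neq0 i.+1 u0)); rewrite -exprD subnK // exprVn divfK ?expf_neq0.
have [V [vV AV IV]] := valuation_extension rA' idI I1.
have lV := valuation_local vV; have rV := lV.1.
have PA : P `<=` A.
  move=> x Px; exists x, 0; rewrite addr0; split=> //.
  by apply: adjoin_base => //; exact: subring0.
have mI x : nonunits E0 x -> I x.
  by move=> nx; exists 0, x; rewrite mulr0 add0r; split=> //; exact: subring0.
have RV : R `<=` V by apply: subset_trans AV; exact: subset_trans PA.
have [C [[YC [CV mCV]] _]] := (gm_proper M).2 V vV RV.
have nuV x y : nonunits V x -> V y -> x * y = 1 -> False.
  by move=> [_ h] Vy xy; apply: h; exists y.
(* The nonunits of [E0] belong to [I], hence are nonunits of [V]; an element outside [E0] is the
   inverse of one of them. *)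
have VE : V `<=` E0.
  move=> y Vy; apply: contrapT => nEy; have y0 : y != 0.
    by apply/eqP => y0; apply: nEy; rewrite y0; exact: subring0.
  have ny' : nonunits E0 y^-1.
    by case: (valE y) => // Ey'; apply/(nonunitP lE); split=> //; right; rewrite invrK.
  exact: (nuV _ _ (IV _ (mI _ ny')) Vy (mulVf y0)).
have CE : C `<=` E0 by exact: subset_trans VE.
have RC := point_sub M YC; have lC := point_local M YC.
have cC : center C = center E0.
  apply/seteqP; split=> r [nr Rr]; split=> //.
    apply: contrapT => nEr; have nr' : P r^-1 by apply: loc_inv => // -[].
    have r0 : r != 0 by apply/eqP => r0; apply: nEr; rewrite r0.
    exact: (nuV _ _ (mCV _ nr) (AV _ (PA _ nr')) (divff r0)).
  apply: contrapT => nCr; have Cr' := nonunit_inv (RC _ Rr) nCr.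
  have r0 : r != 0.
    by apply/eqP => r0; apply: nCr; rewrite r0; exact: (prime0 (nonunits_prime lC)).
  exact: (nuV _ _ (IV _ (mI _ nr)) (CV _ Cr') (divff r0)).
have [v nvu hv] := ru C YC CE cC.
have Cv : C v := hartogs M YC hv.
have Vu : V u.
  rewrite -(subKr v u); apply: (subringB rV); first exact: CV.
  by case: (IV _ (mI _ nvu)).
have Iu : I u^-1 by exists 1, 0; rewrite mulr1 addr0; split=> //; exact: subring1.
exact: (nuV _ _ (IV _ Iu) Vu (mulVf u0)).
Qed.

(* A regular function on the closure of [E0] is algebraic over the residue field
   of the center, hence nowhere vanishing unless zero. *)
Lemma regular_residue_unit E0 u C v : dvr E0 -> Y E0 -> E0 u -> ~ nonunits E0 u -> regular_residue E0 u ->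
  Y C -> C `<=` E0 -> center C = center E0 -> C v -> nonunits E0 (v - u) -> C v^-1.
Proof.
move=> dE YE Eu nu ru YC CE cC Cv nvu; have lE := point_local M YE; have rE := lE.1.
have lC := point_local M YC; have rC := lC.1.
have pm := nonunits_prime lE.
set P := localization R (center E0).
have lP : is_local P by apply: (loc_local rR); exact: center_prime.
have rP := lP.1.
have PE : P `<=` E0 := center_loc_sub YE.
have PC : P `<=` C by rewrite /P -cC; exact: center_loc_sub.
have nPE : nonunits P `<=` nonunits E0 := center_loc_nonunits YE.
have ex : exists n, `[< exists G : {poly K},
    [/\ coefs_in P G, ~ nonunits P (lead_coef G) & nonunits E0 G.[u]] /\ size G = n >].
  have [G hG] := regular_residue_algebraic dE YE Eu ru.
  by exists (size G); apply/asboolP; exists G.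
have [n /asboolP[G [[PG lG nG] sG]] minG] := ex_minnP ex.
have mD x y : nonunits E0 x -> nonunits E0 y -> nonunits E0 (x + y) := primeD pm.
have [G1 [c GE]] : exists G1 c, G = G1 * 'X + c%:P.
  by elim/poly_ind: {PG lG nG sG minG} G => [|p c _]; [exists 0, 0|exists p, c];
     rewrite ?mul0r ?addr0 ?polyC0.
have Pc : P c by have := PG 0%N; rewrite GE coefD coefMX coefC add0r.
have PG1 : coefs_in P G1.
  by move=> i; have := PG i.+1; rewrite GE coefD coefMX coefC addr0.
(* If the constant term were a nonunit, dividing by [u], a unit of [E0], would give a relation of
   smaller degree. *)
have nc : ~ nonunits P c.
  move=> nc; have nG1 : nonunits E0 G1.[u].
    have h : nonunits E0 (G1.[u] * u).
      rewrite -[_ * u](addrK c); apply: (submoduleB rE lE.2.1); last exact: nPE.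
      by rewrite -hornerMXaddC -GE.
    rewrite -[G1.[u]](mulfK (prime_neq0 pm nu)); apply: (primeMr pm) => //.
    exact: nonunit_inv.
  have G10 : G1 != 0.
    by apply/eqP => G10; apply: lG; rewrite GE G10 mul0r add0r lead_coefC.
  have sGE : size G = (size G1).+1.
    by rewrite GE size_MXaddC (negbTE G10).
  have : (n <= size G1)%N.
    apply: minG; apply/asboolP; exists G1; split=> //; split=> //.
    move=> lG1; apply: lG; rewrite GE lead_coefDl ?lead_coefMX //.
    by rewrite size_mulX // (leq_ltn_trans (size_polyC_leq1 _)) // ltnS size_poly_gt0.
  by rewrite -sG sGE ltnn.
have polyE (H : {poly K}) : coefs_in P H -> nonunits E0 (H.[v] - H.[u]).
  elim/poly_ind: H => [|H d IH] PH; first by rewrite !horner0 subrr; exact: (prime0 pm).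
  have PH' : coefs_in P H.
    by move=> i; have := PH i.+1; rewrite coefD coefMX coefC addr0.
  have hE w : E0 w -> E0 H.[w].
    move=> Ew; rewrite horner_coef; apply: (subring_sum rE) => i _; apply: subringM => //.
      exact/PE/PH'.
    exact: subringX.
  rewrite !hornerMXaddC (_ : _ - _ = (H.[v] - H.[u]) * v + H.[u] * (v - u)); last by ring.
  apply: mD; first by apply: (primeMr pm); [exact: CE|exact: IH].
  by apply: (primeMl pm) => //; exact: hE.
have nGv : nonunits E0 G.[v] by rewrite -(subrK G.[u] G.[v]); apply: mD => //; exact: polyE.
apply: nonunit_inv => // nv.
have pmC := nonunits_prime lC.
have CG1v : C G1.[v].
  rewrite horner_coef; apply: (subring_sum rC) => i _; apply: subringM => //.
    exact/PC/PG1.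
  exact: subringX.
have CGv : C G.[v].
  by rewrite GE hornerMXaddC; apply: subringD => //; [exact: subringM|exact: PC].
(* If [v] vanished at [C], so would the constant term [c = G.[v] - G1.[v] * v], which is a unit of
   [P] and hence of [C]. *)
have nCGv : nonunits C G.[v].
  split=> // -[w Cw e]; case: nGv => _; apply; exists w => //; exact: CE.
have : nonunits C c.
  have -> : c = G.[v] - G1.[v] * v by rewrite GE hornerMXaddC addrAC subrr add0r.
  apply: (submoduleB rC lC.2.1) => //; exact: (primeMl pmC).
move=> [_]; apply; exists c^-1; first exact: (PC _ (nonunit_inv Pc nc)).
by rewrite divff // (prime_neq0 (nonunits_prime lP)).
Qed.

(** The center of an exceptional divisor has codimension at least two. In dimension zero [P] would
    be all of [K]; in dimension one it would be a discrete valuation ring inside [E], hence equal to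
    [E], and [E] would be a point of [Spec R]. *)
Lemma exceptional_center_chain E : exceptional R Y E ->
  prime_chain (localization R (center E)) 2.
Proof.
move=> [pE [YE nRE]]; have dE := divisor_dvr M pE; have pp := center_prime YE.
set P := localization R (center E).
have PE : P `<=` E := center_loc_sub YE.
have [lP nP [x rp]] := gm_regular M pp; have [dx mx] := rp.
have fP : frac_field P by apply: (frac_sub M); exact: loc_sub.
have PnE : P <> E by move=> h; apply: nRE; exists (center E).
have [z nEz] := dvr_neqT dE.
have PnT : ~ P z by move=> /PE.
case: x rp dx mx => [|t [|t' x]] rp dx mx.
- have [a [b [Pa Pb b0 zab]]] := fP z.
  exfalso; apply: PnT; rewrite zab; apply: (subringM lP.1) => //; apply: nonunit_inv => //.
  by rewrite mx span_nil => /eqP; rewrite (negbTE b0).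
- exfalso; apply: PnE; symmetry.
  apply: dvr_maximal => //; [exact: regular_dim1_dvr (gm_regular M pp) fP dx|by case: dE => -[]|].
  by exists z.
- by apply: prime_chainW (proj1 dx).
Qed.

Lemma exceptional_transcendental E : exceptional R Y E ->
  exists u, E u /\ forall G : {poly K}, coefs_in (localization R (center E)) G ->
    ~ nonunits (localization R (center E)) (lead_coef G) -> ~ nonunits E G.[u].
Proof.
move=> eE; have [pE [YE _]] := eE; have pp := center_prime YE.
apply: (dvr_residue_transcendental (gm_subfield M) (gm_char0 M) (gm_fin_gen M)).
- exact: (divisor_dvr M pE).
- exact: (point_fin_diff M YE).
- exact: (loc_local rR pp).
- by apply: subset_trans (gm_sub M) _; exact: loc_sub.
- exact: center_loc_sub.
- exact: center_loc_nonunits.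
- exact: exceptional_center_chain.
Qed.

End Residue.

(** * Indices minimizing a ratio, and their stability *)

Section RatioMinimizers.
Variables (n : nat) (w : 'I_n -> nat).
Hypothesis w_gt0 : forall i, (0 < w i)%N.
Implicit Types o : 'I_n -> nat.

(** The indices where [o i / w i] is smallest, with denominators cleared. In the application [w]
    holds the multiplicities of the negative part and [o] the orders of a function. *)
Definition ratio_min o := [set i | [forall j, (o i * w j <= o j * w i)%N]]%SET.

Lemma ratio_minP o i : reflect (forall j, (o i * w j <= o j * w i)%N) (i \in ratio_min o).
Proof. by rewrite inE; apply: forallP. Qed.

Lemma ratio_min_ex o (i0 : 'I_n) : exists i, i \in ratio_min o.
Proof.
pose F i : rat := (o i)%:R / (w i)%:R.
case: (@Order.TotalTheory.arg_minP _ _ _ i0 xpredT F isT) => i _ hi.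
exists i; apply/ratio_minP => j; have := hi j isT; rewrite /F.
rewrite ler_pdivrMr ?ltr0n // mulrAC ler_pdivlMr ?ltr0n //.
by rewrite -!natrM ler_nat.
Qed.

Lemma ratio_min_perturb o o1 : exists k0, forall k, (k0 <= k)%N ->
  ratio_min (fun i => k * o i + o1 i)%N \subset ratio_min o.
Proof.
(* A strict inequality between natural numbers has gap at least one, which [k] multiplies; the sum
   bounds every error term coming from [o1]. *)
exists (\sum_i \sum_j o1 j * w i).+1 => k hk; apply/fintype.subsetP => i /ratio_minP h.
apply/ratio_minP => j; rewrite leqNgt; apply/negP => hij.
have hs : (o1 j * w i <= \sum_i \sum_j o1 j * w i)%N.
  by rewrite (bigD1 i) //= (bigD1 j) //= -addnA leq_addr.
have := h j; rewrite !mulnDl -!mulnA => h1.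
have h2 : (k * (o j * w i) + k <= k * (o i * w j))%N by rewrite -mulnSr leq_mul2l hij orbT.
lia.
Qed.

End RatioMinimizers.

Section Negativity.
Variables (K : fieldType) (R : set K) (Y : set (set K)) (k0 : set K).
Implicit Types C B E p q : set K.
Hypothesis M : germ_model k0 R Y.
Hypothesis exc_principal : forall E C, exceptional R Y E -> Y C -> C `<=` E ->
  exists t, ideal_stalk E C = span C [set t].
Variables (Q : archiRealDomainType) (D : set K -> Q).
Hypotheses (divD : is_divisor Y D) (intD : integral D).
Hypothesis nonexc_ge0 : forall E, prime_divisor Y E -> ~ exceptional R Y E -> 0 <= D E.
Hypothesis exc_H0 : forall E, exceptional R Y E -> H0_restriction_neq0 Y D E.

Let d E : int := Num.floor (D E).
Let Dd E : D E = (d E)%:~R.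
Proof. by apply/esym/eqP; rewrite /d -intrEfloor; exact: intD. Qed.
(** The multiplicity of [E] in the negative part of [D]. *)
Let nn E : int := if d E < 0 then - d E else 0.
Let nn_ge E : - nn E <= d E.
Proof. by rewrite /nn; case: ltrP => h; rewrite ?opprK ?oppr0. Qed.

Let neg_exceptional E : D E < 0 -> exceptional R Y E.
Proof.
move=> DE; apply: contrapT => nE; have := nonexc_ge0 _ nE; rewrite leNgt DE => h.
by suff : false by []; apply: h; apply: divD.2; rewrite lt_eqF.
Qed.

Let ord_R_ge0 E f : prime_divisor Y E -> R f -> f != 0 -> 0 <= ord E f.
Proof.
move=> pE Rf f0; have dE := divisor_dvr M pE; apply: (ord_ge0 dE) => //.
by apply: (point_sub M) Rf; case: pE.
Qed.

Lemma center_specialization C E : Y C -> Y E -> C `<=` E -> center R E `<=` center R C.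
Proof.
move=> YC YE CE r [nEr Rr]; split=> //; have lC := point_local M YC.
have RC := point_sub M YC; apply: contrapT => nCr; have Cr := nonunit_inv (RC _ Rr) nCr.
have r0 : r != 0.
  by apply/eqP => r0; apply: nCr; rewrite r0; exact: (prime0 (nonunits_prime lC)).
by case: nEr => _; apply; exists r^-1; [exact: CE|rewrite divff].
Qed.

(* With [sig] a section of [O_Y(-D)|_E0], the product [sig ^ b * f ^ a] is a regular
   function on the closure of [E0], hence a unit at all its points. *)
Lemma proportional_near E0 f (a b : nat) : exceptional R Y E0 -> R f -> f != 0 ->
  (0 < a)%N -> (0 < b)%N -> d E0 = - a%:Z -> ord E0 f = b%:Z ->
  (forall C E, Y C -> C `<=` E0 -> center R C = center R E0 -> prime_divisor Y E -> C `<=` E ->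
     nn E * b%:Z <= ord E f * a%:Z) ->
  forall C E, Y C -> C `<=` E0 -> center R C = center R E0 -> prime_divisor Y E -> C `<=` E ->
    ord E f * a%:Z = nn E * b%:Z.
Proof.
move=> eE0 Rf f0 a0 b0 dE0a oE0b ineq.
have pE0 := exceptional_divisor eE0; have dE0 := divisor_dvr M pE0; have YE0 : Y E0 by case: pE0.
have lE0 := point_local M YE0; have rE0 := lE0.1; have pm := nonunits_prime lE0.
have [sig [sig0 osig hsig]] := H0_representatives M exc_principal eE0 (Dd E0) (exc_H0 eE0).
(* The exponents are chosen so that the orders [- a] of [sig] and [b] of [f] along [E0] cancel. *)
pose u := sig ^+ b * f ^+ a.
have u0 : u != 0 by rewrite mulf_neq0 ?expf_neq0.
have ou : ord E0 u = 0.
  by rewrite /u ordM ?expf_neq0 // !ordX // osig oE0b dE0a; lia.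
have [Eu nu] := ord_eq0 dE0 u0 ou.
have congr_u g : ord_ge E0 ((d E0 + 1)%:~R : Q) (g - sig) -> nonunits E0 (g ^+ b * f ^+ a - u).
  move=> hg; pose x := g / sig.
  have nx : nonunits E0 (x - 1).
    have -> : x - 1 = (g - sig) / sig by rewrite /x mulrBl divff.
    apply/(ord_ge_nonunit Q dE0).
    rewrite (_ : 1 = (d E0 + 1)%:~R + (- d E0)%:~R); last first.
      by rewrite -intrD (_ : d E0 + 1 + - d E0 = 1) //; ring.
    apply: (ord_geM dE0) => //; apply/ord_ge_ord => //; first by rewrite invr_eq0.
    by rewrite ordV // osig.
  have Ex : E0 x by rewrite -(subrK 1 x); apply: (subringD rE0); [case: nx|exact: subring1].
  have -> : g ^+ b * f ^+ a - u = (x ^+ b - 1) * u.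
    rewrite mulrBl mul1r; congr (_ - _); rewrite /u /x expr_div_n mulrA divfK //.
    by rewrite expf_neq0.
  apply: (primeMr pm) => //; rewrite subrX1; apply: (primeMr pm) => //.
  by apply: (subring_sum rE0) => i _; exact: subringX.
have mem_v C E g : Y C -> C `<=` E0 -> center R C = center R E0 -> prime_divisor Y E -> C `<=` E ->
    ord_ge E (D E) g -> g != 0 ->
    0 <= ord E (g ^+ b * f ^+ a) /\ - nn E <= ord E g.
  move=> YC CE0 cC pE CE hg g0; have dE := divisor_dvr M pE.
  have og : d E <= ord E g by move: hg; rewrite Dd => /(ord_ge_ord dE) => /(_ g0); rewrite ler_int.
  have ogn : - nn E <= ord E g := le_trans (nn_ge E) og.
  split=> //; have := ineq C E YC CE0 cC pE CE.
  rewrite ordM ?expf_neq0 // !ordX //; nia.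
have ru : regular_residue R Y E0 u.
  move=> C YC CE0 cC; have [g [hg hgs]] := hsig C YC CE0.
  exists (g ^+ b * f ^+ a); first exact: congr_u.
  move=> E pE CE; have dE := divisor_dvr M pE; apply/(mem_dvr dE).
  have [g0|g0] := eqVneq g 0; first by left; rewrite g0 expr0n gtn_eqF // mul0r.
  by right; have [] := mem_v C E g YC CE0 cC pE CE (hg E pE CE) g0.
move=> C E YC CE0 cC pE CE; have dE := divisor_dvr M pE.
have [g [hg hgs]] := hsig C YC CE0.
pose v := g ^+ b * f ^+ a.
have nvu := congr_u g hgs.
have g0 : g != 0.
  apply/eqP => g0; apply: nu.
  have v0 : v = 0 by rewrite /v g0 expr0n gtn_eqF // mul0r.
  by rewrite -[u](subKr v); rewrite {1}v0 sub0r; exact: (submoduleN rE0 lE0.2.1).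
have Cv : C v.
  apply: (hartogs M) => // E' pE' CE'; apply/(mem_dvr (divisor_dvr M pE')); right.
  by have [] := mem_v C E' g YC CE0 cC pE' CE' (hg E' pE' CE') g0.
have Cv' := regular_residue_unit M dE0 YE0 Eu nu ru YC CE0 cC Cv nvu.
have v0 : v != 0 by rewrite mulf_neq0 ?expf_neq0.
(* This order is the sum of [b * (ord E g + nn E)] and [a * ord E f - b * nn E], both nonnegative;
   hence both vanish. *)
have ov : ord E v = 0 by apply: (ord_unit dE) => //; exact: CE.
have [_ ogn] := mem_v C E g YC CE0 cC pE CE (hg E pE CE) g0.
have h1 := ineq C E YC CE0 cC pE CE.
move: ov; rewrite /v ordM ?expf_neq0 // !ordX // => ov.
by apply/eqP; rewrite eq_le h1 andbT; nia.
Qed.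

(* Among the [f] vanishing at a minimal center, one with the fewest ratio minimizers
   keeps its minimizer [e i] when [f ^ k] is multiplied by any element of [R]. So the
   divisor of every function is proportional to [D] near [e i], and every unit along
   [e i] has algebraic residue. *)
Theorem antieffective_effective : effective D.
Proof.
move=> Estar; rewrite leNgt; apply/negP => Dstar.
have fS : finite_set [set E | D E < 0].
  by apply: sub_finite_set divD.1 => E /= DE; rewrite lt_eqF.
have [E1 [DE1 minE1]] : exists E1, D E1 < 0 /\ forall E, D E < 0 ->
    center R E `<=` center R E1 -> center R E = center R E1.
  have [n [f Sf]] := finite_set_enum fS; have [i0 _] := (Sf Estar).1 Dstar.
  (* A strictly smaller center would have strictly fewer components below it, so a least cardinality
     gives a minimal center. *)
  pose below i := [set j | `[< center R (f j) `<=` center R (f i) >]]%SET.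
  have [i _ mini] := arg_minnP (fun i => #|below i|) (isT : xpredT i0).
  exists (f i); split; first by apply/(Sf (f i)).2; exists i.
  move=> E /(Sf E).1[j <-] ji; apply/seteqP; split=> //.
  have sub : below j \subset below i.
    apply/fintype.subsetP => l; rewrite !finset.in_set => /asboolP lj; apply/asboolP => r /lj.
    exact: ji.
  have : i \in below j.
    have /eqP -> : below j == below i by rewrite eqEcard sub mini.
    by rewrite finset.in_set; apply/asboolP.
  by rewrite finset.in_set => /asboolP.
set p := center R E1 in minE1.
have [n [e Se]] : exists n (e : 'I_n -> set K), forall E, (D E < 0 /\ center R E = p) <-> exists i, e i = E.
  by apply: (@finite_set_enum _ [set E | D E < 0 /\ center R E = p]); apply: sub_finite_set fS => E [].
have De i : D (e i) < 0 by have [] := (Se (e i)).2 (ex_intro _ i erefl).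
have ce i : center R (e i) = p by have [] := (Se (e i)).2 (ex_intro _ i erefl).
have ee i : exceptional R Y (e i) by exact: neg_exceptional.
have pe i : prime_divisor Y (e i) := exceptional_divisor (ee i).
have dvre i : dvr (e i) := divisor_dvr M (pe i).
have [i0 _] : exists i, e i = E1 by apply/Se.
pose w i := `|d (e i)|%N.
have dw i : d (e i) = - (w i)%:Z.
  by have := De i; rewrite Dd ltrz0 /w; lia.
have w0 i : (0 < w i)%N by have := De i; rewrite Dd ltrz0 /w; lia.
pose o f i := `|ord (e i) f|%N.
have oE f i : R f -> f != 0 -> (o f i)%:Z = ord (e i) f.
  by move=> Rf f0; rewrite /o gez0_abs // ord_R_ge0.
have p_sub f : p f -> R f by case.
have o_gt0 f i : p f -> f != 0 -> (0 < o f i)%N.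
  move=> pf f0; rewrite -ltz_nat oE //; last exact: p_sub.
  by apply/(ord_gt0 (dvre i) f0); move: pf; rewrite -(ce i) => -[].
have KP f i : p f -> f != 0 -> i \in ratio_min w (o f) ->
    forall C E, Y C -> C `<=` e i -> center R C = p -> prime_divisor Y E -> C `<=` E ->
    ord E f * (w i)%:Z = nn E * (o f i)%:Z.
  move=> pf f0 /ratio_minP hi C E YC Ci cC.
  apply: (proportional_near (ee i) (p_sub f pf) f0 (w0 i) (o_gt0 f i pf f0) (dw i)) => //.
  - by rewrite oE //; exact: p_sub.
  - move=> C' E' YC' C'i cC' pE' C'E'; rewrite {1}/nn; case: ltrP => dE'; last first.
      by rewrite mul0r mulr_ge0 // ord_R_ge0 //; exact: p_sub.
    have DE' : D E' < 0 by rewrite Dd ltrz0.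
    have YE' : Y E' by case: pE'.
    (* [E'] passes through a point lying over [p], so its center is contained in [p], and minimality
       gives equality. Thus [E'] is one of the [e j], where the ratio of [e i] is known to be
       extremal. *)
    have cE' : center R E' = p.
      by apply: minE1 => //; rewrite -/p -(ce i) -cC'; exact: center_specialization.
    have [j ej] : exists j, e j = E' by apply/Se.
    have oj := oE f j (p_sub f pf) f0.
    by rewrite -ej dw opprK -oj -!PoszM lez_nat [X in (X <= _)%N]mulnC; exact: hi.
  - by rewrite cC ce.
have [f0 [pf0 f00]] : exists f0, p f0 /\ f0 != 0.
  have pE1 := exceptional_divisor (neg_exceptional DE1); have dE1 := divisor_dvr M pE1.
  have [_ _ _ [t ut]] := dE1; have [a [b [Ra Rb b0 tab]]] := gm_frac M t.
  have a0 : a != 0 by apply: contraNneq ut.1 => a0; rewrite tab a0 mul0r.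
  exists a; split=> //; split=> //; apply/(ord_gt0 dE1 a0).
  have := ord_uniformizer dE1 ut; rewrite tab ord_div //.
  by have := ord_R_ge0 pE1 Rb b0; lia.
have ex : exists m, `[< exists f, [/\ p f, f != 0 & #|ratio_min w (o f)| = m] >].
  by exists #|ratio_min w (o f0)|; apply/asboolP; exists f0.
have [m /asboolP[f [pf fn0 fm]] minm] := ex_minnP ex.
have [i hi] := ratio_min_ex w0 (o f) i0.
have YE0 : Y (e i) by case: (pe i).
have [u [Eu tru]] := exceptional_transcendental M (ee i).
have lP : is_local (localization R (center R (e i))).
  by apply: loc_local; [exact: gm_subring M|exact: (center_prime M)].
have nu : ~ nonunits (e i) u.
  move=> nu; apply: (tru 'X); rewrite ?hornerX //.
    by move=> l; rewrite coefX; apply: subring_nat; case: lP.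
  by rewrite lead_coefX; case: (nonunits_prime lP).
have u0 : u != 0 by exact: (prime_neq0 (nonunits_prime (point_local M YE0)) nu).
have ou : ord (e i) u = 0.
  apply: (ord_unit (dvre i)) => //; exact: nonunit_inv.
have [f1 [f2 [Rf1 Rf2 f2n0 uf]]] := gm_frac M u.
have f1n0 : f1 != 0 by apply: contraNneq u0 => a0; rewrite uf a0 mul0r.
(* The exponent [k.+1] keeps the product in [p] whatever [k] is. The minimizers of the product are
   among those of [f], and not fewer by the choice of [f]. *)
have stable h : R h -> h != 0 -> exists k0, forall k, (k0 <= k)%N ->
    i \in ratio_min w (o (f ^+ k.+1 * h)).
  move=> Rh h0; have [k1 hk1] := ratio_min_perturb w (o f) (o h).
  exists k1 => k kk0; have fk0 : f ^+ k.+1 != 0 by rewrite expf_neq0.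
  have rR := gm_subring M; have Rf := p_sub f pf.
  have oo : o (f ^+ k.+1 * h) = fun j => (k.+1 * o f j + o h j)%N.
    apply/funext => j; apply/eqP; rewrite -eqz_nat PoszD PoszM !oE //.
    - by rewrite ordM // ordX //; apply/eqP; ring.
    - by apply: (subringM rR) => //; exact: subringX.
    - by rewrite mulf_neq0.
  have sub : ratio_min w (o (f ^+ k.+1 * h)) \subset ratio_min w (o f).
    by rewrite oo; apply: hk1; exact: leqW.
  have pF : p (f ^+ k.+1 * h).
    have pp := center_prime M (proj1 (exceptional_divisor (neg_exceptional DE1))).
    apply: (primeMr pp) => //; rewrite exprSr; apply: (primeMl pp) => //; exact: subringX.
  have /eqP -> : ratio_min w (o (f ^+ k.+1 * h)) == ratio_min w (o f).
    rewrite eqEcard sub fm; apply: minm; apply/asboolP.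
    by exists (f ^+ k.+1 * h); split=> //; rewrite mulf_neq0.
  exact: hi.
have [k1 hk1] := stable f1 Rf1 f1n0; have [k2 hk2] := stable f2 Rf2 f2n0.
pose k := (k1 + k2)%N.
have t1 := hk1 k (leq_addr _ _); have t2 := hk2 k (leq_addl _ _).
have pF h : R h -> p (f ^+ k.+1 * h).
  have pp := center_prime M (proj1 (exceptional_divisor (neg_exceptional DE1))).
  move=> Rh; apply: (primeMr pp) => //; rewrite exprSr; apply: (primeMl pp) => //.
  by have rR := gm_subring M; apply: subringX => //; exact: p_sub.
have fk0 : f ^+ k.+1 != 0 by rewrite expf_neq0.
(* Both [f ^+ k.+1 * f1] and [f ^+ k.+1 * f2] have orders proportional to the negative part, with
   the same factor as [u] has order zero along [e i]. So [u = f1 / f2] has order zero along every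
   divisor through these points and is its own lift. *)
have ru : regular_residue R Y (e i) u.
  move=> C YC Ci cC; exists u.
    by rewrite subrr; exact: (prime0 (nonunits_prime (point_local M YE0))).
  move=> E pE CE; have dE := divisor_dvr M pE; apply/(mem_dvr dE); right.
  have cCp : center R C = p by rewrite cC ce.
  have e1 := KP _ _ (pF _ Rf1) (mulf_neq0 fk0 f1n0) t1 C E YC Ci cCp pE CE.
  have e2 := KP _ _ (pF _ Rf2) (mulf_neq0 fk0 f2n0) t2 C E YC Ci cCp pE CE.
  have oFE : o (f ^+ k.+1 * f1) i = o (f ^+ k.+1 * f2) i.
    apply/eqP; rewrite -eqz_nat !oE ?mulf_neq0 //; try by apply: p_sub; exact: pF.
    rewrite !(ordM (dvre i)) //; move: ou; rewrite uf (ord_div (dvre i)) // => /eqP.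
    by rewrite subr_eq0 => /eqP->.
  move: e1; rewrite oFE -e2 !(ordM dE) // => /eqP.
  rewrite (inj_eq (mulIf _)); last by have := w0 i; rewrite -lt0n.
  rewrite (inj_eq (addrI _)) => /eqP e12.
  by rewrite uf (ord_div dE) // e12 subrr.
have [G [PG lG nG]] := regular_residue_algebraic M (dvre i) YE0 Eu ru.
exact: (tru G).
Qed.

End Negativity.

(** * The antieffective envelope *)

Section Envelope.
Variables (K : fieldType) (R : set K) (Y : set (set K)) (k0 : set K).
Implicit Types C B E p q : set K.
Hypothesis M : germ_model k0 R Y.
Let rR : is_subring R := gm_subring M.

Lemma divisor_ord_ge0 E f : prime_divisor Y E -> R f -> f != 0 -> 0 <= ord E f.
Proof.
move=> pE Rf f0; apply: (ord_ge0 (divisor_dvr M pE)) => //.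
by apply: (point_sub M) Rf; case: pE.
Qed.

Lemma center_neq0 E : prime_divisor Y E -> exists r, [/\ R r, r != 0 & nonunits E r].
Proof.
move=> pE; have dE := divisor_dvr M pE; have [_ _ _ [t ut]] := dE.
have [a [b [Ra Rb b0 tab]]] := gm_frac M t.
have a0 : a != 0 by apply: contraNneq ut.1 => a0; rewrite tab a0 mul0r.
exists a; split=> //; apply/(ord_gt0 dE a0).
have := ord_uniformizer dE ut; rewrite tab ord_div //.
by have := divisor_ord_ge0 pE Rb b0; lia.
Qed.

Lemma nonexceptional_loc E : prime_divisor Y E -> ~ exceptional R Y E ->
  E = localization R (center R E).
Proof.
move=> pE nE; have YE : Y E by case: pE.
have [q pq Eq] : Spec R E by apply: contrapT => nS; apply: nE.
by rewrite /center -{2}Eq loc_nonunitsI.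
Qed.

(** Otherwise the center of [E'] would lie in that of [E]. As [E] is a localization of [R], it would
    then be contained in [E'], and no inclusion holds between distinct prime divisors. *)
Lemma center_avoid E E' : prime_divisor Y E -> ~ exceptional R Y E -> prime_divisor Y E' ->
  E' <> E -> exists r, [/\ R r, r != 0, ord E r = 0 & nonunits E' r].
Proof.
move=> pE nE pE' EE'; have YE : Y E by case: pE. have YE' : Y E' by case: pE'.
have [r [[nr Rr] nEr]] : exists r, center R E' r /\ ~ center R E r.
  apply: contrapT => nr; apply: EE'; symmetry; apply: (divisor_eq M pE' pE).
  rewrite (nonexceptional_loc pE nE).
  apply: subset_trans (center_loc_sub M YE') => _ [x Rx [y [Ry ny] <-]].
  exists x => //; exists y => //; split=> // h; apply: nr; exists y; split=> //.
have r0 : r != 0 by exact: (prime_neq0 (center_prime M YE) nEr).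
have Er : E r by exact: (point_sub M YE Rr).
exists r; split=> //; apply: (ord_unit (divisor_dvr M pE)) => //.
by apply: nonunit_inv => // h; apply: nEr.
Qed.

(** The multiplicative set [P] serves two purposes: it consists of all nonzero elements of [R], or
    of those having order zero along a fixed divisor. *)
Lemma high_order_element (P : set K) (S : set (set K)) (c : set K -> nat) :
  finite_set S -> (forall E, S E -> prime_divisor Y E) ->
  P 1 -> (forall x y, P x -> P y -> P (x * y)) -> (forall x, P x -> R x /\ x != 0) ->
  (forall E, S E -> exists2 r, P r & nonunits E r) ->
  exists2 g, P g & forall E, S E -> (c E)%:Z <= ord E g.
Proof.
move=> /finite_set_enum[n [e Se]] pS P1 PM PR hP.
have Si i : S (e i) by apply/Se; exists i.
have /choice[r hr] : forall i, exists r, P r /\ nonunits (e i) r.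
  by move=> i; have [r Pr nr] := hP _ (Si i); exists r.
have Pr i : P (r i ^+ c (e i)).
  by elim: (c (e i)) => [|m IH]; rewrite ?expr0 // exprS; apply: PM => //; case: (hr i).
exists (\prod_i r i ^+ c (e i)); first by apply: big_ind.
move=> E /Se[i <-]; rewrite (bigD1 i) //=.
have Prest : P (\prod_(j | j != i) r j ^+ c (e j)) by apply: big_ind.
have [Rr r0] := PR _ Prest; have [Ri ri0] := PR _ (hr i).1.
have pe := pS _ (Si i); have de := divisor_dvr M pe.
rewrite ordM ?expf_neq0 // ordX //.
have h1 := divisor_ord_ge0 pe Rr r0; have /(ord_gt0 de ri0) h2 := (hr i).2.
move: (ord (e i) _) (ord (e i) _) (c (e i)) h1 h2 => x y m; nia.
Qed.

Variables (Q : archiRealDomainType) (D : set K -> Q).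
Hypothesis divD : is_divisor Y D.

Let ceil_abs (c : Q) : c <= (`|Num.ceil c|%N%:Z)%:~R.
Proof. by apply: le_trans (Num.Theory.ceil_ge c) _; rewrite ler_int; lia. Qed.

Lemma pushforward_neq0 : exists2 f, f != 0 & pushforward Y D f.
Proof.
have [||||||f [Rf f0] hf] := @high_order_element [set x | R x /\ x != 0] [set E | D E != 0]
    (fun E => `|Num.ceil (D E)|%N).
- exact: divD.1.
- exact: divD.2.
- by split; [exact: subring1|rewrite oner_eq0].
- by move=> x y [Rx x0] [Ry y0]; split; [exact: subringM|rewrite mulf_neq0].
- by [].
- by move=> E /divD.2 /center_neq0[r [Rr r0 nr]]; exists r.
exists f => // E pE _; apply/(ord_ge_ord (divisor_dvr M pE)) => //.
have [->|DE] := eqVneq (D E) 0; first by rewrite ler0z; exact: divisor_ord_ge0.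
by apply: le_trans (ceil_abs _) _; rewrite ler_int; exact: hf.
Qed.

(** Otherwise [pi_* O_Y(-D)] contains a function [g / x] with a simple pole along [E], which is not
    in [R]: [x] has order one along [E], while [g] has order zero there and high order along the
    other divisors that matter. The bound is -1 because [D] may have fractional coefficients. *)
Lemma defines_ideal_nonexceptional E : defines_ideal R Y D -> prime_divisor Y E ->
  ~ exceptional R Y E -> -1 < D E.
Proof.
move=> [_ DR] pE nE; rewrite ltNge; apply/negP => DE1.
have dE := divisor_dvr M pE; have YE : Y E by case: pE.
have [_ _ _ [t ut]] := dE.
have [x [Rx x0 ox]] : exists x, [/\ R x, x != 0 & ord E x = 1].
  have := uniformizer_mem ut; rewrite [X in X t](nonexceptional_loc pE nE).
  move=> [x Rx [y [Ry ny] txy]]; have y0 := prime_neq0 (center_prime M YE) ny.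
  have x0 : x != 0 by apply: contraNneq ut.1 => x0; rewrite -txy x0 mul0r.
  exists x; split=> //; rewrite -(ord_uniformizer dE ut) -txy ord_div //.
  rewrite (_ : ord E y = 0) ?subr0 //; have RE := point_sub M YE.
  apply: (ord_unit dE) => //; first exact: RE.
  by apply: nonunit_inv; [exact: RE|move=> h; apply: ny].
pose S := [set E' | (D E' != 0 \/ prime_divisor Y E' /\ ord E' x != 0) /\ E' <> E].
have SS E' : S E' -> prime_divisor Y E' by move=> [[/divD.2|[]]].
have [||||||g [Rg g0 og] hg] := @high_order_element [set r | [/\ R r, r != 0 & ord E r = 0]] S
    (fun E' => `|Num.ceil (D E')| + `|ord E' x|)%N.
- apply: sub_finite_set (_ : finite_set ([set E' | D E' != 0] `|`
    [set E' | prime_divisor Y E' /\ ord E' x != 0])); first by move=> E' [].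
  by rewrite finite_setU; split; [exact: divD.1|exact: (finite_ord_neq0 M)].
- exact: SS.
- by split; [exact: subring1|rewrite oner_eq0|exact: ord1].
- move=> r s [Rr r0 ur] [Rs s0 us]; split; [exact: subringM|by rewrite mulf_neq0|].
  by rewrite ordM // ur us.
- by move=> r [].
- move=> E' SE'; have [r [Rr r0 ur nr]] := center_avoid pE nE (SS _ SE') SE'.2.
  by exists r.
have gx0 : g / x != 0 by rewrite mulf_neq0 ?invr_eq0.
have ogx : ord E (g / x) = -1 by rewrite ord_div // og ox sub0r.
have : R (g / x).
  apply: DR => E' pE' _; have dE' := divisor_dvr M pE'; apply/(ord_ge_ord dE') => //.
  have [->|EE'] := pselect (E' = E); first by rewrite ogx mulrN1z.
  rewrite ord_div //; have [SE'|nSE'] := pselect (S E').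
    by apply: le_trans (ceil_abs _) _; rewrite ler_int; have := hg _ SE'; lia.
  have D0 : D E' = 0.
    by apply/eqP; apply: contrapT => /negP h; apply: nSE'; split=> //; left.
  have o0 : ord E' x = 0.
    by apply/eqP; apply: contrapT => /negP h; apply: nSE'; split=> //; right.
  by rewrite D0 o0 subr0 ler0z; exact: divisor_ord_ge0.
by move=> /(divisor_ord_ge0 pE) /(_ gx0); rewrite ogx.
Qed.

Definition principal_bound (f : K) (E : set K) : Q :=
  if `[< exceptional R Y E >] then (ord E f)%:~R else (Num.ceil (D E))%:~R.

Section PrincipalBound.
Variable f : K.
Hypotheses (f0 : f != 0) (hf : pushforward Y D f).

Lemma principal_bound_ge : div_le D (principal_bound f).
Proof.
move=> E; rewrite /principal_bound; case: asboolP => [[pE _]|_]; last exact: Num.Theory.ceil_ge.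
apply/(ord_ge_ord (divisor_dvr M pE)) => //; apply: hf => //; by case: pE.
Qed.

Lemma pushforward_principal_bound : pushforward Y (principal_bound f) f.
Proof.
move=> E pE YE; have dE := divisor_dvr M pE; apply/(ord_ge_ord dE) => //.
rewrite /principal_bound; case: asboolP => // _.
by rewrite ler_int ceil_le_int; apply/(ord_ge_ord dE) => //; exact: hf.
Qed.

Lemma principal_bound_antieffective : antieffective R Y (principal_bound f).
Proof.
split.
- split.
    apply: sub_finite_set (_ : finite_set ([set E | D E != 0] `|`
      [set E | prime_divisor Y E /\ ord E f != 0])).
      move=> E; rewrite /= /principal_bound; case: asboolP => [[pE _]|_].
        by rewrite intr_eq0; right.
      by move=> h; left; apply: contraNneq h => ->; rewrite ceil0.
    by rewrite finite_setU; split; [exact: divD.1|exact: (finite_ord_neq0 M)].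
  move=> E; rewrite /principal_bound; case: asboolP => [[pE _]//|_] h.
  by apply: divD.2; apply: contraNneq h => ->; rewrite ceil0.
- by move=> E; rewrite /principal_bound; case: ifP => _; exact: intr_int.
- move=> E eE; apply: (H0_restriction_global M eE f0 pushforward_principal_bound).
  by rewrite /principal_bound asboolT.
Qed.

End PrincipalBound.

Hypothesis exc_principal : forall E C, exceptional R Y E -> Y C -> C `<=` E ->
  exists t, ideal_stalk E C = span C [set t].

Lemma antieffective_envelope : exists Dt : set K -> Q,
  [/\ antieffective R Y Dt, div_le D Dt
    & forall D', antieffective R Y D' -> div_le D D' -> div_le Dt D'].
Proof.
pose above D' := antieffective R Y D' /\ div_le D D'.
have [f f0 hf] := pushforward_neq0.
pose Df := principal_bound f.
have aDf : above Df by split; [exact: principal_bound_antieffective|exact: principal_bound_ge].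
have above_int D' E : above D' -> D' E = (Num.floor (D' E))%:~R.
  by move=> [[_ iD' _] _]; apply/esym/eqP; rewrite -intrEfloor; exact: iD'.
have /choice[m hm] : forall E, exists D', above D' /\ forall D'', above D'' -> D' E <= D'' E.
  move=> E; pose c := Num.floor (D E).
  have cD D' : above D' -> c <= Num.floor (D' E) by move=> [_ DD']; exact: le_floor.
  (* Antieffective divisors above [D] have integral coefficients bounded below by [c], so the
     distance to [c] is a natural number and attains its minimum. *)
  have ex : exists j, `[< exists2 D', above D' & `|Num.floor (D' E) - c|%N = j >].
    by exists `|Num.floor (Df E) - c|%N; apply/asboolP; exists Df.
  have [j /asboolP[D' aD' jD'] minj] := ex_minnP ex.
  exists D'; split=> // D'' aD''; rewrite (above_int D') // (above_int D'') // ler_int.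
  have : (j <= `|Num.floor (D'' E) - c|)%N by apply: minj; apply/asboolP; exists D''.
  by have := cD _ aD'; have := cD _ aD''; rewrite -jD'; lia.
pose Dt E := m E E.
have Dt_min D' : above D' -> div_le Dt D' by move=> aD' E; exact: (hm E).2.
have DDt : div_le D Dt by move=> E; exact: (hm E).1.2.
exists Dt; split=> //; last by move=> D' aD' DD'; exact: Dt_min.
split.
- split.
    apply: sub_finite_set (_ : finite_set ([set E | D E != 0] `|` [set E | Df E != 0])).
      move=> E /= Dt0; have [D0|] := eqVneq (D E) 0; [right|by left].
      apply: contraNneq Dt0 => Df0; have := DDt E; have := Dt_min _ aDf E.
      by rewrite D0 Df0 => h1 h2; rewrite eq_le h1.
    by rewrite finite_setU; split; [exact: divD.1|case: aDf => -[[]]].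
  by move=> E; have [[[_ h] _ _] _] := (hm E).1; exact: h.
- by move=> E; have [[_ h _] _] := (hm E).1; exact: h.
(* The minimum at [E] is attained by [m E], which lies above [Dt] and agrees with it at [E]; its
   nonzero section therefore survives. *)
- move=> E eE; have [aE _] := hm E.
  apply: (H0_restriction_mono M exc_principal (D1 := m E) eE) => //; first exact: Dt_min.
  by case: aE => -[_ _ h] _; exact: h.
Qed.

End Envelope.

(** * From the geometric hypotheses to the theorem *)

Lemma germ_model_intro (k : closedFieldType) (K : fieldType) (iota : {rmorphism k -> K})
    (R : set K) (Y : set (set K)) : [pchar k] =i pred0 -> regular_local R ->
  smooth_germ iota R -> proper_model R Y -> (forall C, Y C -> regular_local C) ->
  germ_model (range iota) R Y.
Proof.
move=> char0 regR [[A [ftA regA [q pq Rq]]] fracR] pY regY.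
have rR : is_subring R by case: regR => -[].
have sk : subfield (range iota).
  split; last by move=> _ [x _ <-]; exists x^-1; rewrite ?fmorphV.
  apply/subringP; split; first by exists 1; rewrite ?rmorph1.
    by move=> _ _ [x _ <-] [y _ <-]; exists (x - y); rewrite ?rmorphB.
  by move=> _ _ [x _ <-] [y _ <-]; exists (x * y); rewrite ?rmorphM.
have [s As] := ftA.
have rA : is_subring A by rewrite As; exact: smallest_subring.
have kA : range iota `<=` A by rewrite As => x kx; apply: sub_gen_smallest; left.
have AR : A `<=` R by rewrite -Rq; exact: loc_sub.
have fR : frac_field R.
  move=> x; have : [set: K] x by []. rewrite -fracR => -[a Ra [b Rb <-]].
  have [->|b0] := eqVneq b 0; last by exists a, b.
  exists 0, 1; rewrite invr0 mulr0 mul0r oner_eq0; split=> //; [exact: subring0|exact: subring1].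
split=> //.
- by move=> n; rewrite -(rmorph_nat iota) fmorph_eq0 (pcharf0P k).1.
- exists s => S [rS iS] kS sS; apply/seteqP; split=> // x _.
  have AS : A `<=` S by rewrite As; apply: smallest_sub => // y [/kS|/sS].
  have [a [b [Ra Rb _ ->]]] := fR x.
  have RS : R `<=` S.
    rewrite -Rq => _ [u /AS Su [v [/AS Sv _] <-]]; apply: (subringM rS) => //; exact: iS.
  by apply: (subringM rS); [exact: RS|apply: iS; exact: RS].
- exact: subset_trans AR.
- rewrite -Rq; apply: fin_diff_localization => //.
  apply: (fin_diff_finite_type _ _ ftA); last by case: sk.
  by apply: fin_diff_base; case: sk.
- by case: regR.
(* A localization of [R] is also one of the affine ring [A], where regularity is assumed. *)
- move=> p pp; rewrite -Rq in pp *; rewrite loc_loc //; apply: regA.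
  by exists (p `&` A) => //; apply: prime_contract pp => //; exact: loc_sub.
Qed.

Unset Implicit Arguments.
Set Strict Implicit.
Set Printing Implicit Defensive.

Theorem theorem3p4 (k : closedFieldType) (char0 : [pchar k] =i pred0)
    (K : fieldType) (iota : {rmorphism k -> K}) (R : set K)
    (R_regular : regular_local R) (R_dim : prime_chain R 2)
    (R_germ : smooth_germ iota R)
    (a : set K) (a_ideal : is_ideal R a)
    (Y : set (set K)) (Y_logres : log_resolution R a Y)
    (Q : archiRealDomainType) (D : set K -> Q) (D_div : is_divisor Y D) :
  exists Dt : set K -> Q,
    unique (fun Dt : set K -> Q =>
      [/\ integral Dt,
          (defines_ideal R Y D -> effective Dt),
          antieffective R Y Dt,
          div_le D Dt
        & forall D' : set K -> Q,
            antieffective R Y D' -> div_le D D' -> div_le Dt D']) Dt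
    /\ equivalent Y Dt D.
Proof.
have [pY regY [F [_ _ _ _ sncF]]] := Y_logres.
have M := germ_model_intro char0 R_regular R_germ pY regY.
(* Simple normal crossings provide a local equation of each exceptional divisor. *)
have exc E C : exceptional R Y E -> Y C -> C `<=` E -> exists t, ideal_stalk E C = span C [set t].
  move=> eE YC CE; have [x _ hx] := sncF C YC.
  by have [|t _ tE] := hx E _ CE; [split; [case: eE|right]|exists t].
have [Dt [aDt DDt minDt]] := antieffective_envelope M D_div exc.
have [divDt intDt H0Dt] := aDt.
exists Dt; split.
  split; first split=> //.
  (* Off the exceptional locus [Dt] is at least [D], hence greater than -1, and being integral it is
     nonnegative. *)
  - move=> idD; apply: (antieffective_effective M exc divDt intDt) => // E pE nE.
    have := lt_le_trans (defines_ideal_nonexceptional M D_div idD pE nE) (DDt E).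
    by have /intrP[n ->] := intDt E; rewrite -[-1]/((-1)%:~R) ltr_int ler0z; lia.
  - move=> D' [_ _ aD' DD' minD']; apply/funext => E; apply/eqP; rewrite eq_le.
    by rewrite minDt // minD'.
rewrite /equivalent; apply/seteqP; split; first exact: (OYoppS M DDt).
move=> f hf; have [->|f0] := eqVneq f 0.
  by move=> E pE _; exact: (ord_ge_zero (divisor_dvr M pE)).
apply: (OYoppS M _ (pushforward_principal_bound M f0 hf)).
by apply: minDt; [exact: (principal_bound_antieffective M D_div f0 hf)|
  exact: (principal_bound_ge M f0 hf)].
Qed.
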